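(* Let $n\ge 4$ and let $1<p\le q$ be such that $F(p,q,n)=0$. Assume that $$(f_1,g_1)\in \big(H^1(\mathbf{R}^n)\cap L^q(\mathbf{R}^n)\big)\times L^2(\mathbf{R}^n),\qquad (f_2,g_2)\in H^1(\mathbf{R}^n)\times L^2(\mathbf{R}^n),$$ $$f_1(x)=f_2(x)=g_1(x)=g_2(x)=0\quad\text{for } |x|>R,\ \text{where } R>0,$$ and that $f_1,f_2,g_1,g_2$ are non-negative and that neither $g_1$ nor $g_2$ vanishes identically. For $\varepsilon>0$ consider the problem $$u_{tt}-\Delta u=|v|^p,\qquad v_{tt}-\Delta v=|u|^q\qquad\text{in } \mathbf{R}^n\times[0,T(\varepsilon)),$$ $$u(x,0)=\varepsilon f_1(x),\ u_t(x,0)=\varepsilon g_1(x),\ v(x,0)=\varepsilon f_2(x),\ v_t(x,0)=\varepsilon g_2(x)\qquad (x\in\mathbf{R}^n),$$ and suppose that it has a solution $(u,v)\in C\big([0,T(\varepsilon));(H^1(\mathbf{R}^n)\cap L^q(\mathbf{R}^n))\times H^1(\mathbf{R}^n)\big)$ with $(u_t,v_t)\in \big(C([0,T(\varepsilon));L^2(\mathbf{R}^n))\big)^2$ satisfying $$\mathrm{supp}(u,v,u_t,v_t)\subset\{(x,t)\in\mathbf{R}^n\times[0,T(\varepsilon))\ :\ |x|\le t+R\}.$$ Then there exist a positive constant $\varepsilon_0=\varepsilon_0(f_1,f_2,g_1,g_2,p,q,n,R)$ and a positive constant $C$ independent of $\varepsilon$ such that, for every $0<\varepsilon\le\varepsilon_0$,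 $T(\varepsilon)$ has to satisfy $$T(\varepsilon)\le\begin{cases}\exp\big(C\varepsilon^{-p(pq-1)}\big) & \text{if } p\ne q,\\ \exp\big(C\varepsilon^{-p(p-1)}\big) & \text{if } p=q.\end{cases}$$
   Context: For $p,q>1$ and $n\ge 2$, $$F(p,q,n)=\max\left\{\frac{q+2+p^{-1}}{pq-1},\ \frac{p+2+q^{-1}}{pq-1}\right\}-\frac{n-1}{2}.$$ Here $T(\varepsilon)\in(0,\infty]$ is the existence time of the solution $(u,v)$ under consideration; the constants $\varepsilon_0$ and $C$ do not depend on $\varepsilon$. The unknowns $u,v$ are real-valued. The equations are understood in the sense of distributions on $\mathbf{R}^n\times(0,T(\varepsilon))$, and the initial conditions are attained in the sense of the stated continuity in time of $u,v,u_t,v_t$. *)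

(* Defs.v *)
From HB Require Import structures.
From mathcomp Require Import all_boot all_order all_algebra.
From mathcomp Require Import all_classical all_reals all_analysis.

Set Implicit Arguments.
Unset Strict Implicit.
Unset Printing Implicit Defensive.

Import Order.TTheory GRing.Theory Num.Theory.
Import numFieldNormedType.Exports.

Local Open Scope classical_set_scope.
Local Open Scope ring_scope.

Section rV_measurable.
Context (R : realType) (n : nat).

Let coord (i : 'I_n) (x : 'rV[R]_n) : R := x ord0 i.

Let rV_set0 : g_sigma_preimage coord set0.
Proof. exact: sigma_algebra0. Qed.

Let rV_setC A : g_sigma_preimage coord A -> g_sigma_preimage coord (~` A).
Proof. exact: sigma_algebraC. Qed.

Let rV_bigcup (F : _^nat) : (forall i, g_sigma_preimage coord (F i)) ->
  g_sigma_preimage coord (\bigcup_i (F i)).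
Proof. exact: sigma_algebra_bigcup. Qed.

(* The product sigma-algebra on R^n (the one generated by the coordinates, as
   the library does for [n.-tuple R]); it is the Borel sigma-algebra. *)
HB.instance Definition _ := @isMeasurable.Build default_measure_display
  'rV[R]_n (g_sigma_preimage coord) rV_set0 rV_setC rV_bigcup.

Lemma measurable_rV_coord (i : 'I_n) :
  measurable_fun setT (fun x : 'rV[R]_n => x ord0 i).
Proof.
move=> _ Y mY; rewrite setTI; apply: sub_sigma_algebra.
by rewrite -bigcup_seq /=; exists i; [rewrite /= mem_index_enum|exists Y; rewrite ?setTI].
Qed.

Lemma measurable_fun_rVP d (T : measurableType d) (f : T -> 'rV[R]_n) :
  (forall i, measurable_fun setT (fun t => f t ord0 i)) ->
  measurable_fun setT f.
Proof.
move=> mf; apply: (measurability (\big[setU/set0]_(i < n)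
  preimage_set_system setT (coord i) measurable)) => //.
move=> _ [B + <-]; rewrite -bigcup_seq => -[i /= _ [Y mY <-]].
by rewrite setTI -comp_preimage; exact: mf.
Qed.

End rV_measurable.

Section lebesgue_rV.
Context (R : realType).

Definition cons_rV n (z : 'rV[R]_n * R) : 'rV[R]_n.+1 :=
  \row_(j < n.+1) oapp (z.1 ord0) z.2 (unlift ord0 j).

Lemma measurable_cons_rV n : measurable_fun setT (@cons_rV n).
Proof.
apply: measurable_fun_rVP => i; case: (unliftP ord0 i) => [j|] ->.
  rewrite (_ : (fun _ => _) = (fun x : 'rV[R]_n => x ord0 j) \o fst).
    by apply: measurableT_comp; [exact: measurable_rV_coord|exact: measurable_fst].
  by apply/funext => z; rewrite mxE liftK.
rewrite (_ : (fun _ => _) = snd); first exact: measurable_snd.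
by apply/funext => z; rewrite mxE unlift_none.
Qed.

(* Lebesgue measure on R^n, as the n-fold product of the Lebesgue measure of R. *)
Fixpoint lebesgue_rV n : {measure set 'rV[R]_n -> \bar R} :=
  match n with
  | 0 => \d_ (0 : 'rV[R]_0)
  | m.+1 => measure_function_pushforward__canonical__measure_function_Measure
      (lebesgue_rV m \x lebesgue_measure)%E (@measurable_cons_rV m)
  end.

Lemma lebesgue_rV_box n (A : 'I_n -> set R) : (forall i, measurable (A i)) ->
  lebesgue_rV n [set x | forall i, A i (x ord0 i)] =
  (\prod_(i < n) lebesgue_measure (A i))%E.
Proof.
elim: n A => [|n IH] A mA.
  by rewrite big_ord0 /= diracE mem_set// => -[].
have mB : measurable [set x : 'rV[R]_n | forall i, A (lift ord0 i) (x ord0 i)].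
  rewrite [X in measurable X](_ : _ =
      \big[setI/setT]_(i < n) ((fun x : 'rV[R]_n => x ord0 i) @^-1` A (lift ord0 i))); last first.
    rewrite -bigcap_seq; apply/seteqP; split=> x /= h i; first by move=> _; exact: h.
    by apply: (h i); rewrite /= mem_index_enum.
  apply: bigsetI_measurable => i _; rewrite -[X in measurable X]setTI.
  exact: measurable_rV_coord.
rewrite big_ord_recl muleC -(IH _ (fun i => mA (lift ord0 i))).
rewrite -(product_measure1E (lebesgue_rV n) lebesgue_measure mB (mA ord0)).
rewrite /= /pushforward; congr product_measure1.
apply/seteqP; split=> [[x t] /= h|[x t] /= [h1 h2] i].
  split; first by move=> i; have := h (lift ord0 i); rewrite mxE liftK.
  by have := h ord0; rewrite mxE unlift_none.
by rewrite mxE; case: unliftP => [j|] ->.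
Qed.

End lebesgue_rV.

Section function_spaces.
Context (R : realType).

(* The library's norm on ['rV[R]_n] is the sup norm. *)
Definition enorm n (x : 'rV[R]_n) : R := Num.sqrt (\sum_(i < n) x ord0 i ^+ 2).

Definition smooth (V : normedModType R) (f : V -> R) : Prop :=
  forall (s : seq V) (x : V), differentiable (foldr (fun v g => 'D_v g) f s) x.

Definition test_function (V : normedModType R) (D : set V) (f : V -> R) : Prop :=
  [/\ smooth f, compact (closure [set x | f x != 0]) &
      closure [set x | f x != 0] `<=` D].

Definition partial n (i : 'I_n) (f : 'rV[R]_n -> R) : 'rV[R]_n -> R :=
  'D_(delta_mx ord0 i) f.

Definition weak_partial n (i : 'I_n) (f g : 'rV[R]_n -> R) : Prop :=
  forall phi, test_function setT phi ->
    \int[lebesgue_rV R n]_x (f x * partial i phi x) =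
    - \int[lebesgue_rV R n]_x (g x * phi x).

Definition Lp n (p : R) : set ('rV[R]_n -> R) :=
  [set f | f \in Lfun (lebesgue_rV R n) p%:E].

Definition Lp_norm n (p : R) (f : 'rV[R]_n -> R) : \bar R :=
  'N[lebesgue_rV R n]_p%:E [EFin \o f].

Definition H1 n : set ('rV[R]_n -> R) :=
  [set f | Lp 2 f /\ forall i, exists2 g, Lp 2 g & weak_partial i f g].

(* The weak derivative is unique up to a null set; one representative is
   selected. The value is junk outside of H^1. *)
Definition wpartial n (i : 'I_n) (f : 'rV[R]_n -> R) : 'rV[R]_n -> R :=
  xget (fun=> 0) [set g | Lp 2 g /\ weak_partial i f g].

Definition H1_norm n (f : 'rV[R]_n -> R) : \bar R :=
  ((Lp_norm 2 f `^ 2 + \sum_(i < n) Lp_norm 2 (wpartial i f) `^ 2) `^ 2^-1)%E.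

End function_spaces.

Section wave_system.
Context (R : realType) (n : nat).
(* A function w on R^n x [0,T) is curried, time first: [w t] is a function on
   R^n, i.e. a representative of an element of the space at hand. *)
Implicit Types (T : \bar R) (w : R -> 'rV[R]_n -> R).

Definition time_interval T : set R := [set t | 0 <= t /\ (t%:E < T)%E].

Definition open_time_interval T : set R := [set t | 0 < t /\ (t%:E < T)%E].

Definition continuous_in T (X : set ('rV[R]_n -> R))
    (N : ('rV[R]_n -> R) -> \bar R) w : Prop :=
  (forall t, time_interval T t -> X (w t)) /\
  (forall t, time_interval T t ->
     N (w s \- w t) @[s --> within (time_interval T) (nbhs t)] --> 0%E).

(* As w t is only defined almost everywhere, w vanishes on U when each slice
   [w s] vanishes a.e. on the corresponding slice of U. *)
Definition supp T w : set ('rV[R]_n * R) :=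
  [set z | time_interval T z.2 /\
    ~ exists2 U, nbhs z U & forall s, time_interval T s ->
        {ae lebesgue_rV R n, forall y, U (y, s) -> w s y = 0}].

Definition dt (phi : 'rV[R]_n * R -> R) : 'rV[R]_n * R -> R := 'D_(0, 1) phi.

Definition dx (i : 'I_n) (phi : 'rV[R]_n * R -> R) : 'rV[R]_n * R -> R :=
  'D_(delta_mx ord0 i, 0) phi.

Definition laplacian (phi : 'rV[R]_n * R -> R) : 'rV[R]_n * R -> R :=
  fun z => \sum_(i < n) dx i (dx i phi) z.

Definition test_function_slab T : ('rV[R]_n * R -> R) -> Prop :=
  test_function [set z | open_time_interval T z.2].

(* w acts on psi as the L^2-valued (or L^1-valued) curve t |-> w t: the iterated
   integral needs no joint measurability of the representatives w t. *)
Definition pairing T w (psi : 'rV[R]_n * R -> R) : R :=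
  \int[lebesgue_measure]_(t in open_time_interval T)
    \int[lebesgue_rV R n]_x (w t x * psi (x, t)).

Definition time_derivative T w wt : Prop :=
  forall phi, test_function_slab T phi ->
    pairing T w (dt phi) = - pairing T wt phi.

(* w_tt - Laplacian w = h, both derivatives being moved to the test function. *)
Definition wave_equation T w h : Prop :=
  forall phi, test_function_slab T phi ->
    pairing T w (fun z => dt (dt phi) z - laplacian phi z) = pairing T h phi.

Record solution (p q r eps : R) (f1 g1 f2 g2 : 'rV[R]_n -> R) T
    (u v ut vt : R -> 'rV[R]_n -> R) : Prop := Solution {
  solution_u_H1 : continuous_in T (@H1 R n) (@H1_norm R n) u;
  solution_u_Lq : continuous_in T (Lp q) (Lp_norm q) u;
  solution_v_H1 : continuous_in T (@H1 R n) (@H1_norm R n) v;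
  solution_ut_L2 : continuous_in T (Lp 2) (Lp_norm 2) ut;
  solution_vt_L2 : continuous_in T (Lp 2) (Lp_norm 2) vt;
  solution_ut : time_derivative T u ut;
  solution_vt : time_derivative T v vt;
  solution_u_eq : wave_equation T u (fun t x => `|v t x| `^ p);
  solution_v_eq : wave_equation T v (fun t x => `|u t x| `^ q);
  solution_u0 : {ae lebesgue_rV R n, forall x, u 0 x = eps * f1 x};
  solution_ut0 : {ae lebesgue_rV R n, forall x, ut 0 x = eps * g1 x};
  solution_v0 : {ae lebesgue_rV R n, forall x, v 0 x = eps * f2 x};
  solution_vt0 : {ae lebesgue_rV R n, forall x, vt 0 x = eps * g2 x};
  solution_supp : supp T u `|` supp T v `|` supp T ut `|` supp T vt
    `<=` [set z | time_interval T z.2 /\ enorm z.1 <= z.2 + r] }.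

End wave_system.

Definition F (R : realType) (p q : R) (n : nat) : R :=
  Num.max ((q + 2 + p^-1) / (p * q - 1)) ((p + 2 + q^-1) / (p * q - 1))
  - (n%:R - 1) / 2.

(* Main.v *)
(* Let [psi] be a nonnegative solution of the free wave equation on the cone [|x| <= t + r],
   cut off in time after [X] and before [expR d * X]. Testing the equation of [v] with it, and
   using Hoelder's inequality on the region where the cutoff varies, bounds the p-th power of
   [int_0^X int |u|^q psi] plus a data term by the integral of [|v|^p] over
   [X <= t <= expR d * X]. For [psi] a superposition of the Lorentz-invariant powers
   [((t + l)^2 - |x|^2)^(-(n-1)/2)], which is [>= c (1 + t)^(-beta)] with
   [beta = (n-1)/2 - 1/p], the Hoelder factor contains only a logarithm of [X]. The equation of
   [u], tested with [psi = 1], returns to [|u|^q], and at the critical exponent all powers of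
   [X] cancel. Hence [L(s) = int_0^(exp s) (1 + t)^(-beta) int |u|^q dx dt] satisfies
   [L(s)^(pq) <= C d^(-m) (1 + s)^(q(p-1)) (L(s + d) - L(s))] for [0 < d <= 1], while the data
   give [L(s + 2) - L(s) >= c eps^(pq)]; iterating with geometrically decreasing [d] makes [L]
   infinite before [s] reaches a multiple of [eps^(-p(pq-1))]. If [p = q], the first test
   function is used in both equations. *)
Require Import Defs.
From mathcomp Require Import all_boot all_order all_algebra.
From mathcomp Require Import all_classical all_reals all_analysis.
From mathcomp Require Import ring lra measurable_realfun.

Set Implicit Arguments.
Unset Strict Implicit.
Unset Printing Implicit Defensive.

Import Order.TTheory GRing.Theory Num.Theory.
Import numFieldNormedType.Exports.

Local Open Scope classical_set_scope.
Local Open Scope ring_scope.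

(** * Smooth functions of one variable *)

(** Exponents. Put [nu = (n-1)/2]. The superposed weight carries [gam = nu + 1/p], the value at
    which the [p/(p-1)]-th power of its transverse decay [s^(gam-nu-1)] is exactly [1/s]: this is
    the source of the logarithm, hence of [(1+s)^(q(p-1))]. A single power decays like
    [s^(-(nu+1))], whose power is summable, so the data inequality has no logarithm and yields the
    same gain on every interval of length 2. The blow-up balance [K^(kap-mu) b^(kap-1) <= C] with
    [kap = pq], [mu = q(p-1)], [b ~ eps^(pq)] gives [eps^(-p(pq-1))]; with [kap = p], [mu = p-1],
    [b ~ eps^p] it gives [eps^(-p(p-1))]. Obstacles. Test functions live in the open slab, so the
    data at time 0 are recovered by a second cutoff of width [del] tending to 0. Solutions are
    curves without joint measurability, so Hoelder's inequality on space-time is obtained from a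
    Young inequality with parameter, integrated slice by slice and optimised afterwards. As [v] is
    only known in [L^2], integrability of [|v|^p] needs [p <= 2], which the critical relation forces
    for [n >= 4]. *)

Section real_powers.
Variable R : realType.
Implicit Types x y a b : R.

Lemma eq_leW x y : x = y -> x <= y.
Proof. by move->. Qed.

Lemma powRD_gt0 x a b : 0 < x -> x `^ (a + b) = x `^ a * x `^ b.
Proof. by move=> x0; rewrite powRD//; apply/implyP => _; rewrite gt_eqF. Qed.

Lemma powR_pred x a : 0 < x -> x `^ a = x * x `^ (a - 1).
Proof.
by move=> x0; rewrite -[X in X * _](powRr1 (ltW x0)) -powRD_gt0// addrC subrK.
Qed.

End real_powers.

Section smooth_one_variable.
Variable R : realType.
Implicit Types f g : R -> R.

(* Coinductively: [f] lies in some class of differentiable functions stable by derivation. *)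
Definition Cinf f := exists2 P : (R -> R) -> Prop, P f &
  forall g, P g -> exists2 g', P g' & forall x, is_derive (x : R) (1 : R) g (g' x).

Lemma Cinf_derive f : Cinf f -> exists2 f', Cinf f' & forall x, is_derive (x : R) (1 : R) f (f' x).
Proof.
by move=> [P Pf HP]; have [f' Pf' ff'] := HP _ Pf; exists f' => //; exists P.
Qed.

Lemma Cinf_is_derive f : Cinf f -> forall x, is_derive (x : R) (1 : R) f (derive1 f x).
Proof.
by move=> /Cinf_derive[f' _ ff'] x; rewrite derive1E; apply/derivableP; have [] := ff' x.
Qed.

Lemma Cinf_derive1 f : Cinf f -> Cinf (derive1 f).
Proof.
move=> /Cinf_derive[f' cf' ff']; rewrite (_ : derive1 f = f')//.
by apply/funext => x; rewrite derive1E; have [_ ->] := ff' x.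
Qed.

Lemma Cinf_continuous f : Cinf f -> continuous f.
Proof.
move=> cf x; apply: differentiable_continuous; apply/derivable1_diffP.
by have [] := Cinf_is_derive cf x.
Qed.

(** By the Leibniz and quotient rules this class contains a derivative of each of its members, so it
    can serve as the stable class demanded by [Cinf]. All closure properties of [Cinf] then follow
    from one induction. *)
Inductive Cinf_closure : (R -> R) -> Prop :=
| Cinf_base f of Cinf f : Cinf_closure f
| Cinf_add f g of Cinf_closure f & Cinf_closure g : Cinf_closure (f \+ g)
| Cinf_mul f g of Cinf_closure f & Cinf_closure g : Cinf_closure (f \* g)
| Cinf_inv f of Cinf_closure f & (forall x, f x != 0) : Cinf_closure (fun x => (f x)^-1).

Lemma Cinf_cst (c : R) : Cinf (fun=> c).
Proof.
exists (fun f => exists c, f = fun=> c); first by exists c.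
by move=> _ [d ->]; exists (fun=> 0); [exists 0|move=> x; exact: is_derive_cst].
Qed.

Lemma Cinf_closureP f : Cinf_closure f -> Cinf f.
Proof.
move=> cf; exists Cinf_closure => // {f cf} f; elim => {f}.
- by move=> f /Cinf_derive[f' cf' df]; exists f' => //; exact: Cinf_base.
- move=> f g _ [f' cf' df] _ [g' cg' dg].
  by exists (f' \+ g'); [exact: Cinf_add|move=> x; exact: is_deriveD].
- move=> f g cf [f' cf' df] cg [g' cg' dg].
  exists ((f \* g') \+ (g \* f')); first by apply: Cinf_add; apply: Cinf_mul.
  by move=> x; exact: is_deriveM.
- move=> f cf [f' cf' df] f0.
  exists ((fun=> -1) \* (f' \* ((fun x => (f x)^-1) \* (fun x => (f x)^-1)))).
    apply: Cinf_mul; first by apply: Cinf_base; exact: Cinf_cst.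
    by apply: Cinf_mul => //; apply: Cinf_mul; exact: Cinf_inv.
  move=> x; apply: (is_derive_eq (is_deriveV (f0 x) (df x))).
  by rewrite /= /GRing.scale/= -invrM ?unitfE//; field.
Qed.

Lemma CinfD f g : Cinf f -> Cinf g -> Cinf (f \+ g).
Proof. by move=> cf cg; apply: Cinf_closureP; apply: Cinf_add; exact: Cinf_base. Qed.

Lemma CinfM f g : Cinf f -> Cinf g -> Cinf (f \* g).
Proof. by move=> cf cg; apply: Cinf_closureP; apply: Cinf_mul; exact: Cinf_base. Qed.

Lemma CinfV f : Cinf f -> (forall x, f x != 0) -> Cinf (fun x => (f x)^-1).
Proof. by move=> cf f0; apply: Cinf_closureP; apply: Cinf_inv => //; exact: Cinf_base. Qed.

Lemma is_derive_affine (a b : R) f (x df : R) :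
  is_derive (a * x + b) (1 : R) f df -> is_derive x (1 : R) (fun y => f (a * y + b)) (a * df).
Proof.
move=> h.
have ha : is_derive x 1 (fun y => a * y + b) (a : R).
  have h1 := is_deriveZ a (is_derive_id x (1:R)).
  have h2 := is_derive_cst (b : R) x (1:R).
  by apply: (is_derive_eq (is_deriveD h1 h2)); rewrite addr0 /GRing.scale/= mulr1.
have hc := @is_derive1_comp R f (fun y => a * y + b) x df a h ha.
by apply: (is_derive_eq hc); rewrite mulrC.
Qed.

Lemma Cinf_affine (a b : R) f : Cinf f -> Cinf (fun y => f (a * y + b)).
Proof.
move=> cf.
(* The factor [c] absorbs the powers of [a] that the chain rule produces, which makes the class
   stable. *)
exists (fun g => exists c f, Cinf f /\ g = fun y => c * f (a * y + b)).
  by exists 1, f; split => //; apply/funext => y; rewrite mul1r.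
move=> _ [c [h [ch ->]]]; have [h' ch' dh] := Cinf_derive ch.
exists (fun y => (c * a) * h' (a * y + b)); first by exists (c * a), h'.
move=> x; have hd := is_deriveZ c (is_derive_affine (dh (a * x + b))).
apply: (is_derive_eq hd).
by rewrite /GRing.scale/= mulrA.
Qed.


(** Each multiplication by ['X] uses up half of the rate, since [y <= (2 / a) * expR (a / 2 * y)];
    the other half is left to the induction hypothesis. *)
Lemma poly_expR_bound (p : {poly R}) (a : R) : 0 < a ->
  exists2 C : R, 0 <= C & forall y, 0 <= y -> `|p.[y]| <= C * expR (a * y).
Proof.
elim/poly_ind: p a => [|p c IH] a a0.
  by exists 0 => // y _; rewrite horner0 normr0 mul0r.
have a2 : 0 < a / 2 by rewrite divr_gt0.
have [C C0 HC] := IH _ a2.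
exists (C * (2 / a) + `|c|); first by rewrite addr_ge0// mulr_ge0// divr_ge0// ltW.
move=> y y0; rewrite hornerMXaddC mulrDl (le_trans (ler_normD _ _))// lerD//.
  rewrite normrM (ger0_norm y0) [X in expR X](_ : _ = a / 2 * y + a / 2 * y); last by field.
  rewrite expRD (_ : _ * _ * _ = (C * expR (a / 2 * y)) * (2 / a * expR (a / 2 * y))); last by ring.
  apply: ler_pM => //; first exact: HC.
  rewrite mulrC -ler_pdivrMr ?divr_gt0// invf_div mulrC.
  by apply: le_trans (expR_ge1Dx _); rewrite ler_wpDl// ?ler01.
by rewrite ler_peMr// -expR0 ler_expR mulr_ge0// ltW.
Qed.

(** Meant for the junction point 0 of [flat], where the rules of differentiation do not apply. *)
Lemma is_derive_quadratic f (x C : R) :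
  (forall h, `|f (x + h) - f x| <= C * h ^+ 2) -> is_derive x (1 : R) f 0.
Proof.
move=> H.
have C0 : 0 <= C by have := H 1; rewrite expr1n mulr1; apply: le_trans.
have lim0 : (fun h : R => h^-1 *: (f (h *: (1 : R) + x) - f x)) @ 0^' --> (0 : R).
  apply/cvgrPdist_le => e e0; near=> h.
  rewrite sub0r normrN /GRing.scale/= mulr1 normrM normfV.
  have h0 : 0 < `|h| by rewrite normr_gt0; near: h; exact: nbhs_dnbhs_neq.
  rewrite mulrC ler_pdivrMr// [h + x]addrC (le_trans (H _))//.
  rewrite -real_normK ?num_real// expr2 mulrA ler_wpM2r//.
  apply: (@le_trans _ _ ((C + 1) * `|h|)); first by rewrite ler_wpM2r// lerDl.
  rewrite -ler_pdivlMl ?ltr_pwDr// mulrC; near: h.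
  apply: dnbhs0_le; rewrite divr_gt0// ltr_pwDr//.
by apply: DeriveDef; [exact: cvgP lim0|exact: cvg_lim lim0].
Unshelve. all: by end_near. Qed.

Definition flat (p : {poly R}) (x : R) : R :=
  if 0 < x then p.[x^-1] * expR (- x^-1) else 0.

Lemma flat_is_derive (p : {poly R}) x :
  is_derive x (1 : R) (flat p) (flat ('X^2 * (p - p^`())) x).
Proof.
have [x0|x0|->] := ltrgt0P x.
- have hV := is_deriveV (lt0r_neq0 x0) (is_derive_id x (1 : R)).
  have h1 := @is_derive1_comp R (horner p) (fun y => y^-1) x _ _ (is_derive_poly p x^-1) hV.
  have h2 := @is_derive1_comp R expR (fun y => - y^-1) x _ _ (is_derive_expR (- x^-1))
    (is_deriveN hV).
  have h3 := is_deriveM h1 h2.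
  rewrite /flat x0.
  apply: (@near_eq_is_derive _ _ _ ((horner p \o GRing.inv) \* (expR \o (fun y => - y^-1)))) => //.
  + near=> y; rewrite /= ifT//; near: y; exact: lt_nbhsr.
  + apply: (is_derive_eq h3); rewrite /GRing.scale/= !hornerE/=; field.
    exact: lt0r_neq0.
- rewrite /flat ltNge (ltW x0)/=.
  apply: (@near_eq_is_derive _ _ _ (fun=> 0)) => //.
  + near=> y; rewrite ltNge ifF//; apply/negbTE/negPn/ltW; near: y; exact: lt_nbhsl.
- rewrite {2}/flat ltxx.
  (* Taken at [y = h^-1], this bound says that [flat p h] is at most [C * h ^+ 2] in absolute
     value. *)
  have [C C0 HC] := poly_expR_bound (p * 'X^2) ltr01.
  apply: (@is_derive_quadratic _ _ C) => h; rewrite add0r {2}/flat ltxx subr0 /flat.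
  case: ifPn => [h0|_]; last by rewrite normr0 mulr_ge0// sqr_ge0.
  have hV0 : 0 <= h^-1 by rewrite invr_ge0 ltW.
  have := HC _ hV0; rewrite mul1r hornerM hornerXn normrM [X in _ * X]ger0_norm ?exprn_ge0//.
  rewrite normrM [`|expR _|]ger0_norm ?expR_ge0// expRN => H.
  rewrite ler_pdivrMr ?expR_gt0// mulrAC -ler_pdivrMr ?exprn_gt0//.
  by rewrite -exprVn.
Unshelve. all: by end_near. Qed.

Lemma Cinf_flat p : Cinf (flat p).
Proof.
exists (fun f => exists p, f = flat p); first by exists p.
move=> _ [q ->]; exists (flat ('X^2 * (q - q^`()))); first by eexists.
exact: flat_is_derive.
Qed.

Lemma flat1_ge0 x : 0 <= flat 1 x.
Proof. by rewrite /flat; case: ifP => // _; rewrite hornerE mul1r expR_ge0. Qed.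

Lemma flat1_gt0 x : 0 < x -> 0 < flat 1 x.
Proof. by rewrite /flat => ->; rewrite hornerE mul1r expR_gt0. Qed.

Lemma flat1_eq0 x : x <= 0 -> flat 1 x = 0.
Proof. by rewrite /flat leNgt => /negbTE ->. Qed.

(** Smooth transition from 0 on [y <= 1] to 1 on [2 <= y]. Both the cutoffs in time and the smooth
    substitutes for real powers are made from it. *)
Definition step (y : R) : R := flat 1 (y - 1) / (flat 1 (y - 1) + flat 1 (2 - y)).

Lemma step_den_gt0 y : 0 < flat 1 (y - 1) + flat 1 (2 - y).
Proof.
have [y1|y1] := ltP 1 y.
  by rewrite ltr_wpDr ?flat1_ge0// flat1_gt0// subr_gt0.
by rewrite ltr_wpDl ?flat1_ge0// flat1_gt0//; lra.
Qed.

Lemma Cinf_step : Cinf step.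
Proof.
have h1 : Cinf (fun y : R => flat 1 (y - 1)).
  by have := Cinf_affine 1 (-1) (Cinf_flat 1); under eq_fun do rewrite mul1r.
have h2 : Cinf (fun y : R => flat 1 (2 - y)).
  by have := Cinf_affine (-1) 2 (Cinf_flat 1); under eq_fun do rewrite mulN1r addrC.
apply: CinfM => //; apply: CinfV; first exact: CinfD.
by move=> x; rewrite gt_eqF// step_den_gt0.
Qed.

Lemma step0 y : y <= 1 -> step y = 0.
Proof. by move=> y1; rewrite /step flat1_eq0 ?mul0r// subr_le0. Qed.

Lemma step1 y : 2 <= y -> step y = 1.
Proof.
move=> y2; rewrite /step [flat 1 (2 - y)]flat1_eq0 ?subr_le0// addr0 divff//.
by rewrite gt_eqF// flat1_gt0//; lra.
Qed.

Lemma step_ge0 y : 0 <= step y.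
Proof. by rewrite /step divr_ge0 ?flat1_ge0// ltW// step_den_gt0. Qed.

Lemma step_le1 y : step y <= 1.
Proof. by rewrite /step ler_pdivrMr ?step_den_gt0// mul1r lerDl flat1_ge0. Qed.

Lemma derive1_locally_cst f (x c : R) : (\near x, f x = c) -> derive1 f x = 0.
Proof.
move=> h; rewrite derive1E (@near_eq_derive _ _ _ f (fun=> c)) ?oner_neq0//.
exact: derive_cst.
Qed.

Lemma derive1_step_eq0 y : ~~ (1 <= y <= 2) -> derive1 step y = 0.
Proof.
rewrite negb_and -!ltNge => /orP[y1|y2].
  apply: (@derive1_locally_cst _ _ 0); near=> z; apply: step0.
  by apply: ltW; near: z; exact: lt_nbhsl.
apply: (@derive1_locally_cst _ _ 1); near=> z; apply: step1.
by apply: ltW; near: z; exact: lt_nbhsr.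
Unshelve. all: by end_near. Qed.

Lemma derive2_step_eq0 y : ~~ (1 <= y <= 2) -> derive1 (derive1 step) y = 0.
Proof.
rewrite negb_and -!ltNge => /orP[y1|y2].
  apply: (@derive1_locally_cst _ _ 0); near=> z; apply: derive1_step_eq0.
  by rewrite negb_and -!ltNge; apply/orP; left; near: z; exact: lt_nbhsl.
apply: (@derive1_locally_cst _ _ 0); near=> z; apply: derive1_step_eq0.
by rewrite negb_and -!ltNge; apply/orP; right; near: z; exact: lt_nbhsr.
Unshelve. all: by end_near. Qed.

Lemma continuous_bounded_outside f (a b : R) : a <= b -> continuous f ->
  (forall y, ~~ (a <= y <= b) -> f y = 0) -> exists2 C : R, 0 < C & forall y, `|f y| <= C.
Proof.
move=> ab cf f0.
have [c _ hc] := @EVT_max _ (fun y => `|f y|) a b ab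
  (continuous_subspaceT (fun y => continuous_comp (cf y) (@norm_continuous _ _ _))).
exists (`|f c| + 1); first by rewrite ltr_wpDl.
move=> y; have [yab|/f0 ->] := boolP (a <= y <= b); last by rewrite normr0 addr_ge0.
by rewrite (le_trans (hc y _)) ?in_itv// lerDl.
Qed.

Lemma step_derive_bounded : exists2 C : R, 0 < C &
  forall y, `|derive1 step y| <= C /\ `|derive1 (derive1 step) y| <= C.
Proof.
have c1 := Cinf_continuous (Cinf_derive1 Cinf_step).
have c2 := Cinf_continuous (Cinf_derive1 (Cinf_derive1 Cinf_step)).
have h12 : (1 : R) <= 2 by rewrite ler1n.
have [C1 C10 H1] := continuous_bounded_outside h12 c1 derive1_step_eq0.
have [C2 C20 H2] := continuous_bounded_outside h12 c2 derive2_step_eq0.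
exists (C1 + C2); first exact: addr_gt0.
by move=> y; split; [rewrite (le_trans (H1 y))// lerDl ltW|rewrite (le_trans (H2 y))// lerDr ltW].
Qed.

(** A real power is smooth only on the positive half-line. A coefficient that vanishes below 1 makes
    the product rule valid everywhere, and the derivative is again a sum of such products. *)
Inductive powR_closure : (R -> R) -> Prop :=
| powR_base f a of Cinf f & (forall y, y < 1 -> f y = 0) :
    powR_closure (fun y => f y * y `^ a)
| powR_add f g of powR_closure f & powR_closure g : powR_closure (f \+ g).

Lemma is_derive_mul_powR f a x : Cinf f -> (forall y, y < 1 -> f y = 0) ->
  is_derive x (1 : R) (fun y => f y * y `^ a)
    (derive1 f x * x `^ a + a * f x * x `^ (a - 1)).
Proof.
move=> cf f0; have [x1|x1] := ltP x 1.
  apply: (@near_eq_is_derive _ _ _ (fun=> 0)).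
    by near=> y; rewrite f0 ?mul0r//; near: y; exact: lt_nbhsl.
  rewrite (@derive1_locally_cst _ _ 0); last first.
    by near=> y; apply: f0; near: y; exact: lt_nbhsl.
  by rewrite f0// mulr0 !mul0r addr0; exact: is_derive_cst.
have h := is_deriveM (Cinf_is_derive cf x) (is_derive1_powR a (lt_le_trans ltr01 x1)).
by apply: (is_derive_eq h); rewrite /GRing.scale/=; ring.
Unshelve. all: by end_near. Qed.

Lemma Cinf_mul_powR f a : Cinf f -> (forall y, y < 1 -> f y = 0) ->
  Cinf (fun y => f y * y `^ a).
Proof.
move=> cf f0; exists powR_closure; first exact: powR_base.
move=> {cf f0 a f} f; elim => {f}.
- move=> f a cf f0.
  exists ((fun y => derive1 f y * y `^ a) \+ (fun y => (a * f y) * y `^ (a - 1))).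
    apply: powR_add; apply: powR_base; first exact: Cinf_derive1.
    + move=> y y1; apply: (@derive1_locally_cst _ _ 0); near=> z.
      by apply: f0; near: z; exact: lt_nbhsl.
    + exact: CinfM (Cinf_cst a) cf.
    + by move=> y y1; rewrite f0// mulr0.
  by move=> x; exact: is_derive_mul_powR.
- move=> f g _ [f' cf' df] _ [g' cg' dg].
  by exists (f' \+ g'); [exact: powR_add|move=> x; exact: is_deriveD].
Unshelve. all: by end_near. Qed.

(* [y `^ a] made smooth on the whole line; it is unchanged for [2 <= y]. *)
Definition cut_powR (a y : R) : R := step y * y `^ a.

Lemma Cinf_cut_powR a : Cinf (cut_powR a).
Proof. by apply: Cinf_mul_powR => [|y y1]; [exact: Cinf_step|rewrite step0// ltW]. Qed.

Lemma cut_powRE a y : 2 <= y -> cut_powR a y = y `^ a.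
Proof. by move=> y2; rewrite /cut_powR step1// mul1r. Qed.

Lemma cut_powR_eq0 a y : y <= 1 -> cut_powR a y = 0.
Proof. by move=> y2; rewrite /cut_powR step0// mul0r. Qed.

Lemma derive1_cut_powR a y : 2 < y -> derive1 (cut_powR a) y = a * y `^ (a - 1).
Proof.
move=> y2; rewrite derive1E.
have -> : 'D_1 (cut_powR a) y = 'D_1 (@powR R ^~ a) y.
  by apply: near_eq_derive; near=> z; apply: cut_powRE; apply: ltW; near: z; exact: lt_nbhsr.
have y0 : 0 < y by rewrite (lt_trans _ y2).
by have [_ ->] := is_derive1_powR a y0.
Unshelve. all: by end_near. Qed.

Lemma derive2_cut_powR a y : 2 < y ->
  derive1 (derive1 (cut_powR a)) y = a * (a - 1) * y `^ (a - 2).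
Proof.
move=> y2; rewrite derive1E.
have -> : 'D_1 (derive1 (cut_powR a)) y = 'D_1 (fun y => a *: y `^ (a - 1)) y.
  by apply: near_eq_derive; near=> z; apply: derive1_cut_powR; near: z; exact: lt_nbhsr.
have y0 : 0 < y by rewrite (lt_trans _ y2).
have [_ ->] := is_deriveZ a (is_derive1_powR (a - 1) y0).
by rewrite /GRing.scale/= mulrA; congr (_ * _ `^ _); ring.
Unshelve. all: by end_near. Qed.

End smooth_one_variable.

(** * Smooth functions on space-time *)

Section smooth_expressions.
Variables (R : realType) (V : normedModType R).
Implicit Types f g : V -> R.

(* Syntactically stable by directional derivatives, which makes [smooth] an induction on the
   list of directions. *)
Inductive smooth_expr : (V -> R) -> Prop :=
| SE_cst c : smooth_expr (fun=> c)
| SE_lin f of (forall z, differentiable f z) &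
    (forall h v z, f (h *: v + z) = h * f v + f z) : smooth_expr f
| SE_add f g of smooth_expr f & smooth_expr g : smooth_expr (fun z => f z + g z)
| SE_mul f g of smooth_expr f & smooth_expr g : smooth_expr (fun z => f z * g z)
| SE_comp (G : R -> R) f of Cinf G & smooth_expr f : smooth_expr (fun z => G (f z)).

Lemma smooth_expr_differentiable f : smooth_expr f -> forall z, differentiable f z.
Proof.
elim => {f} //.
- by move=> f g _ df _ dg z; exact: (differentiableD (df z) (dg z)).
- by move=> f g _ df _ dg z; exact: (differentiableM (df z) (dg z)).
- move=> G f cG _ df z; apply: (differentiable_comp (df z)).
  by apply/derivable1_diffP; have [] := Cinf_is_derive cG (f z).
Qed.

Lemma derive_lin f z v : (forall h v z, f (h *: v + z) = h * f v + f z) ->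
  'D_v f z = f v.
Proof.
move=> fl; apply: cvg_lim => //; apply: cvg_near_cst; near=> h.
rewrite /= fl addrK /GRing.scale/= mulrA mulVf ?mul1r//.
by near: h; exact: nbhs_dnbhs_neq.
Unshelve. all: by end_near. Qed.

Lemma derive_comp1 (G : R -> R) f z v : Cinf G -> differentiable f z ->
  'D_v (fun z => G (f z)) z = derive1 G (f z) * 'D_v f z.
Proof.
move=> cG df.
have dG : differentiable G (f z).
  by apply/derivable1_diffP; have [] := Cinf_is_derive cG (f z).
rewrite deriveE; last exact: (differentiable_comp df).
rewrite (_ : (fun z => G (f z)) = G \o f)// diff_comp//= diff1E//.
by rewrite -deriveE// /GRing.scale/= mulrC.
Qed.

Lemma derive_addE f g z v : differentiable f z -> differentiable g z ->
  'D_v (fun z => f z + g z) z = 'D_v f z + 'D_v g z.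
Proof. by move=> df dg; apply: deriveD; exact: diff_derivable. Qed.

Lemma derive_mulE f g z v : differentiable f z -> differentiable g z ->
  'D_v (fun z => f z * g z) z = 'D_v f z * g z + f z * 'D_v g z.
Proof.
move=> df dg; have -> := @deriveM _ _ f g z v (diff_derivable df) (diff_derivable dg).
by rewrite /GRing.scale/= addrC mulrC.
Qed.

Lemma smooth_expr_derive f v : smooth_expr f -> smooth_expr ('D_v f).
Proof.
elim => {f}.
- move=> c; rewrite (_ : 'D_v _ = fun=> 0); first exact: SE_cst.
  by apply/funext => z; exact: derive_cst.
- move=> f df fl; rewrite (_ : 'D_v _ = fun=> f v); first exact: SE_cst.
  by apply/funext => z; exact: derive_lin.
- move=> f g ef ef' eg eg'.
  rewrite (_ : 'D_v _ = fun z => 'D_v f z + 'D_v g z); first exact: SE_add.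
  by apply/funext => z; apply: derive_addE; exact: smooth_expr_differentiable.
- move=> f g ef ef' eg eg'.
  rewrite (_ : 'D_v _ = fun z => 'D_v f z * g z + f z * 'D_v g z).
    by apply: SE_add; apply: SE_mul.
  by apply/funext => z; apply: derive_mulE; exact: smooth_expr_differentiable.
- move=> G f cG ef ef'.
  rewrite (_ : 'D_v _ = fun z => derive1 G (f z) * 'D_v f z).
    by apply: SE_mul => //; apply: SE_comp => //; exact: Cinf_derive1.
  by apply/funext => z; apply: derive_comp1 => //; exact: smooth_expr_differentiable.
Qed.

Lemma smooth_expr_smooth f : smooth_expr f -> smooth f.
Proof.
move=> ef s x; apply: smooth_expr_differentiable.
by elim: s => //= v s IH; exact: smooth_expr_derive.
Qed.

Lemma smooth_expr_continuous f : smooth_expr f -> continuous f.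
Proof. by move=> ef x; exact/differentiable_continuous/smooth_expr_differentiable. Qed.

Lemma smooth_expr_sum (I : Type) (s : seq I) (F : I -> V -> R) :
  (forall i, smooth_expr (F i)) -> smooth_expr (fun z => \sum_(i <- s) F i z).
Proof.
move=> eF; elim: s => [|i s IH].
  by under eq_fun do rewrite big_nil; exact: SE_cst.
by under eq_fun do rewrite big_cons; exact: SE_add.
Qed.

Lemma derive_sumE (I : Type) (s : seq I) (F : I -> V -> R) v z :
  (forall i, differentiable (F i) z) ->
  'D_v (fun z => \sum_(i <- s) F i z) z = \sum_(i <- s) 'D_v (F i) z.
Proof.
move=> dF.
suff [] : differentiable (fun z => \sum_(i <- s) F i z) z /\
  'D_v (fun z => \sum_(i <- s) F i z) z = \sum_(i <- s) 'D_v (F i) z by [].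
elim: s => [|i s [IH1 IH2]].
  under eq_fun do rewrite big_nil.
  by split; [exact: differentiable_cst|rewrite big_nil; exact: derive_cst].
under eq_fun do rewrite big_cons.
by split; [exact: differentiableD|rewrite big_cons derive_addE// IH2].
Qed.

End smooth_expressions.

Section space_time.
Variables (R : realType) (n : nat).
Local Notation V := ('rV[R]_n * R)%type.

Definition xcoord (i : 'I_n) : V -> R := fun z => z.1 ord0 i.

Lemma SE_xcoord i : smooth_expr (xcoord i).
Proof.
apply: SE_lin => [z|h v z]; last by rewrite /xcoord/= !mxE.
apply: (@differentiable_comp _ _ _ _ fst (fun x : 'rV[R]_n => x ord0 i)).
  by apply: linear_differentiable => x; exact: cvg_fst.
exact: differentiable_coord.
Qed.

Lemma SE_time : smooth_expr (snd : V -> R).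
Proof.
by apply: SE_lin => // z; apply: linear_differentiable => x; exact: cvg_snd.
Qed.

Lemma dt_time (z : V) : dt snd z = 1. Proof. by rewrite /dt derive_lin. Qed.

Lemma dx_time i (z : V) : dx i snd z = 0. Proof. by rewrite /dx derive_lin. Qed.

Lemma dt_xcoord i (z : V) : dt (xcoord i) z = 0.
Proof. by rewrite /dt derive_lin /xcoord ?mxE// => h v w; rewrite !mxE. Qed.

Lemma dx_xcoord i j (z : V) : dx i (xcoord j) z = (i == j)%:R.
Proof.
by rewrite /dx derive_lin /xcoord/= ?mxE ?eqxx 1?eq_sym// => h v w; rewrite !mxE.
Qed.

Definition sqnorm (x : 'rV[R]_n) : R := \sum_(i < n) x ord0 i ^+ 2.

(** The Lorentz quadratic form with its vertex moved to time [- l]. *)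
Definition cone (l : R) (z : V) : R := (z.2 + l) ^+ 2 - sqnorm z.1.

Lemma coneE l : cone l = fun z => (z.2 + l) * (z.2 + l) +
  (-1) * (\sum_(i < n) xcoord i z * xcoord i z).
Proof.
by apply/funext => z; rewrite /cone expr2 mulN1r.
Qed.

Lemma SE_shifted_time l : smooth_expr (fun z : V => z.2 + l).
Proof. by apply: SE_add; [exact: SE_time|exact: SE_cst]. Qed.

Lemma SE_sqnorm : smooth_expr (fun z : V => \sum_(i < n) xcoord i z * xcoord i z).
Proof. by apply: smooth_expr_sum => i; apply: SE_mul; exact: SE_xcoord. Qed.

Lemma SE_cone l : smooth_expr (cone l).
Proof.
rewrite coneE; apply: SE_add; first by apply: SE_mul; exact: SE_shifted_time.
by apply: SE_mul; [exact: SE_cst|exact: SE_sqnorm].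
Qed.

Let sed := @smooth_expr_differentiable R V.

Lemma derive_cone l (v z : V) : 'D_v (cone l) z =
  2 * (z.2 + l) * 'D_v snd z - 2 * \sum_(i < n) xcoord i z * 'D_v (xcoord i) z.
Proof.
have e1 := sed (SE_shifted_time l); have e2 := sed SE_sqnorm.
have e3 := sed (SE_mul (SE_shifted_time l) (SE_shifted_time l)).
have e4 := sed (SE_mul (SE_cst _ (-1)) SE_sqnorm).
rewrite coneE derive_addE// derive_mulE// (derive_mulE _ _ (e2 z))//.
rewrite derive_sumE; last by move=> i; apply: (sed (SE_mul (SE_xcoord i) (SE_xcoord i))).
rewrite derive_addE//; last exact: (sed SE_time).
rewrite !derive_cst mul0r add0r mulN1r; congr (_ - _); first by ring.
rewrite mulr_sumr; apply: eq_bigr => i _.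
rewrite derive_mulE; first (by ring); exact: (sed (SE_xcoord i)).
Qed.

Lemma dt_cone l z : dt (cone l) z = 2 * (z.2 + l).
Proof.
rewrite /dt derive_cone [X in _ * X - _]dt_time mulr1 big1 ?mulr0 ?subr0// => i _.
by rewrite [X in _ * X]dt_xcoord mulr0.
Qed.

Lemma dx_cone i l z : dx i (cone l) z = - 2 * xcoord i z.
Proof.
rewrite /dx derive_cone [X in _ * X - _]dx_time mulr0 sub0r mulNr; congr (- (_ * _)).
rewrite (bigD1 i)//= [X in _ * X + _]dx_xcoord eqxx mulr1 big1 ?addr0// => j ji.
by rewrite [X in _ * X]dx_xcoord eq_sym (negbTE ji) mulr0.
Qed.

Lemma dt_comp_cone (G : R -> R) l : Cinf G ->
  dt (fun z => G (cone l z)) = fun z => derive1 G (cone l z) * (2 * (z.2 + l)).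
Proof.
move=> cG; apply/funext => z; rewrite /dt derive_comp1//; last exact: (sed (SE_cone l)).
by rewrite [X in _ * X]dt_cone.
Qed.

Lemma dx_comp_cone i (G : R -> R) l : Cinf G ->
  dx i (fun z => G (cone l z)) = fun z => derive1 G (cone l z) * (- 2 * xcoord i z).
Proof.
move=> cG; apply/funext => z; rewrite /dx derive_comp1//; last exact: (sed (SE_cone l)).
by rewrite [X in _ * X]dx_cone.
Qed.

(** On functions of the Lorentz form the wave operator becomes an ordinary differential operator. On
    a power [c^a] it gives [(4 a (a - 1) + 2 (n + 1) a) c^(a-1)], which vanishes exactly for [a = 0]
    and [a = -(n-1)/2]: these are the exponents of the weights used later. *)
Lemma box_comp_cone (G : R -> R) l z : Cinf G ->
  dt (dt (fun z => G (cone l z))) z - laplacian (fun z => G (cone l z)) z =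
  2 * (n%:R + 1) * derive1 G (cone l z) + 4 * cone l z * derive1 (derive1 G) (cone l z).
Proof.
move=> cG; have cG' := Cinf_derive1 cG.
have dG' : differentiable (fun z => derive1 G (cone l z)) z.
  exact: (sed (SE_comp cG' (SE_cone l))).
rewrite dt_comp_cone// /dt derive_mulE//; last first.
  exact: (sed (SE_mul (SE_cst _ 2) (SE_shifted_time l))).
rewrite (derive_mulE _ _ (sed (SE_shifted_time l) z))//.
rewrite derive_cst mul0r add0r derive_addE//; last exact: (sed SE_time).
have dtt : 'D_((0, 1) : V) (snd : V -> R) z = 1 := dt_time z.
rewrite dtt derive_cst addr0.
rewrite [X in X * _ + _ - _](_ : _ = derive1 (derive1 G) (cone l z) * (2 * (z.2 + l))); last first.
  by have := dt_comp_cone l cG' => /(congr1 (fun f => f z)).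
rewrite /laplacian.
have -> : \sum_(i < n) dx i (dx i (fun z0 => G (cone l z0))) z =
   \sum_(i < n) (4 * derive1 (derive1 G) (cone l z) * xcoord i z ^+ 2 - 2 * derive1 G (cone l z)).
  apply: eq_bigr => i _; rewrite dx_comp_cone// /dx derive_mulE//; last first.
    exact: (sed (SE_mul (SE_cst _ (-2)) (SE_xcoord i))).
  rewrite (derive_mulE _ _ (sed (SE_xcoord i) z))//.
  have dxx : 'D_((delta_mx ord0 i, 0) : V) (xcoord i) z = 1 by have := dx_xcoord i i z;
    rewrite eqxx.
  rewrite derive_cst mul0r add0r dxx.
  rewrite [X in X * _ + _](_ : _ = derive1 (derive1 G) (cone l z) * (- 2 * xcoord i z)); last first.
    by have := dx_comp_cone i l cG' => /(congr1 (fun f => f z)).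
  by ring.
rewrite big_split/= -mulr_sumr sumr_const card_ord -[(- _) *+ n]mulr_natl.
have -> : \sum_(i < n) xcoord i z ^+ 2 = (z.2 + l) ^+ 2 - cone l z.
  by rewrite /cone opprB addrC subrK.
by ring.
Qed.


(** The sigma-algebra of ['rV[R]_n] is given by its coordinates, so the proof follows the syntax of
    the expression; a linear form is expanded in the canonical basis. *)
Lemma smooth_expr_measurable (f : V -> R) t : smooth_expr f ->
  measurable_fun setT (fun x : 'rV[R]_n => f (x, t)).
Proof.
elim => {f}.
- by move=> c; exact: measurable_cst.
- move=> f _ fl.
  have f0 : f 0 = 0 by have := fl (-1) 0 0; rewrite scaler0 addr0 mulN1r addNr.
  have fD u v : f (u + v) = f u + f v by have := fl 1 u v; rewrite scale1r mul1r.
  have fZ c u : f (c *: u) = c * f u by have := fl c u 0; rewrite addr0 f0 addr0.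
  have fS (s : seq 'I_n) (F : 'I_n -> V) :
      f (\sum_(i <- s) F i) = \sum_(i <- s) f (F i).
    by elim: s => [|i s IH]; rewrite ?big_nil// !big_cons fD IH.
  rewrite (_ : (fun x => _) = fun x : 'rV[R]_n =>
      (\sum_(i < n) x ord0 i * f (delta_mx ord0 i, 0)) + t * f (0, 1)).
    apply: measurable_funD; last exact: measurable_cst.
    apply: measurable_sum => i; apply: measurable_funM; last exact: measurable_cst.
    exact: measurable_rV_coord.
  apply/funext => x.
  have -> : (x, t) = \sum_(i < n) (x ord0 i *: ((delta_mx ord0 i, 0) : V)) + t *: ((0, 1) : V).
    have -> : \sum_(i < n) (x ord0 i *: ((delta_mx ord0 i, 0) : V)) = (x, 0).
      rewrite {2}(row_sum_delta x).
      elim/big_ind2 : _ => // [u u1 w w1 -> ->|i _].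
        by transitivity ((u + w, 0 + 0) : V); rewrite // addr0.
      transitivity ((x ord0 i *: delta_mx ord0 i, x ord0 i *: (0 : R)) : V) => //.
      by rewrite scaler0.
    transitivity ((x + t *: 0, 0 + t * 1) : V) => //.
    by rewrite scaler0 addr0 add0r mulr1.
  rewrite fD fS fZ; congr (_ + _); apply: eq_bigr => i _; exact: fZ.
- by move=> f g _ mf _ mg; exact: measurable_funD.
- by move=> f g _ mf _ mg; exact: measurable_funM.
- move=> G f cG _ mf; apply: (measurableT_comp _ mf).
  by apply: continuous_measurable_fun; exact: Cinf_continuous.
Qed.

Lemma test_function_slab_mul (T : \bar R) (chi : R -> R) (psi : V -> R) (a b B : R) :
  0 < a -> (b%:E < T)%E -> Cinf chi -> (forall t, ~~ (a <= t <= b) -> chi t = 0) ->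
  smooth_expr psi ->
  (forall x t, a <= t <= b -> psi (x, t) != 0 -> forall i, `|x ord0 i| <= B) ->
  test_function_slab T (fun z => chi z.2 * psi z).
Proof.
move=> a0 bT cchi chi0 spsi psi0.
pose K := [set v : 'rV[R]_n | forall i, `[- B, B]%classic (v ord0 i)] `*` `[a, b]%classic.
have cK : compact K.
  apply: compact_setX; last exact: segment_compact.
  by apply: (@rV_compact R n (fun=> `[- B, B]%classic)) => i; exact: segment_compact.
have sK : closure [set z : V | chi z.2 * psi z != 0] `<=` K.
  rewrite closureE; apply: smallest_sub; first exact: (compact_closed _ cK).
  move=> [x t] /=; rewrite mulf_eq0 negb_or => /andP[chit psit].
  have tab : a <= t <= b by apply: contra_neqT chit => /chi0.
  split => /=; last by rewrite in_itv.
  by move=> i; rewrite /= in_itv/= -ler_norml (psi0 x t).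
split.
- apply: smooth_expr_smooth; apply: SE_mul => //.
  exact: SE_comp SE_time.
- exact: subclosed_compact (@closed_closure _ _) cK sK.
- apply: subset_trans sK _ => -[x t] [_ /=]; rewrite in_itv/= => /andP[at_ tb].
  by split; [rewrite (lt_le_trans a0)|rewrite (le_lt_trans _ bT)// lee_fin].
Qed.

End space_time.

(** * Lebesgue measure of balls and shells *)

Section scaling.
Variable R : realType.
Local Open Scope ereal_scope.

Lemma measurable_mulr_fun (c : R) : measurable_fun setT (fun x : measurableTypeR R => (c * x)%R
  : measurableTypeR R).
Proof. by apply: measurable_funM => //; exact: measurable_cst. Qed.

(** It gives [A] the value [c] times the Lebesgue measure of [c^-1 A]. It agrees with Lebesgue
    measure on half-open intervals, so the two are equal by uniqueness, which is the scaling law. *)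
Let scaled (c : R) (c0 : (0 <= c)%R) : {measure set (measurableTypeR R) -> \bar R} :=
  mscale (NngNum c0) (measure_function_pushforward__canonical__measure_function_Measure
    (@lebesgue_measure R) (measurable_mulr_fun c)).

Lemma lebesgue_measure_scale (c : R) (A : set R) : (0 < c)%R -> measurable A ->
  lebesgue_measure (( *%R c) @^-1` A) = (c^-1)%:E * lebesgue_measure A.
Proof.
move=> c0 mA.
have -> : lebesgue_measure A = scaled (ltW c0) A.
  apply: (@lebesgue_measure_unique R (scaled (ltW c0))) => //= _ [[a b] _ <-].
  rewrite /mscale/= /pushforward.
  have -> : ( *%R c) @^-1` `]a, b]%classic = `](a / c)%R, (b / c)%R]%classic.
    by apply/seteqP; split => x /=; rewrite !in_itv/= ltr_pdivrMr// ler_pdivlMr// mulrC.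
  rewrite !lebesgue_measure_itv/= !lte_fin ltr_pM2r ?invr_gt0//.
  case: ifPn => _; last by rewrite mule0.
  by rewrite -!EFinB -EFinM; congr (_%:E); field; exact: lt0r_neq0.
by rewrite /= /mscale/= muleA -EFinM mulVf ?mul1e// gt_eqF.
Qed.

Lemma measurable_scale_rV n (c : R) : measurable_fun setT (fun x : 'rV[R]_n => (c *: x)%R).
Proof.
apply: measurable_fun_rVP => i.
under eq_fun do rewrite mxE.
by apply: measurable_funM; [exact: measurable_cst|exact: measurable_rV_coord].
Qed.

(** Induction through the product structure: the sections in the added coordinate contribute [c^-1],
    and the change of variable in the outer integral contributes [c ^- n] by the induction
    hypothesis. *)
Lemma lebesgue_rV_scale n (c : R) (A : set 'rV[R]_n) : (0 < c)%R -> measurable A ->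
  lebesgue_rV R n ((fun x => c *: x)%R @^-1` A) = (c ^- n)%:E * lebesgue_rV R n A.
Proof.
move=> c0; elim: n A => [|n IH] A mA.
  rewrite expr0 invr1 mul1e /= !diracE.
  by congr (_%:R%:E); congr nat_of_bool; apply/idP/idP; rewrite !inE/= scaler0.
have cn0 : (0 <= c ^- n)%R by rewrite invr_ge0 exprn_ge0 ?ltW.
rewrite /= /pushforward.
set B := @cons_rV R n @^-1` A.
have mB : measurable B by rewrite -[B]setTI; exact: measurable_cons_rV.
rewrite (_ : _ @^-1` _ = (fun z : 'rV[R]_n * R => (c *: z.1, c * z.2)%R) @^-1` B); last first.
  apply/seteqP; split => -[x t] /=; rewrite /B/= => h.
    rewrite (_ : cons_rV _ = c *: cons_rV (x, t))%R//; apply/rowP => j; rewrite !mxE/=.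
    by case: unliftP => [k|] _ /=; rewrite ?mxE.
  rewrite (_ : c *: cons_rV (x, t) = cons_rV (c *: x, c * t))%R//; apply/rowP => j; rewrite !mxE/=.
  by case: unliftP => [k|] _ /=; rewrite ?mxE.
rewrite /product_measure1.
have mphi := measurable_fun_xsection (@lebesgue_measure R) mB.
transitivity (\int[lebesgue_rV R n]_x ((c^-1)%:E * (lebesgue_measure \o xsection B) (c *: x)%R)).
  apply: eq_integral => x _ /=.
  by rewrite -lebesgue_measure_scale//; exact: measurable_xsection.
rewrite ge0_integralZl//; last 2 first.
- apply: (@measurableT_comp _ _ _ _ _ _ (lebesgue_measure \o xsection B) _
    (fun x : 'rV[R]_n => c *: x)%R) => //.
  exact: measurable_scale_rV.
- by rewrite lee_fin invr_ge0 ltW.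
have pos : {in setT, forall x, 0 <= (@lebesgue_measure R \o xsection B) x}.
  by move=> x _ /=; exact: measure_ge0.
have := @ge0_integral_pushforward _ _ _ _ _ _ (@measurable_scale_rV n c)
  (lebesgue_rV R n) setT _ measurableT mphi pos.
rewrite preimage_setT => <-.
rewrite [X in _ * X = _](eq_measure_integral (mscale (NngNum cn0) (lebesgue_rV R n))); last 2 first.
- exact: measurable_scale_rV.
- by move=> h X mX _; exact: IH.
rewrite ge0_integral_mscale//.
rewrite muleA -EFinM/=; congr (_%:E * _).
by rewrite exprS invfM mulrC.
Qed.

End scaling.

Section balls.
Variables (R : realType) (n : nat).
Hypothesis n0 : (0 < n)%N.
Local Notation mu := (lebesgue_rV R n).

Lemma enorm_ge0 (x : 'rV[R]_n) : 0 <= enorm x. Proof. exact: sqrtr_ge0. Qed.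

Lemma sqnorm_ge0 (x : 'rV[R]_n) : 0 <= sqnorm x.
Proof. by apply: sumr_ge0 => i _; exact: sqr_ge0. Qed.

Lemma enorm_sqr (x : 'rV[R]_n) : enorm x ^+ 2 = sqnorm x.
Proof. by rewrite sqr_sqrtr// sqnorm_ge0. Qed.

Lemma coord_le_enorm (x : 'rV[R]_n) i : `|x ord0 i| <= enorm x.
Proof.
rewrite -[X in X <= _]sqrtr_sqr /enorm ler_wsqrtr// (bigD1 i)//= lerDl.
by apply: sumr_ge0 => j _; exact: sqr_ge0.
Qed.

Lemma enormZ c (x : 'rV[R]_n) : 0 <= c -> enorm (c *: x) = c * enorm x.
Proof.
move=> c0; rewrite /enorm.
under eq_bigr do rewrite mxE exprMn.
by rewrite -mulr_sumr sqrtrM ?sqr_ge0// sqrtr_sqr ger0_norm.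
Qed.

Lemma measurable_enorm : measurable_fun setT (@enorm R n).
Proof.
apply: (@measurableT_comp _ _ _ _ _ _ (@Num.sqrt R) _ (@sqnorm R n)).
  by apply: continuous_measurable_fun; exact: sqrt_continuous.
apply: measurable_sum => i; apply: (measurable_funX 2).
exact: measurable_rV_coord.
Qed.

Lemma measurable_enorm_le rho : measurable [set x : 'rV[R]_n | enorm x <= rho].
Proof.
rewrite [X in measurable X](_ : _ = @enorm R n @^-1` `]-oo, rho]%classic); last first.
  by apply/seteqP; split => x /=; rewrite in_itv.
by rewrite -[X in measurable X]setTI; exact: measurable_enorm.
Qed.

Lemma measurable_enorm_shell a b : measurable [set x : 'rV[R]_n | a < enorm x <= b].
Proof.
rewrite [X in measurable X](_ : _ = @enorm R n @^-1` `]a, b]%classic); last first.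
  by apply/seteqP; split => x /=; rewrite in_itv.
by rewrite -[X in measurable X]setTI; exact: measurable_enorm.
Qed.

Lemma ball_le_box rho : (mu [set x | enorm x <= rho]%R <=
  \prod_(i < n) lebesgue_measure `[(- rho)%R, rho]%classic)%E.
Proof.
rewrite -(@lebesgue_rV_box R n (fun=> `[- rho, rho]%classic))//.
apply: le_measure; rewrite ?inE; first exact: measurable_enorm_le.
  rewrite [X in measurable X](_ : _ =
    \big[setI/setT]_(i < n) ((fun x : 'rV[R]_n => x ord0 i) @^-1` `[- rho, rho]%classic)).
    apply: bigsetI_measurable => i _; rewrite -[X in measurable X]setTI.
    exact: measurable_rV_coord.
  rewrite -bigcap_seq; apply/seteqP; split=> x /= h i; first by move=> _; exact: h.
  by apply: (h i); rewrite /= mem_index_enum.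
by move=> x /= xr i; rewrite in_itv/= -ler_norml (le_trans (coord_le_enorm x i)).
Qed.

Lemma ball_fin_num rho : mu [set x | enorm x <= rho] \is a fin_num.
Proof.
rewrite ge0_fin_numE ?measure_ge0//; apply: le_lt_trans (ball_le_box rho) _.
suff : (\prod_(i < n) lebesgue_measure `[(- rho)%R, rho]%classic)%E \is a fin_num
  by case/fin_numPlt/andP.
elim/big_ind: _ => //; first by move=> x y; exact: fin_numM.
by move=> i _; rewrite lebesgue_measure_itv; case: ifP.
Qed.

Definition unit_ball_volume : R := fine (mu [set x | enorm x <= 1]).
Local Notation omega := unit_ball_volume.

Lemma unit_ball_volume_ge0 : 0 <= omega.
Proof. by rewrite fine_ge0// measure_ge0. Qed.

Lemma ball_measure (rho : R) : 0 <= rho -> mu [set x | enorm x <= rho] = (omega * rho ^+ n)%:E.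
Proof.
rewrite le_eqVlt => /predU1P[<-|rho0].
  rewrite expr0n gtn_eqF// mulr0; apply/eqP; rewrite eq_le measure_ge0 andbT.
  apply: le_trans (ball_le_box 0) _; rewrite oppr0.
  case: n n0 => // m _; rewrite big_ord_recl lebesgue_measure_itv/= ltxx mul0e.
  exact: lexx.
have := lebesgue_rV_scale rho0 (measurable_enorm_le rho).
rewrite [X in mu X = _](_ : _ = [set x | enorm x <= 1]); last first.
  have e (x : 'rV[R]_n) : (enorm (rho *: x) <= rho) = (enorm x <= 1).
    by rewrite enormZ ?(ltW rho0)// -{2}[rho]mulr1 ler_pM2l.
  by apply/seteqP; split => x /=; rewrite e.
rewrite /unit_ball_volume => ->.
rewrite -[mu [set x | enorm x <= rho]](fineK (ball_fin_num rho)) -EFinM/=.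
by congr (_%:E); rewrite mulrC mulrA divff ?mul1r// expf_neq0// gt_eqF.
Qed.

(** [b^n - a^n] is [b - a <= 1] times a sum of [n] terms, each at most [b^(n-1)]. The maximum with 0
    takes care of shells with negative outer radius, which are empty. *)
Lemma shell_measure_le (a b : R) : a <= b <= a + 1 ->
  (mu [set x | a < enorm x <= b]%R <= (omega * n%:R * (Num.max 0 b) ^+ n.-1)%:E)%E.
Proof.
move=> /andP[ab ba1].
have [b0|b0] := ltP b 0.
  rewrite (_ : [set x | _] = set0) ?measure0 ?lee_fin ?mulr_ge0 ?unit_ball_volume_ge0//.
  apply/seteqP; split => x //= /andP[_ xb].
  by have := le_lt_trans (le_trans (enorm_ge0 x) xb) b0; rewrite ltxx.
have [a0|a0] := ltP a 0.
  apply: (@le_trans _ _ (mu [set x | enorm x <= b]%R)).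
    apply: le_measure; rewrite ?inE; [exact: measurable_enorm_shell|exact: measurable_enorm_le|].
    by move=> x /= /andP[].
  rewrite ball_measure// lee_fin -mulrA ler_wpM2l ?unit_ball_volume_ge0//.
  have b1 : b <= 1 by rewrite (le_trans ba1)// gerDr ltW.
  rewrite -{1}(prednK n0) exprS ler_wpM2r ?exprn_ge0//.
  by rewrite (le_trans b1)// ler1n.
rewrite (_ : [set x | _] = [set x | enorm x <= b] `\` [set x | enorm x <= a]); last first.
  apply/seteqP; split => x /=; rewrite ?[a < _]ltNge; first by move=> /andP[/negP].
  by move=> [-> /negP ->].
rewrite measureD; [|exact: measurable_enorm_le|exact: measurable_enorm_le|]; last first.
  by have /andP[] := ball_fin_num b; rewrite -ge0_fin_numE ?measure_ge0// ball_fin_num.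
rewrite setIidr; last by move=> x /= /le_trans; apply.
rewrite [X in (X - _)%E](ball_measure b0) [X in (_ - X)%E](ball_measure a0) -EFinB lee_fin
  -mulrBr -mulrA ler_wpM2l ?unit_ball_volume_ge0//.
rewrite subrXX.
apply: (@le_trans _ _ (1 * \sum_(i < n) b ^+ n.-1)).
  apply: ler_pM; rewrite ?subr_ge0//.
  - by apply: sumr_ge0 => i _; rewrite mulr_ge0// exprn_ge0.
  - by rewrite lerBlDl.
  - apply: ler_sum => i _.
    have -> : n.-1 = (n.-1 - i + i)%N by rewrite subnK// -ltnS prednK// ltn_ord.
    by rewrite addnK exprD ler_wpM2l ?exprn_ge0// lerXn2r.
by rewrite mul1r sumr_const card_ord mulr_natl.
Qed.


(** This plays the part of polar coordinates. On the unit shell where [b - enorm x] lies between [i]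
    and [i + 1], a nonincreasing majorant is at most [h i%:R], and the shell has volume of order
    [b^(n-1)]. The sum starts at 1 because [g] vanishes where the distance is below 1. *)
Lemma integral_dist_cone_le (h : R -> R) (b : R) (m : nat) (g : 'rV[R]_n -> R) :
  0 <= b -> b < m%:R -> (forall s, 0 <= s -> 0 <= h s) ->
  (forall s t, 1 <= s -> s <= t -> h t <= h s) ->
  measurable_fun setT g ->
  (forall x, b - enorm x < 1 -> g x = 0) ->
  (forall x, 1 <= b - enorm x -> 0 <= g x <= h (b - enorm x)) ->
  (\int[mu]_x (g x)%:E <=
    (omega * n%:R * b ^+ n.-1 * \sum_(1 <= i < m) h i%:R)%:E)%E.
Proof.
move=> b0 bm h0 hd mg g0 gh.
have hi (i : nat) : 0 <= h i%:R by exact: h0.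
pose shell i := [set x : 'rV[R]_n | b - i.+1%:R < enorm x <= b - i%:R].
have mshell i : measurable (shell i) by exact: measurable_enorm_shell.
apply: (@le_trans _ _ (\int[mu]_x (\sum_(1 <= i < m) (h i%:R)%:E * (\1_(shell i) x)%:E))%E).
  apply: ge0_le_integral => //.
  - move=> x _; rewrite lee_fin.
    by have [/gh/andP[]//|/g0 ->] := leP 1 (b - enorm x).
  - exact/measurable_EFinP.
  - apply: emeasurable_sum => i; apply: emeasurable_funM => //.
    by apply/measurable_EFinP; exact: measurable_indic.
  - move=> x _; have sum_ge0 : (0 <= \sum_(1 <= i < m) (h i%:R)%:E * (\1_(shell i) x)%:E)%E.
      by apply: sume_ge0 => i _; rewrite mule_ge0 ?lee_fin.
    have [x1|/g0 ->//] := leP 1 (b - enorm x).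
    set s := b - enorm x in x1 *.
    have s0 : 0 <= s by rewrite (le_trans _ x1).
    have /andP[fs sf] := truncn_itv s0.
    set k := Num.truncn s in fs sf *.
    have k1 : (1 <= k)%N by rewrite -ltnS -(ltr_nat R) (le_lt_trans x1).
    have km : (k < m)%N.
      by rewrite -(ltr_nat R) (le_lt_trans fs)// (le_lt_trans _ bm)// gerBl enorm_ge0.
    rewrite (bigD1_seq k) ?mem_index_iota ?k1 ?iota_uniq//=.
    rewrite (_ : \1_(shell k) x = 1); last first.
      rewrite indicE mem_set// /shell/=; apply/andP; split.
        by rewrite ltrBlDr -ltrBlDl.
      by rewrite lerBrDr -lerBrDl.
    rewrite mule1 (@le_trans _ _ (h k%:R)%:E)//.
      rewrite lee_fin; have /andP[_] := gh _ x1; move=> /le_trans; apply.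
      by apply: hd => //; rewrite ler1n.
    by rewrite leeDl//; apply: sume_ge0 => i _; rewrite mule_ge0 ?lee_fin.
have mind i : measurable_fun setT (fun x => (\1_(shell i) x : R)%:E).
  by apply/measurable_EFinP; exact: measurable_indic.
rewrite ge0_integral_sum//; last 2 first.
- by move=> i; apply: emeasurable_funM.
- by move=> i x _; rewrite mule_ge0 ?lee_fin.
rewrite mulr_sumr -sumEFin; apply: lee_sum => i _.
rewrite ge0_integralZl//; last by rewrite lee_fin.
rewrite integral_indic// setIT [X in (_ <= X%:E)%E]mulrC EFinM lee_wpmul2l ?lee_fin//.
apply: (le_trans (shell_measure_le _)).
  by rewrite -natr1; apply/andP; split; lra.
rewrite lee_fin ler_wpM2l ?mulr_ge0 ?unit_ball_volume_ge0// lerXn2r ?nnegrE//.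
  by rewrite le_max lexx.
by rewrite ge_max b0 gerBl/=.
Qed.

Lemma sum_inv_le_ln m : (0 < m)%N -> \sum_(1 <= i < m.+1) (i%:R : R)^-1 <= 1 + ln m%:R.
Proof.
case: m => // m _; elim: m => [|m IH].
  by rewrite big_nat1 invr1 ln1 addr0.
rewrite big_nat_recr//= (le_trans (lerD IH (lexx _)))// -addrA lerD2l.
have m1 : 0 < m.+1%:R :> R by rewrite ltr0n.
have m2 : 0 < m.+2%:R :> R by rewrite ltr0n.
rewrite -lerBrDl.
have -> : ln (m.+2%:R : R) - ln m.+1%:R = - ln (m.+1%:R / m.+2%:R).
  by rewrite ln_div ?posrE// opprB.
rewrite lerNr -[X in ln X](_ : 1 + (- m.+2%:R^-1) = _).
  apply: (@le_ln1Dx R (- m.+2%:R^-1)).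
  by rewrite ltrN2 invf_lt1// ltr1n.
by rewrite -[m.+1%:R](addrK 1) natr1; field; rewrite gt_eqF.
Qed.

Lemma sum_inv_sqr_le m : \sum_(1 <= i < m.+1) (i%:R ^+ 2 : R)^-1 <= 2.
Proof.
case: m => [|m]; first by rewrite big_geq.
suff : \sum_(1 <= i < m.+2) (i%:R ^+ 2 : R)^-1 <= 2 - m.+1%:R^-1.
  by move=> /le_trans; apply; rewrite gerBl invr_ge0.
elim: m => [|m IH]; first by rewrite big_nat1 expr1n invr1; lra.
rewrite big_nat_recr//= (le_trans (lerD IH (lexx _)))//.
rewrite -[m.+2%:R]natr1; have : 0 < m.+1%:R :> R by rewrite ltr0n.
move: (m.+1%:R : R) => x x0; rewrite -subr_ge0.
have -> : 2 - (x + 1)^-1 - (2 - x^-1 + ((x + 1) ^+ 2)^-1) = (x * (x + 1) ^+ 2)^-1.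
  by field; apply/andP; split; rewrite gt_eqF// addr_gt0.
by rewrite invr_ge0 mulr_ge0 ?ltW// exprn_gt0 ?addr_gt0.
Qed.

End balls.

(** * Supports *)

Section support.
Variables (R : realType) (n : nat).
Local Notation mu := (lebesgue_rV R n).

Lemma rational_box_dense (x : 'rV[R]_n) (e : R) : 0 < e ->
  exists (c : 'rV[rat]_n), forall i, `|x ord0 i - ratr (c ord0 i)| < e.
Proof.
move=> e0; have H i : exists q : rat, `|x ord0 i - ratr q| < e.
  have xe : x ord0 i - e < x ord0 i + e by lra.
  have [q /=] := rat_in_itvoo xe; rewrite in_itv/= => /andP[q1 q2].
  by exists q; rewrite ltr_norml; apply/andP; split; lra.
exists (\row_i xchoose (H i)) => i; rewrite mxE; exact: (xchooseP (H i)).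
Qed.

(** A Lindeloef argument: among the countably many boxes with rational centre and side given by some
    [k.+1%:R^-1], those on which [w] vanishes almost everywhere cover [D], and a countable union of
    null sets is null. *)
Lemma ae_of_local_ae (w : 'rV[R]_n -> R) (D : set 'rV[R]_n) :
  (forall x, D x -> exists2 e : R, 0 < e & {ae mu, forall y, ball x e y -> w y = 0}) ->
  {ae mu, forall x, D x -> w x = 0}.
Proof.
move=> H.
pose box (ck : 'rV[rat]_n * nat) : set 'rV[R]_n :=
  [set y | forall i, `|y ord0 i - ratr (ck.1 ord0 i)| < ck.2.+1%:R^-1].
have : {ae mu, forall y, forall k : nat,
    if unpickle k is Some ck then
      {ae mu, forall y, box ck y -> w y = 0} -> box ck y -> w y = 0 else True}.
  apply/ae_foralln => k.
  case: unpickle => [ck|]; last exact: aeW.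
  have [h|h] := pselect {ae mu, forall y, box ck y -> w y = 0}.
    by apply: filterS h => y hy _.
  by apply: aeW => y /h.
apply: filterS => y hy Dy; have [e e0 He] := H _ Dy.
(* Half of [e] is enough for a box that contains [y] to lie inside the ball of radius [e] about
   [y]. *)
have [k ke] : exists k : nat, k.+1%:R^-1 < e / 2.
  have e2 : 0 < e / 2 by rewrite divr_gt0.
  have [k _ hk] := near_infty_natSinv_lt (PosNum e2).
  by exists k; have := hk k (leqnn k).
have k0 : 0 < k.+1%:R^-1 :> R by rewrite invr_gt0.
have [c hc] := rational_box_dense y k0.
have := hy (pickle (c, k)); rewrite pickleK; apply; last by [].
apply: filterS He => z hz bz; apply: hz; split => // i j; rewrite ord1.
rewrite -ball_normE/= -(subrK (ratr (c ord0 j)) (y ord0 j)) -addrA.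
apply: le_lt_trans (ler_normD _ _) _; rewrite [X in _ + X]distrC.
by rewrite [X in _ < X]splitr; apply: ltrD; [exact: lt_trans (hc j) ke|exact: lt_trans (bz j) ke].
Qed.

Lemma supp_ae T (w : R -> 'rV[R]_n -> R) (r s : R) : time_interval T s ->
  supp T w `<=` [set z | time_interval T z.2 /\ enorm z.1 <= z.2 + r] ->
  {ae mu, forall x, s + r < enorm x -> w s x = 0}.
Proof.
move=> Ts ws; apply: ae_of_local_ae => x xs.
have : ~ supp T w (x, s).
  by move=> /ws[_ /=] /(lt_le_trans xs); rewrite ltxx.
move=> /not_andP[//|/contrapT[U /nbhs_ballP[e /= e0 eU] HU]].
exists e => //; apply: filterS (HU _ Ts) => y hy xy; apply: hy; apply: eU.
by split => //=; exact: ballxx.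
Qed.

End support.

(** * Curves of integrable functions *)

Section powR_inequalities.
Variable R : realType.

Lemma powR_le (k x y : R) : 0 <= k -> 0 <= x -> x <= y -> x `^ k <= y `^ k.
Proof. by move=> k0 x0 xy; apply: ge0_ler_powR; rewrite ?nnegrE// (le_trans x0). Qed.

(** The two terms correspond to [a <= eta] and [eta < a]. Integrated over a ball it controls the
    [k]-th power by the [m]-th one, with a constant term that a small [eta] makes as small as
    desired. *)
Lemma powR_le_split (k m eta a : R) : 0 <= k <= m -> 0 < eta -> 0 <= a ->
  a `^ k <= eta `^ k + (eta `^ (m - k))^-1 * a `^ m.
Proof.
move=> /andP[k0 km] eta0 a0; have [ae|ea] := leP a eta.
  rewrite (@le_trans _ _ (eta `^ k))//; first exact: powR_le.
  by rewrite lerDl mulr_ge0 ?invr_ge0 ?powR_ge0.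
rewrite ler_wpDl ?powR_ge0// mulrC ler_pdivlMr ?powR_gt0//.
have a_gt0 : 0 < a by rewrite (lt_trans eta0).
have -> : a `^ m = a `^ k * a `^ (m - k).
  by rewrite -powRD_gt0 ?subrKC.
by apply: ler_wpM2l; [exact: powR_ge0|apply: powR_le; rewrite ?subr_ge0//; exact: ltW].
Qed.

Lemma powR_add_convex (k theta x y : R) : 1 <= k -> 0 < theta < 1 -> 0 <= x -> 0 <= y ->
  (x + y) `^ k <= (1 - theta) `^ (1 - k) * x `^ k + theta `^ (1 - k) * y `^ k.
Proof.
move=> k1 /andP[th0 th1] x0 y0.
have th1' : 0 < 1 - theta by rewrite subr_gt0.
have key (c z : R) : 0 < c -> 0 <= z -> c * (z / c) `^ k = c `^ (1 - k) * z `^ k.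
  move=> c0 z0; rewrite powRM// ?invr_ge0 ?(ltW c0)// mulrCA mulrC; congr (_ * _).
  rewrite -{1}[c](powRr1 (ltW c0)) -powR_inv1 ?(ltW c0)// -powRrM mulN1r.
  by rewrite -powRD_gt0.
rewrite -!key//.
have h01 : 0 <= 1 - theta <= 1 by rewrite ltW//= gerBl ltW.
have := @convex_powR R k k1 (Itv01 (proj1 (andP h01)) (proj2 (andP h01))) (x / (1 - theta)) (y /
  theta).
rewrite !inE/= !in_itv/= !andbT.
move=> /(_ (divr_ge0 x0 (ltW th1')) (divr_ge0 y0 (ltW th0))).
rewrite convRE [X in X `^ _ <= _ -> _]convRE/=.
rewrite /unstable.onem !subKr mulrCA divff ?gt_eqF// mulr1 mulrCA divff ?gt_eqF// mulr1.
done.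
Qed.

(** After integration this says that [f |-> |f|^k] is continuous from [L^k] to [L^1]: [eta] is
    chosen first, then the [L^k] distance is made small against [C]. *)
Lemma powR_diff (k eta : R) : 1 <= k -> 0 < eta -> exists2 C : R, 0 <= C &
  forall a b : R, `| `|a| `^ k - `|b| `^ k | <= eta * `|b| `^ k + C * `|a - b| `^ k.
Proof.
rewrite le_eqVlt => /predU1P[<-|k1] eta0.
  exists 1 => // a b; rewrite !powRr1// mul1r (le_trans (ler_dist_dist _ _))//.
  by rewrite lerDr mulr_ge0// ltW.
pose c := 1 + eta; have c1 : 1 < c by rewrite ltrDl.
have c0 : 0 < c by rewrite (lt_trans _ c1).
have k10 : 0 < k - 1 by rewrite subr_gt0.
pose th := 1 - c `^ (- (k - 1)^-1).
have th01 : 0 < th < 1.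
  rewrite /th subr_gt0 ltrBlDr ltrDl powR_gt0// andbT powRN invf_lt1 ?powR_gt0//.
  have h : 0 < (k - 1)^-1 by rewrite invr_gt0.
  have := gt0_ltr_powR h (_ : 1 \in Num.nneg) (_ : c \in Num.nneg) c1.
  by rewrite powR1; apply; rewrite nnegrE// ltW.
have ce : (1 - th) `^ (1 - k) = c.
  rewrite /th subKr -powRrM (_ : _ * _ = 1) ?powRr1 ?ltW//.
  by rewrite mulNr -mulrN opprB mulVf// gt_eqF.
exists (th `^ (1 - k)); first exact: powR_ge0.
have H (x y : R) : `|x| `^ k <= c * `|y| `^ k + th `^ (1 - k) * `|x - y| `^ k.
  rewrite -ce; apply: le_trans (powR_add_convex (ltW k1) th01 _ _) => //.
  apply: powR_le; rewrite ?normr_ge0 ?(le_trans ler01 (ltW k1))//.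
  by rewrite -{1}(subrK y x) addrC ler_normD.
move=> a b; rewrite ler_norml; apply/andP; split; last first.
  by have := H a b; rewrite /c; lra.
have := H b a; rewrite (distrC b a).
set A := `|a| `^ k; set B := `|b| `^ k; set D := th `^ _ * _ => h.
have A0 : 0 <= A by exact: powR_ge0.
have D0 : 0 <= D by rewrite mulr_ge0 ?powR_ge0.
(* For the lower bound the roles of [a] and [b] are exchanged and one divides by [c = 1 + eta],
   using [(1 - eta) * (1 + eta) <= 1]. *)
have : B - D <= c * A by lra.
rewrite mulrC -ler_pdivrMr// => h2.
have [BD|BD] := leP 0 (B - D).
  have : (1 - eta) * (B - D) <= (B - D) / c.
    rewrite ler_pdivlMr// mulrAC ler_piMl//.
    by rewrite /c -subr_ge0; have := sqr_ge0 eta; lra.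
  by have := mulr_ge0 (ltW eta0) D0; nra.
by have := mulr_ge0 (ltW eta0) (powR_ge0 `|b| k); rewrite -/B; lra.
Qed.

End powR_inequalities.

Section curves.
Variables (R : realType) (n : nat) (T : \bar R) (r : R).
Hypothesis n0 : (0 < n)%N.
Local Notation mu := (lebesgue_rV R n).
Local Notation I := (time_interval T).
Implicit Types (w : R -> 'rV[R]_n -> R) (f g : 'rV[R]_n -> R).

(* The support condition is pointwise here, not only almost everywhere as in [supp]. *)
Record L1_curve w : Prop := L1Curve {
  L1_curve_int : forall t, I t -> mu.-integrable setT (EFin \o w t);
  L1_curve_supp : forall t x, I t -> t + r < enorm x -> w t x = 0;
  L1_curve_cont : forall t, I t -> forall e : R, 0 < e ->
    \forall s \near within I (nbhs t), I s -> \int[mu]_x `|w s x - w t x| <= e }.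

Lemma integrable_measurable f : mu.-integrable setT (EFin \o f) -> measurable_fun setT f.
Proof. by move=> /integrableP[/measurable_EFinP]. Qed.

Lemma integrable_indic_ball (c rho : R) :
  mu.-integrable setT (EFin \o (fun x => c * \1_[set x | enorm x <= rho] x)).
Proof.
apply: (@integrableZl _ _ _ mu setT measurableT c (EFin \o \1_[set x | enorm x <= rho])).
have mB := measurable_enorm_le rho : measurable [set x : 'rV[R]_n | enorm x <= rho].
apply/integrableP; split; first by apply/measurable_EFinP; exact: measurable_indic.
rewrite (eq_integral (EFin \o \1_[set x | enorm x <= rho])); last first.
  by move=> x _ /=; rewrite ger0_norm.
by rewrite integral_indic// setIT -ge0_fin_numE ?measure_ge0// ball_fin_num.
Qed.

Lemma Rintegral_indic_ball (c rho : R) : 0 <= rho ->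
  \int[mu]_x (c * \1_[set x | enorm x <= rho] x) = c * (unit_ball_volume R n * rho ^+ n).
Proof.
move=> rho0; have mB := measurable_enorm_le rho : measurable [set x : 'rV[R]_n | enorm x <= rho].
have h := integrable_indic_ball 1 rho.
rewrite RintegralZl//; last by apply: eq_integrable h => // x _ /=; rewrite mul1r.
by rewrite /Rintegral integral_indic// setIT ball_measure.
Qed.

Lemma integrable_dominated f g : measurable_fun setT f ->
  mu.-integrable setT (EFin \o g) -> (forall x, `|f x| <= g x) ->
  mu.-integrable setT (EFin \o f).
Proof.
move=> mf ig fg; apply: le_integrable ig => //; first exact/measurable_EFinP.
by move=> x _ /=; rewrite lee_fin (le_trans (fg x))// ler_norm.
Qed.

Lemma integrableD_fun f g : mu.-integrable setT (EFin \o f) ->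
  mu.-integrable setT (EFin \o g) -> mu.-integrable setT (EFin \o (fun x => f x + g x)).
Proof. by move=> hf hg; exact: (integrableD measurableT hf hg). Qed.

Lemma integrableB_fun f g : mu.-integrable setT (EFin \o f) ->
  mu.-integrable setT (EFin \o g) -> mu.-integrable setT (EFin \o (fun x => f x - g x)).
Proof. by move=> hf hg; exact: (integrableB measurableT hf hg). Qed.

Lemma integrableZ_fun (c : R) f : mu.-integrable setT (EFin \o f) ->
  mu.-integrable setT (EFin \o (fun x => c * f x)).
Proof. by move=> hf; exact: (integrableZl measurableT c hf). Qed.

Lemma integrable_abs_fun f : mu.-integrable setT (EFin \o f) ->
  mu.-integrable setT (EFin \o (fun x => `|f x|)).
Proof. by move=> hf; exact: (integrable_norm hf). Qed.

Lemma measurable_abs_powR f (k : R) : measurable_fun setT f ->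
  measurable_fun setT (fun x => `|f x| `^ k).
Proof.
move=> mf; apply: (measurableT_comp (measurable_powR k)).
exact: measurableT_comp.
Qed.

Lemma ball_powR_split f (k m eta rho : R) x : 0 < k <= m -> 0 < eta ->
  (rho < enorm x -> f x = 0) ->
  `|f x| `^ k <= eta `^ k * \1_[set x | enorm x <= rho] x + (eta `^ (m - k))^-1 * `|f x| `^ m.
Proof.
move=> /andP[k0 km] eta0 fsupp; have [xr|xr] := leP (enorm x) rho.
  by rewrite indicE mem_set// mulr1 powR_le_split// km ltW.
by rewrite fsupp// normr0 powR0 ?gt_eqF// addr_ge0 ?mulr_ge0 ?invr_ge0 ?powR_ge0.
Qed.

Lemma integrable_powR_le f (k m rho : R) : 0 < k <= m -> measurable_fun setT f ->
  (forall x, rho < enorm x -> f x = 0) ->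
  mu.-integrable setT (EFin \o (fun x => `|f x| `^ m)) ->
  mu.-integrable setT (EFin \o (fun x => `|f x| `^ k)).
Proof.
move=> km mf fsupp fm.
apply: (integrable_dominated (g := fun x => 1 `^ k * \1_[set x | enorm x <= rho] x +
   (1 `^ (m - k))^-1 * `|f x| `^ m)).
- exact: measurable_abs_powR.
- by apply: integrableD_fun; [exact: integrable_indic_ball|exact: integrableZ_fun].
- by move=> x; rewrite ger0_norm ?powR_ge0// ball_powR_split// => ?; exact: fsupp.
Qed.

Lemma Rintegral_powR_le f (k m eta rho : R) : 0 < k <= m -> measurable_fun setT f ->
  0 < eta -> 0 <= rho ->
  (forall x, rho < enorm x -> f x = 0) ->
  mu.-integrable setT (EFin \o (fun x => `|f x| `^ m)) ->
  \int[mu]_x (`|f x| `^ k) <= eta `^ k * (unit_ball_volume R n * rho ^+ n) +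
    (eta `^ (m - k))^-1 * \int[mu]_x (`|f x| `^ m).
Proof.
move=> km mf eta0 rho0 fsupp fm.
rewrite -Rintegral_indic_ball// -RintegralZl// -RintegralD//; last 2 first.
- exact: integrable_indic_ball.
- exact: integrableZ_fun.
apply: le_Rintegral => //.
- exact: (@integrable_powR_le f k m rho).
- by apply: integrableD_fun; [exact: integrable_indic_ball|exact: integrableZ_fun].
- by move=> x _; apply: ball_powR_split => // ?; exact: fsupp.
Qed.

(** Under the support condition each slice changes only on a null set, by [trunc_ae]; in exchange
    the vanishing outside the cone holds at every point. *)
Definition trunc w : R -> 'rV[R]_n -> R :=
  fun t x => if enorm x <= t + r then w t x else 0.

Lemma trunc_supp w t x : t + r < enorm x -> trunc w t x = 0.
Proof. by move=> h; rewrite /trunc leNgt h. Qed.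

Lemma trunc_ae w t : {ae mu, forall x, t + r < enorm x -> w t x = 0} ->
  {ae mu, forall x, trunc w t x = w t x}.
Proof.
by apply: filterS => x h; rewrite /trunc; case: leP => // /h ->.
Qed.

Lemma measurable_trunc w t : measurable_fun setT (w t) -> measurable_fun setT (trunc w t).
Proof.
move=> mw; rewrite (_ : trunc w t = (fun x => \1_[set x | enorm x <= t + r] x * w t x)).
  by apply: measurable_funM => //; apply: measurable_indic; exact: measurable_enorm_le.
apply/funext => x; rewrite /trunc indicE; have [h|h] := boolP (enorm x <= t + r).
  by rewrite mem_set// mul1r.
by rewrite memNset ?mul0r// => /= h'; rewrite h' in h.
Qed.

Lemma ae_eq_Rintegral f g : measurable_fun setT f -> measurable_fun setT g ->
  {ae mu, forall x, f x = g x} -> \int[mu]_x f x = \int[mu]_x g x.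
Proof.
move=> mf mg fg; rewrite /Rintegral; congr fine; apply: ae_eq_integral => //.
- exact/measurable_EFinP.
- exact/measurable_EFinP.
- by apply: filterS fg => x -> .
Qed.

Lemma Lp_measurable m f : Lp m f -> measurable_fun setT f.
Proof. by rewrite /Lp/= inE => /andP[]; rewrite inE. Qed.

Lemma Lp_integrable m f : 1 <= m -> Lp m f ->
  mu.-integrable setT (EFin \o (fun x => `|f x| `^ m)).
Proof. by move=> m1; exact: Lfun_integrable. Qed.

Lemma Lp_curve_cont (m : R) w (t e : R) : 1 <= m -> continuous_in T (Lp m) (@Lp_norm R n m) w ->
  I t -> 0 < e ->
  \forall s \near within I (nbhs t), I s -> \int[mu]_x `|w s x - w t x| `^ m <= e.
Proof.
move=> m1 [_ cw] It e0; have m0 : 0 < m by rewrite (lt_le_trans _ m1).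
have d0 : 0 < e `^ m^-1 by rewrite powR_gt0.
have : nbhs (0%E : \bar R) [set y | (y < (e `^ m^-1)%:E)%E].
  by apply: open_nbhs_nbhs; split; [exact: open_ereal_lt_ereal|rewrite /= lte_fin].
move=> /(cw _ It) h.
have {h} : \forall s \near within I (nbhs t), (Lp_norm m (w s \- w t)%R < (e `^ m^-1)%:E)%E := h.
apply: filterS => s /= Ns _.
have : (Lp_norm m (w s \- w t)%R `^ m <= e%:E)%E.
  rewrite -[X in (_ <= X%:E)%E](powRr1 (ltW e0)) -(mulVf (lt0r_neq0 m0)) powRrM -poweR_EFin.
  apply: gt0_ler_poweR; rewrite ?(ltW m0)//.
  - by rewrite in_itv/= leey Lnorm_ge0.
  - by rewrite in_itv/= leey lee_fin (ltW d0).
  - exact: ltW.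
rewrite /Lp_norm powR_Lnorm ?gt_eqF// /Rintegral => h.
by rewrite -lee_fin (le_trans _ h)// fineK// ge0_fin_numE ?integral_ge0// (le_lt_trans h) ?ltry.
Qed.

Hypothesis r0 : 0 <= r.

Section from_Lp.
Variables (m : R) (w : R -> 'rV[R]_n -> R).
Hypothesis m1 : 1 <= m.
Hypothesis cw : continuous_in T (Lp m) (@Lp_norm R n m) w.
Hypothesis sw : forall t, I t -> {ae mu, forall x, t + r < enorm x -> w t x = 0}.
Local Notation w' := (trunc w).

Let mw t : I t -> measurable_fun setT (w t).
Proof. by move=> It; exact: Lp_measurable (cw.1 _ It). Qed.

Let mw' t : I t -> measurable_fun setT (w' t).
Proof. by move=> /mw; exact: measurable_trunc. Qed.

Lemma trunc_powR_integrable t k : I t -> 0 < k <= m ->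
  mu.-integrable setT (EFin \o (fun x => `|w' t x| `^ k)).
Proof.
move=> It km; apply: (@integrable_powR_le _ _ m (t + r)) => //.
- exact: mw'.
- by move=> x; exact: trunc_supp.
- have := Lp_integrable m1 (cw.1 _ It) => h.
  apply: (integrable_dominated (g := fun x => `|w t x| `^ m)) => //.
    by apply: measurable_abs_powR; exact: mw'.
  move=> x; rewrite ger0_norm ?powR_ge0// /trunc; case: ifP => // _.
  by rewrite normr0 powR0 ?powR_ge0// gt_eqF// (lt_le_trans _ m1).
Qed.

Lemma trunc_diff_integrable s t k : I s -> I t -> 0 < k <= m ->
  mu.-integrable setT (EFin \o (fun x => `|w' s x - w' t x| `^ k)).
Proof.
move=> Is It /andP[k0 km]; have mm : 0 < m <= m by rewrite lexx (lt_le_trans _ m1).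
have m0 : 0 <= m by rewrite (le_trans _ m1).
apply: (@integrable_powR_le _ _ m (Num.max s t + r)); rewrite ?k0//.
- by apply: measurable_funB; exact: mw'.
- by move=> x h; rewrite !trunc_supp ?subrr// (le_lt_trans _ h)// lerD2r le_max lexx ?orbT.
- apply: (integrable_dominated (g := fun x => 2 `^ m * (`|w' s x| `^ m + `|w' t x| `^ m))).
  + by apply: measurable_abs_powR; apply: measurable_funB; exact: mw'.
  + by apply: integrableZ_fun; apply: integrableD_fun; exact: trunc_powR_integrable.
  + move=> x; rewrite ger0_norm ?powR_ge0//.
    set a := `|w' s x|; set b := `|w' t x|.
    apply: (@le_trans _ _ ((2 * Num.max a b) `^ m)).
      apply: powR_le => //; rewrite (le_trans (ler_normB _ _))// mulr_natl mulr2n.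
      by rewrite lerD// le_max lexx ?orbT.
    rewrite powRM// ?le_max ?normr_ge0// ler_wpM2l ?powR_ge0//.
    by case: (leP a b) => _; rewrite ?lerDr ?lerDl powR_ge0.
Qed.

Lemma trunc_cont_powR (t k e : R) : I t -> 0 < k <= m -> 0 < e ->
  \forall s \near within I (nbhs t), I s -> \int[mu]_x (`|w' s x - w' t x| `^ k) <= e.
Proof.
move=> It /andP[k0 km] e0.
have V0 : 0 <= unit_ball_volume R n * (t + 1 + r) ^+ n.
  rewrite mulr_ge0 ?unit_ball_volume_ge0// exprn_ge0// !addr_ge0//.
  by case: It.
set V := unit_ball_volume R n * _ in V0.
have V1 : 0 < 2 * (V + 1) by rewrite mulr_gt0// ltr_wpDl.
pose eta := (e / (2 * (V + 1))) `^ k^-1.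
have eta0 : 0 < eta by rewrite powR_gt0// divr_gt0.
have etak : eta `^ k = e / (2 * (V + 1)).
  by rewrite -powRrM mulVf ?gt_eqF// powRr1// divr_ge0 ?ltW.
have d0 : 0 < e / 2 * eta `^ (m - k) by rewrite mulr_gt0 ?divr_gt0// powR_gt0.
have st : \forall s \near within I (nbhs t), s < t + 1.
  by apply: cvg_within; apply: nbhs_left_lt || (apply: lt_nbhsl); rewrite ltrDl.
move: (Lp_curve_cont m1 cw It d0) st; apply: filterS2 => s hs st1 Is.
have {}hs : \int[mu]_x `|w' s x - w' t x| `^ m <= e / 2 * eta `^ (m - k).
  apply: le_trans (hs Is); rewrite le_eqVlt; apply/orP; left; apply/eqP.
  apply: ae_eq_Rintegral.
  - by apply: measurable_abs_powR; apply: measurable_funB; exact: mw'.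
  - by apply: measurable_abs_powR; apply: measurable_funB; exact: mw.
  - have := trunc_ae (sw Is); have := trunc_ae (sw It).
    by apply: filterS2 => x -> ->.
have mm : 0 < m <= m by rewrite lexx (lt_le_trans _ m1).
apply: le_trans (Rintegral_powR_le (k := k) (m := m) (eta := eta) (rho := t + 1 + r) _ _ _ _ _
  _) _ => //.
- by rewrite k0.
- by apply: measurable_funB; exact: mw'.
- by rewrite !addr_ge0//; case: It.
- move=> x h; rewrite !trunc_supp ?subrr//; apply: le_lt_trans h; rewrite lerD2r ?lerDl//.
  exact: ltW.
- exact: trunc_diff_integrable.
rewrite -/V etak [X in _ <= X]splitr lerD//.
  rewrite (_ : _ * V = e / 2 * (V / (V + 1))).
    apply: ler_piMr; first by rewrite divr_ge0// ltW.
    by rewrite ler_pdivrMr ?ltr_wpDl// mul1r lerDl.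
  by field; rewrite gt_eqF// ltr_wpDl.
by rewrite mulrC ler_pdivrMr// powR_gt0.
Qed.

Lemma trunc_L1_curve : L1_curve w'.
Proof.
have m01 : (0 : R) < 1 <= m by apply/andP.
split.
- move=> t It; apply: (integrable_dominated (mw' It) (trunc_powR_integrable It m01)).
  by move=> x; rewrite powRr1.
- by move=> t x _; exact: trunc_supp.
- move=> t It e e0; have := trunc_cont_powR It m01 e0.
  by apply: filterS => s + Is => /(_ Is); under eq_Rintegral do rewrite powRr1//.
Qed.

(** Continuity in [L^1] comes from [powR_diff]: its [eta] is tuned to the integral of [|w' t|^k],
    and then the [L^k] distance to its constant [C], so that each term contributes at most
    [e / 2]. *)
Lemma trunc_powR_L1_curve k : 1 <= k <= m -> L1_curve (fun t x => `|w' t x| `^ k).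
Proof.
move=> /andP[k1 km]; have k0 : 0 < k by rewrite (lt_le_trans _ k1).
have k0m : 0 < k <= m by rewrite k0.
split.
- by move=> t It; exact: trunc_powR_integrable.
- by move=> t x _ h; rewrite trunc_supp// normr0 powR0// gt_eqF.
- move=> t It e e0.
  set N := \int[mu]_x `|w' t x| `^ k.
  have N0 : 0 <= N by apply: Rintegral_ge0 => x _; exact: powR_ge0.
  have N1 : 0 < N + 1 by rewrite ltr_wpDl.
  have eta0 : 0 < e / 2 / (N + 1) by rewrite !divr_gt0.
  have [C C0 HC] := powR_diff k1 eta0.
  have C1 : 0 < C + 1 by rewrite ltr_wpDl.
  have d0 : 0 < e / 2 / (C + 1) by rewrite !divr_gt0.
  have := trunc_cont_powR It k0m d0.
  apply: filterS => s + Is => /(_ Is) hs.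
  have i1 := trunc_powR_integrable It k0m.
  have i2 := trunc_diff_integrable Is It k0m.
  apply: (@le_trans _ _ (\int[mu]_x (e / 2 / (N + 1) * `|w' t x| `^ k +
      C * `|w' s x - w' t x| `^ k))).
    apply: le_Rintegral => //.
    + apply: integrable_abs_fun; apply: integrableB_fun => //.
      exact: trunc_powR_integrable.
    + by apply: integrableD_fun; exact: integrableZ_fun.
  rewrite RintegralD//; [|exact: integrableZ_fun|exact: integrableZ_fun].
  rewrite !RintegralZl// -/N [X in _ <= X]splitr lerD//.
    rewrite (_ : _ * N = e / 2 * (N / (N + 1))); last by field; rewrite gt_eqF.
    apply: ler_piMr; first by rewrite divr_ge0// ltW.
    by rewrite ler_pdivrMr// mul1r lerDl.
  move: hs; set X := Rintegral _ _ _ => hs.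
  have X0 : 0 <= X by apply: Rintegral_ge0 => x _; exact: powR_ge0.
  clearbody X; apply: (@le_trans _ _ ((C + 1) * X)); first by rewrite ler_wpM2r// lerDl.
  by rewrite mulrC -ler_pdivlMr.
Qed.

End from_Lp.

Section pairing.
Variables (w : R -> 'rV[R]_n -> R) (psi : 'rV[R]_n * R -> R).
Hypotheses (cw : L1_curve w) (spsi : smooth_expr psi).

Lemma smooth_expr_bounded (B : R) : exists2 K : R, 0 < K &
  forall x s, enorm x <= B -> `|s| <= B -> `|psi (x, s)| <= K.
Proof.
pose D := [set v : 'rV[R]_n | forall i, `[- B, B]%classic (v ord0 i)] `*` `[- B, B]%classic.
have cD : compact D.
  apply: compact_setX; last exact: segment_compact.
  by apply: (@rV_compact R n (fun=> `[- B, B]%classic)) => i; exact: segment_compact.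
have cpsi : {within D, continuous psi}.
  by apply: continuous_subspaceT; exact: smooth_expr_continuous.
have /compact_bounded[M [Mr HM]] := continuous_compact cpsi cD.
exists (`|M| + 1); first by rewrite ltr_wpDl.
move=> x s xB sB; apply: (HM (`|M| + 1)).
  by rewrite (le_lt_trans (ler_norm M))// ltrDl.
exists (x, s) => //; split => /=; last by rewrite in_itv/= -ler_norml.
by move=> i; rewrite in_itv/= -ler_norml (le_trans (coord_le_enorm x i)).
Qed.

Lemma measurable_slice t : measurable_fun setT (fun x => psi (x, t)).
Proof. exact: smooth_expr_measurable. Qed.

Lemma curve_pairing_integrable t s : I t ->
  mu.-integrable setT (EFin \o (fun x => w t x * psi (x, s))).
Proof.
move=> It; have [K K0 HK] := smooth_expr_bounded (Num.max `|t + r| `|s|).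
have iw := L1_curve_int cw It.
apply: (integrable_dominated (g := fun x => K * `|w t x|)).
- by apply: measurable_funM; [exact: integrable_measurable|exact: measurable_slice].
- exact/integrableZ_fun/integrable_abs_fun.
- move=> x; have [h|h] := leP (enorm x) (t + r).
    rewrite normrM mulrC ler_wpM2r// HK// le_max ?lexx ?orbT//.
    by rewrite (le_trans h (ler_norm _)).
  by rewrite (L1_curve_supp cw It h) mul0r normr0 mulr0.
Qed.

(** The variation splits in two. With [w t] frozen, the dependence of [psi] on time is handled by
    dominated convergence; the change from [w t] to [w s] is small in [L^1] and is multiplied by
    [psi], which is bounded on the part of the cone concerned. *)
Lemma curve_pairing_cont t : I t ->
  (fun s => \int[mu]_x (w s x * psi (x, s))) s @[s --> within I (nbhs t)] -->
  \int[mu]_x (w t x * psi (x, t)).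
Proof.
move=> It; have iw := L1_curve_int cw It.
have t0 : 0 <= t by case: It.
have [K K0 HK] := smooth_expr_bounded (t + 1 + r).
have st : \forall s \near nbhs t, `|s - t| < 1.
  by have := @nbhsx_ballx _ _ t 1 ltr01; apply: filterS => s; rewrite -ball_normE/= distrC.
have bnd s : `|s - t| < 1 -> `|s| <= t + 1 + r.
  rewrite ltr_norml => /andP[s1 s2]; rewrite ler_norml; apply/andP; split.
    by rewrite lerNl; have := r0; lra.
  by have := r0; lra.
have F : {for t, continuous (fun s => \int[mu]_x (w t x * psi (x, s)))}.
  have := @continuity_under_integral R _ _ mu (fun s x => w t x * psi (x, s)) setT measurableT
    (t - 1) (t + 1) _ _ (fun x => K * `|w t x|) _ _ t.
  apply.
  - by move=> s _; exact: curve_pairing_integrable.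
  - apply: aeW => x _ s _; apply: cvgM; first exact: cvg_cst.
    have h := @smooth_expr_continuous _ _ psi spsi (x, s).
    apply: (@continuous_comp _ _ _ (fun s' => (x, s')) psi) => //.
    apply: differentiable_continuous; apply: differentiable_pair.
      exact: differentiable_cst.
    exact: ex_diff.
  - exact/integrableZ_fun/integrable_abs_fun.
  - move=> s /=; rewrite in_itv/= => /andP[s1 s2]; apply: aeW => x _.
    have [h|h] := leP (enorm x) (t + r).
      rewrite normrM mulrC ler_wpM2r// HK//; first by rewrite (le_trans h)// lerD2r lerDl.
      by apply: bnd; rewrite ltr_norml; apply/andP; split; lra.
    by rewrite (L1_curve_supp cw It h) mul0r normr0 mulr0.
  - by rewrite inE/= in_itv/=; apply/andP; split; lra.
apply/cvgrPdist_le => e e0.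
have d0 : 0 < e / 2 / K by rewrite !divr_gt0.
have e2 : 0 < e / 2 by rewrite divr_gt0.
have hF : \forall s \near within I (nbhs t), `|\int[mu]_x (w t x * psi (x, t)) -
    \int[mu]_x (w t x * psi (x, s))| <= e / 2.
  by apply: cvg_within; move/cvgrPdist_le : F => /(_ _ e2).
have hI : \forall s \near within I (nbhs t), I s by exact: withinT.
have hst : \forall s \near within I (nbhs t), `|s - t| < 1 by exact: cvg_within.
near=> s.
have Is : I s by near: s.
have s1 : `|s - t| < 1 by near: s.
have hs : `|\int[mu]_x (w t x * psi (x, t)) - \int[mu]_x (w t x * psi (x, s))| <= e / 2 by near: s.
have hc : \int[mu]_x `|w s x - w t x| <= e / 2 / K.
  have : I s -> \int[mu]_x `|w s x - w t x| <= e / 2 / K.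
    by near: s; exact: (L1_curve_cont cw It d0).
  by apply.
rewrite -(subrK (\int[mu]_x (w t x * psi (x, s))) (\int[mu]_x (w t x * psi (x, t)))).
rewrite -addrA (le_trans (ler_normD _ _))// [X in _ <= X]splitr lerD//.
have iws := L1_curve_int cw Is.
rewrite -RintegralB//; [|exact: curve_pairing_integrable..].
apply: (le_trans (le_normr_Rintegral measurableT _)).
  by apply: integrableB_fun; exact: curve_pairing_integrable.
apply: (@le_trans _ _ (\int[mu]_x (K * `|w s x - w t x|))).
  have iK : mu.-integrable setT (EFin \o (fun x => K * `|w s x - w t x|)).
    by apply: integrableZ_fun; apply: integrable_abs_fun; exact: integrableB_fun.
  apply: le_Rintegral => //.
    by apply: integrable_abs_fun; apply: integrableB_fun; exact: curve_pairing_integrable.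
  move=> x _; rewrite -mulrBl normrM mulrC distrC.
  have [h|h] := leP (enorm x) (t + 1 + r).
    by rewrite ler_wpM2r// HK// bnd.
  rewrite (L1_curve_supp cw Is) ?(L1_curve_supp cw It) ?subrr ?normr0 ?mulr0//.
    by rewrite (le_lt_trans _ h)// lerD2r lerDl.
  rewrite (le_lt_trans _ h)// lerD2r; move: s1; rewrite ltr_norml => /andP[_ s2]; lra.
rewrite RintegralZl//; last by apply: integrable_abs_fun; exact: integrableB_fun.
by rewrite mulrC -ler_pdivlMr.
Unshelve. all: by end_near. Qed.

End pairing.

End curves.

(** * Cutoffs in time *)

Section ramp.
Variable R : realType.

Definition ramp (d c t : R) : R := step (d * t + c).

Lemma Cinf_ramp d c : Cinf (ramp d c).
Proof. exact: Cinf_affine (Cinf_step R). Qed.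

Lemma derive1_affine (d c : R) (f : R -> R) : Cinf f ->
  derive1 (fun t => f (d * t + c)) = fun t => d * derive1 f (d * t + c).
Proof.
move=> cf; apply/funext => t; rewrite derive1E.
by have [_ ->] := is_derive_affine (Cinf_is_derive cf (d * t + c)).
Qed.

Lemma derive1_ramp d c : derive1 (ramp d c) = fun t => d * derive1 (@step R) (d * t + c).
Proof. by rewrite derive1_affine//; exact: Cinf_step. Qed.

Lemma derive1_scale (d : R) (f : R -> R) : Cinf f ->
  derive1 (fun t => d * f t) = fun t => d * derive1 f t.
Proof.
move=> cf; apply/funext => t; rewrite derive1E.
by have [_ ->] := is_deriveZ d (Cinf_is_derive cf t).
Qed.

Lemma derive2_ramp d c :
  derive1 (derive1 (ramp d c)) = fun t => d ^+ 2 * derive1 (derive1 (@step R)) (d * t + c).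
Proof.
have cs := Cinf_derive1 (Cinf_step R).
rewrite derive1_ramp derive1_scale; last exact: Cinf_affine.
by rewrite derive1_affine//; apply/funext => t; rewrite mulrA.
Qed.

Lemma derive1B (f g : R -> R) : Cinf f -> Cinf g ->
  derive1 (fun t => f t - g t) = fun t => derive1 f t - derive1 g t.
Proof.
move=> cf cg; apply/funext => t; rewrite derive1E.
by have [_ ->] := is_deriveB (Cinf_is_derive cf t) (Cinf_is_derive cg t).
Qed.

Lemma CinfB (f g : R -> R) : Cinf f -> Cinf g -> Cinf (fun t => f t - g t).
Proof.
move=> cf cg; have := CinfD cf (CinfM (Cinf_cst (-1)) cg).
by congr Cinf; apply/funext => t /=; rewrite mulN1r.
Qed.

End ramp.

Section time_cutoff.
Variables (R : realType) (T : \bar R).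
Local Notation mu := (@lebesgue_measure R).
Local Notation I := (time_interval T).
Local Notation J := (open_time_interval T).

Definition continuous_on_time (f : R -> R) :=
  forall t, I t -> f s @[s --> within I (nbhs t)] --> f t.

Lemma continuous_on_time_within f b : (b%:E < T)%E -> continuous_on_time f ->
  {within `[0, b], continuous f}.
Proof.
move=> bT cf; apply/subspace_continuousP => t /=; rewrite in_itv/= => /andP[t0 tb].
have It : I t by split=> //; rewrite (le_lt_trans _ bT)// lee_fin.
apply: cvg_trans (cf _ It); apply: cvg_app; apply: within_subset => //.
move=> s /=; rewrite in_itv/= => /andP[s0 sb].
by split=> //; rewrite (le_lt_trans _ bT)// lee_fin.
Qed.

Lemma within_continuousM (D : set R) (f g : R -> R) : {within D, continuous f} ->
  {within D, continuous g} -> {within D, continuous (fun t => f t * g t)}.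
Proof. by move=> cf cg x; exact: (@continuousM _ (subspace D) f g x (cf x) (cg x)). Qed.

Lemma continuous_integrable a b (f : R -> R) : {within `[a, b], continuous f} ->
  mu.-integrable `[a, b] (EFin \o f).
Proof. by move=> cf; apply: continuous_compact_integrable => //; exact: segment_compact. Qed.

Lemma Rintegral_open_time (f : R -> R) a b : 0 < a -> (b%:E < T)%E ->
  (forall t, ~~ (a <= t <= b) -> f t = 0) ->
  \int[mu]_(t in J) f t = \int[mu]_(t in `[0, b]) f t.
Proof.
move=> a0 bT f0; rewrite Rintegral_mkcond [RHS]Rintegral_mkcond.
congr Rintegral; apply/funext => t; rewrite !patchE.
have [tab|/f0 ->] := boolP (a <= t <= b); last by rewrite !if_same.
have /andP[at_ tb] := tab.
rewrite mem_set; last first.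
  by split; [exact: lt_le_trans at_|rewrite (le_lt_trans _ bT)// lee_fin].
by rewrite mem_set//= in_itv/= tb andbT (le_trans (ltW a0)).
Qed.

(** In the application these are the integrals over space of [w psi], [w (dt psi)], [wt psi] and
    [h psi]. Then [E1] is the wave equation tested with [chi(t) psi], where [psi] is a free wave,
    and [E2] is the relation between [w] and its time derivative. Everything that remains is
    one-dimensional. *)
Variables V V1 W N : R -> R.
Hypotheses (cV : continuous_on_time V) (cV1 : continuous_on_time V1)
  (cW : continuous_on_time W) (cN : continuous_on_time N).
Hypothesis N0 : forall t, I t -> 0 <= N t.
Hypothesis E1 : forall (chi : R -> R) (a b : R), Cinf chi -> 0 < a -> (b%:E < T)%E ->
  (forall t, ~~ (a <= t <= b) -> chi t = 0) ->
  \int[mu]_(t in J) (derive1 (derive1 chi) t * V t + 2 * derive1 chi t * V1 t) =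
  \int[mu]_(t in J) (chi t * N t).
Hypothesis E2 : forall (chi : R -> R) (a b : R), Cinf chi -> 0 < a -> (b%:E < T)%E ->
  (forall t, ~~ (a <= t <= b) -> chi t = 0) ->
  \int[mu]_(t in J) (derive1 chi t * V t + chi t * V1 t) =
  - \int[mu]_(t in J) (chi t * W t).

Variables (R1 R2 Cs : R) (G : R -> R).
Hypotheses (R10 : 0 < R1) (R12 : R1 < R2) (R2T : (R2%:E < T)%E).
Hypothesis HCs : forall y, `|derive1 (@step R) y| <= Cs /\ `|derive1 (derive1 (@step R)) y| <= Cs.
Hypothesis cG : {within `[0, R2], continuous G}.
Hypothesis G0 : forall t, 0 <= t <= R2 -> 0 <= G t.
Hypothesis HG : forall t, R1 <= t <= R2 ->
  Cs / (R2 - R1) ^+ 2 * `|V t| + 2 * (Cs / (R2 - R1)) * `|V1 t| <= G t.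

Let d := (R2 - R1)^-1.
Let c := 1 - d * R1.
Let rho := ramp d c.
Local Notation D := (`[0, R2]%classic).

Let d0 : 0 < d. Proof. by rewrite invr_gt0 subr_gt0. Qed.

Let arg_le t : (1 <= d * t + c) = (R1 <= t).
Proof. by rewrite /c addrCA lerDl -mulrBr pmulr_rge0// subr_ge0. Qed.

Let arg_ge t : (d * t + c <= 2) = (t <= R2).
Proof.
rewrite /c addrCA -mulrBr -[2]/(1 + 1) lerD2l /d mulrC ler_pdivrMr ?subr_gt0//.
by rewrite mul1r lerD2r.
Qed.

Let rho0 t : t <= R1 -> rho t = 0.
Proof.
move=> tR; rewrite /rho /ramp step0//.
by rewrite /c addrCA gerDl -mulrBr pmulr_rle0// subr_le0.
Qed.

Let rho1 t : R2 <= t -> rho t = 1.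
Proof.
move=> tR; rewrite /rho /ramp step1//.
rewrite /c addrCA -mulrBr -[2]/(1 + 1) lerD2l /d mulrC ler_pdivlMr ?subr_gt0//.
by rewrite mul1r lerD2r.
Qed.

Let drho t : ~~ (R1 <= t <= R2) -> derive1 rho t = 0.
Proof. by move=> h; rewrite /rho derive1_ramp derive1_step_eq0 ?mulr0// arg_le arg_ge. Qed.

Let ddrho t : ~~ (R1 <= t <= R2) -> derive1 (derive1 rho) t = 0.
Proof. by move=> h; rewrite /rho derive2_ramp derive2_step_eq0 ?mulr0// arg_le arg_ge. Qed.

Section eta.
Variables (del : R).
Hypotheses (del0 : 0 < del) (delR : 2 * del < R1).
(** It rises from 0 to 1 on [[del, 2 * del]], so [eta - rho] is supported inside the open time
    interval, as [E1] demands. Its derivative is an approximate Dirac mass at time 0. *)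
Let eta := ramp del^-1 0.

Let earg_le t : (1 <= del^-1 * t + 0) = (del <= t).
Proof. by rewrite addr0 mulrC ler_pdivlMr// mul1r. Qed.

Let earg_ge t : (del^-1 * t + 0 <= 2) = (t <= 2 * del).
Proof. by rewrite addr0 mulrC ler_pdivrMr. Qed.

Let eta0 t : t <= del -> eta t = 0.
Proof. by move=> td; rewrite /eta /ramp step0// addr0 mulrC ler_pdivrMr// mul1r. Qed.

Let eta1 t : 2 * del <= t -> eta t = 1.
Proof. by move=> td; rewrite /eta /ramp step1// addr0 mulrC ler_pdivlMr. Qed.

Let deta t : ~~ (del <= t <= 2 * del) -> derive1 eta t = 0.
Proof. by move=> h; rewrite /eta derive1_ramp derive1_step_eq0 ?mulr0// earg_le earg_ge. Qed.

Let ddeta t : ~~ (del <= t <= 2 * del) -> derive1 (derive1 eta) t = 0.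
Proof. by move=> h; rewrite /eta derive2_ramp derive2_step_eq0 ?mulr0// earg_le earg_ge. Qed.

Let ceta : Cinf eta. Proof. exact: Cinf_ramp. Qed.
Let crho : Cinf rho. Proof. exact: Cinf_ramp. Qed.

Let wD (f : R -> R) : Cinf f -> {within D, continuous f}.
Proof. by move=> cf; apply: continuous_subspaceT; exact: Cinf_continuous. Qed.

Let wV := continuous_on_time_within R2T cV.
Let wV1 := continuous_on_time_within R2T cV1.
Let wW := continuous_on_time_within R2T cW.
Let wN := continuous_on_time_within R2T cN.

Let iM (f g : R -> R) : Cinf f -> {within D, continuous g} ->
  mu.-integrable D (EFin \o (fun t => f t * g t)).
Proof. by move=> cf cg; apply: continuous_integrable; apply: within_continuousM => //;
  exact: wD. Qed.

Let mD : (measurable (D : set (measurableTypeR R))). Proof. exact: measurable_itv. Qed.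

Let iB (f g : R -> R) : mu.-integrable D (EFin \o f) -> mu.-integrable D (EFin \o g) ->
  mu.-integrable D (EFin \o (fun t => f t - g t)).
Proof. by move=> hf hg; exact: (integrableB mD hf hg). Qed.

Let iZ k (f : R -> R) : mu.-integrable D (EFin \o f) ->
  mu.-integrable D (EFin \o (fun t => k * f t)).
Proof. by move=> hf; exact: (integrableZl mD k hf). Qed.

Local Notation "'iint' f" := (Rintegral mu D f) (at level 10).

(** [E1] is used with [eta - rho] and [E2] with [derive1 eta]. The terms with the second derivative
    of [eta], of size [del^-2], cancel; what is left of [eta] is its first derivative against
    [W - V1], which converges to the contribution of the data. *)
Lemma time_identity :
  iint (fun t => (eta t - rho t) * N t) + iint (fun t => derive1 eta t * (W t - V1 t)) =
  - (iint (fun t => derive1 (derive1 rho) t * V t) + 2 * iint (fun t => derive1 rho t * V1 t)).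
Proof.
have out_sub t a b a' b' : a <= a' -> b' <= b -> ~~ (a <= t <= b) -> ~~ (a' <= t <= b').
  move=> aa bb; apply: contra => /andP[h1 h2].
  by rewrite (le_trans aa h1) (le_trans h2 bb).
have dR2 : 2 * del <= R2 by rewrite (le_trans (ltW delR))// ltW.
have dR1 : del <= R1 by have := del0; have := delR; lra.
have out_eta t : ~~ (del <= t <= R2) -> ~~ (del <= t <= 2 * del) by exact: out_sub.
have out_rho t : ~~ (del <= t <= R2) -> ~~ (R1 <= t <= R2) by exact: out_sub.
have cdeta := Cinf_derive1 ceta; have cddeta := Cinf_derive1 cdeta.
have cdrho := Cinf_derive1 crho; have cddrho := Cinf_derive1 cdrho.
have supp1 t : ~~ (del <= t <= R2) -> eta t - rho t = 0.
  rewrite negb_and -!ltNge => /orP[h|h].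
    by rewrite eta0 ?rho0 ?subrr// ltW// (lt_le_trans h).
  by rewrite eta1 ?rho1 ?subrr// ltW// (le_lt_trans dR2).
have e1 := derive1B ceta crho; have e2 := derive1B cdeta cdrho.
have := E1 (CinfB ceta crho) del0 R2T supp1; rewrite e1 e2.
rewrite (@Rintegral_open_time _ del R2)//; last first.
  move=> t h; have h1 := out_eta _ h; have h2 := out_rho _ h.
  by rewrite (deta h1) (ddeta h1) (drho h2) (ddrho h2) subr0 mulr0 !mul0r addr0.
rewrite (@Rintegral_open_time _ del R2)//; last by move=> t /supp1 ->; rewrite mul0r.
move=> h1.
have := E2 cdeta del0 R2T (fun t h => deta (out_eta t h)).
rewrite (@Rintegral_open_time _ del R2)//; last first.
  by move=> t h; rewrite deta ?ddeta ?mul0r ?addr0//; auto.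
rewrite (@Rintegral_open_time _ del R2)//; last by move=> t h; rewrite deta ?mul0r//; auto.
move=> h2.
rewrite -h1.
have -> : iint (fun t => (derive1 (derive1 eta) t - derive1 (derive1 rho) t) * V t +
     2 * (derive1 eta t - derive1 rho t) * V1 t) =
   iint (fun t => derive1 (derive1 eta) t * V t) - iint (fun t => derive1 (derive1 rho) t * V t) +
   2 * (iint (fun t => derive1 eta t * V1 t) - iint (fun t => derive1 rho t * V1 t)).
  rewrite -!RintegralB//; try exact: iM.
  rewrite -RintegralZl//; last by apply: iB; exact: iM.
  rewrite -RintegralD//; last 2 first.
    by apply: iB; exact: iM.
    by apply: iZ; apply: iB; exact: iM.
  apply: eq_Rintegral => t _.
  move: (derive1 (derive1 eta) t) (derive1 (derive1 rho) t) => x1 x2.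
  move: (derive1 eta t) (derive1 rho t) (V t) (V1 t) => x3 x4 x5 x6.
  by ring.
move: h2; rewrite RintegralD//; [|exact: iM|exact: iM] => h2.
have -> : iint (fun t => derive1 eta t * (W t - V1 t)) =
   iint (fun t => derive1 eta t * W t) - iint (fun t => derive1 eta t * V1 t).
  rewrite -RintegralB//; [|exact: iM|exact: iM].
  by apply: eq_Rintegral => t _; rewrite mulrBr.
have alg (x1 x2 x3 x4 x5 : R) : x1 + x3 = - x5 ->
    x1 - x2 + 2 * (x3 - x4) + (x5 - x3) = - (x2 + 2 * x4) by move=> h; lra.
exact: alg h2.
Qed.

Let int_deta : iint (derive1 eta) = 1.
Proof.
have R20 : 0 < R2 by exact: lt_trans R12.
have ce := Cinf_continuous ceta.
have := @continuous_FTC2 R (derive1 eta) eta 0 R2 R20 (wD (Cinf_derive1 ceta)).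
rewrite /Rintegral => ->//.
- rewrite eta1; last by have := delR; have := R12; lra.
  by rewrite eta0 ?(ltW del0)//= subr0.
- split.
  + by move=> t _; have [] := Cinf_is_derive ceta t.
  + by apply: cvg_at_right_filter; exact: ce.
  + by apply: cvg_at_left_filter; exact: ce.
Qed.

Variables (e Nmax : R).
Hypothesis HN : forall t, 0 <= t <= R1 -> N t <= Nmax.
Hypothesis HF : forall t, 0 <= t <= 2 * del -> `|(W t - V1 t) - (W 0 - V1 0)| <= e.

Let Cs0 : 0 <= Cs. Proof. by have [h _] := HCs 0; exact: le_trans h. Qed.

Let DI t : 0 <= t <= R2 -> I t.
Proof. by move=> /andP[t0 tR]; split => //; rewrite (le_lt_trans _ R2T)// lee_fin. Qed.

Let int_restrict (a b : R) (f : R -> R) : 0 <= a -> b <= R2 ->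
  iint (f \_ `[a, b]) = \int[mu]_(t in `[a, b]) f t.
Proof.
move=> a0 bR; rewrite -Rintegral_mkcondr; congr Rintegral.
rewrite setIidr// => t /=; rewrite !in_itv/= => /andP[h1 h2].
by rewrite (le_trans a0 h1) (le_trans h2 bR).
Qed.

Let integrable_restrict_itv (a b : R) (f : R -> R) : 0 <= a -> b <= R2 ->
  {within D, continuous f} -> mu.-integrable D (EFin \o (f \_ `[a, b])).
Proof.
move=> a0 bR cf; have mI : measurable (`[a, b]%classic : set (measurableTypeR R))
  by exact: measurable_itv.
rewrite -restrict_EFin.
apply/(@integrable_restrict _ _ _ mu _ mI _ mD (EFin \o f)).
rewrite setIidr; last first.
  move=> t /=; rewrite !in_itv/= => /andP[h1 h2].
  by rewrite (le_trans a0 h1) (le_trans h2 bR).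
apply: (integrableS mD mI _ (continuous_integrable cf)).
move=> t /=; rewrite !in_itv/= => /andP[h1 h2].
by rewrite (le_trans a0 h1) (le_trans h2 bR).
Qed.

Let restrictE (a b : R) (f : R -> R) t : (f \_ `[a, b]) t = if a <= t <= b then f t else 0.
Proof.
by rewrite patchE; case: ifPn; rewrite ?inE ?notin_setE/= in_itv/=;
  [move=> ->|move=> /negP/negbTE ->].
Qed.

Let iD (f g : R -> R) : mu.-integrable D (EFin \o f) -> mu.-integrable D (EFin \o g) ->
  mu.-integrable D (EFin \o (fun t => f t + g t)).
Proof. by move=> hf hg; exact: (integrableD mD hf hg). Qed.

Let int_cst_restrict (a b k : R) : 0 <= a -> a <= b -> b <= R2 ->
  iint ((fun=> k) \_ `[a, b]) = k * (b - a).
Proof.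
move=> a0 ab bR; rewrite int_restrict// Rintegral_cst; last exact: measurable_itv.
rewrite [X in fine X](lebesgue_measure_itv `[a, b])/= lte_fin.
by case: ltgtP ab => //= -> _; rewrite subrr.
Qed.

Let lower_N : \int[mu]_(t in `[0, R1]) N t - 2 * del * Nmax <=
  iint (fun t => (eta t - rho t) * N t).
Proof.
have R1R2 : R1 <= R2 by exact: ltW.
have i1 := integrable_restrict_itv (lexx 0) R1R2 wN.
have d2 : 0 <= 2 * del by rewrite mulr_ge0// ltW.
have d2R : 2 * del <= R2 by rewrite (le_trans (ltW delR)).
have i2 : mu.-integrable D (EFin \o ((fun=> Nmax) \_ `[0, 2 * del])).
  apply: integrable_restrict_itv => //.
  by apply: continuous_subspaceT => x; exact: cvg_cst.
rewrite -(int_restrict N (lexx 0) R1R2).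
have -> : 2 * del * Nmax = iint ((fun=> Nmax) \_ `[0, 2 * del]).
  by rewrite int_cst_restrict// subr0 mulrC.
rewrite -RintegralB//; apply: le_Rintegral => //.
- exact: iB.
- by apply: iM => //; exact: CinfB.
move=> t; rewrite [D t]/= in_itv/= => /andP[t0 tR].
change ((N \_ `[0, R1]) t - ((fun=> Nmax) \_ `[0, 2 * del]) t <= (eta t - rho t) * N t).
rewrite !restrictE t0/=.
have N_ge0 : 0 <= N t by apply: N0; apply: DI; rewrite t0.
have eta_ge0 : 0 <= eta t by exact: step_ge0.
have [h1|h1] := leP t (2 * del).
  have tR1 : t <= R1 by rewrite (le_trans h1 (ltW delR)).
  rewrite tR1 rho0// subr0; apply: le_trans (mulr_ge0 eta_ge0 N_ge0).
  by rewrite subr_le0 HN// t0.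
rewrite eta1 ?(ltW h1)// subr0; case: ifPn => [tR1|_]; first by rewrite rho0// subr0 mul1r.
by rewrite mulr_ge0// subr_ge0 step_le1.
Qed.

(** The derivative of [eta] has integral 1 and is at most [Cs / del] on an interval of length [del],
    so the error [Cs * e] does not depend on [del]. *)
Let lower_F : (W 0 - V1 0) - Cs * e <= iint (fun t => derive1 eta t * (W t - V1 t)).
Proof.
have cdeta := Cinf_derive1 ceta.
have wF : {within D, continuous (fun t => W t - V1 t)}.
  by move=> x; apply: (@cvgB _ _ _ (nbhs (x : subspace D))); [exact: wW|exact: wV1].
have d2R : 2 * del <= R2 by rewrite (le_trans (ltW delR))// ltW.
have i1 : mu.-integrable D (EFin \o derive1 eta) by apply: continuous_integrable; exact: wD.
have i2 : mu.-integrable D (EFin \o ((fun=> Cs / del * e) \_ `[del, 2 * del])).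
  apply: integrable_restrict_itv => //; first exact: ltW.
  by apply: continuous_subspaceT => x; exact: cvg_cst.
have -> : Cs * e = iint ((fun=> Cs / del * e) \_ `[del, 2 * del]).
  rewrite int_cst_restrict ?(ltW del0)//; last by rewrite mulr_natl mulr2n lerDl ltW.
  by field; exact: lt0r_neq0.
have -> : W 0 - V1 0 = iint (fun t => (W 0 - V1 0) * derive1 eta t).
  by rewrite RintegralZl// int_deta mulr1.
rewrite -RintegralB//; last exact: iZ.
apply: le_Rintegral => //.
- by apply: iB => //; exact: iZ.
- exact: iM.
move=> t; rewrite [D t]/= in_itv/= => /andP[t0 tR].
change ((W 0 - V1 0) * derive1 eta t - ((fun=> Cs / del * e) \_ `[del, 2 * del]) t <=
  derive1 eta t * (W t - V1 t)).
rewrite restrictE.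
case: ifPn => [/andP[h1 h2]|/deta ->]; last by rewrite mulr0 mul0r subrr.
have hF := HF (_ : 0 <= t <= 2 * del); rewrite t0 h2 in hF.
move: (hF isT); rewrite lerBlDr -lerBlDl mulrC -mulrBr => {}hF.
have hd : `|derive1 eta t| <= Cs / del.
  rewrite /eta derive1_ramp normrM gtr0_norm ?invr_gt0// mulrC ler_wpM2r ?invr_ge0 ?(ltW del0)//.
  by have [] := HCs (del^-1 * t + 0).
rewrite (le_trans (ler_norm _))// normrM ler_pM// distrC//.
Qed.

Let upper_G : - (iint (fun t => derive1 (derive1 rho) t * V t) +
    2 * iint (fun t => derive1 rho t * V1 t)) <= \int[mu]_(t in `[R1, R2]) G t.
Proof.
have cdrho := Cinf_derive1 crho; have cddrho := Cinf_derive1 cdrho.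
have j1 := iM cddrho wV; have j2 := iM cdrho wV1.
rewrite -RintegralZl// -RintegralD//; last exact: iZ.
rewrite -(int_restrict G (ltW R10) (lexx R2)).
have jj := iD j1 (iZ 2 j2).
apply: le_trans (_ : iint (fun t => `|derive1 (derive1 rho) t * V t + 2 * (derive1 rho t * V1
  t)|) <= _).
  by rewrite (le_trans (ler_norm _))// normrN le_normr_Rintegral.
apply: le_Rintegral => //.
- exact: (integrable_norm jj).
- by apply: integrable_restrict_itv => //; exact: ltW.
move=> t; rewrite [D t]/= in_itv/= => /andP[t0 tR].
change (`|derive1 (derive1 rho) t * V t + 2 * (derive1 rho t * V1 t)| <= (G \_ `[R1, R2]) t).
rewrite restrictE.
case: ifPn => [tt|h]; last by rewrite (drho h) (ddrho h) !mul0r mulr0 addr0 normr0.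
apply: le_trans (HG tt); rewrite (le_trans (ler_normD _ _))// lerD//.
  rewrite normrM ler_wpM2r// /rho derive2_ramp normrM ger0_norm ?sqr_ge0// mulrC.
  rewrite /d exprVn ler_wpM2r ?invr_ge0 ?sqr_ge0//.
  by have [_] := HCs (d * t + c).
rewrite !normrM [`|2|]ger0_norm// mulrA ler_wpM2r// ler_wpM2l//.
rewrite /rho derive1_ramp normrM gtr0_norm// mulrC ler_wpM2r ?(ltW d0)//.
by have [] := HCs (d * t + c).
Qed.

Lemma time_inequality_delta :
  \int[mu]_(t in `[0, R1]) N t - 2 * del * Nmax + ((W 0 - V1 0) - Cs * e) <=
  \int[mu]_(t in `[R1, R2]) G t.
Proof.
by apply: le_trans upper_G; rewrite -time_identity; exact: lerD.
Qed.

End eta.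

Lemma time_inequality :
  \int[mu]_(t in `[0, R1]) N t + (W 0 - V1 0) <= \int[mu]_(t in `[R1, R2]) G t.
Proof.
have R20 : 0 < R2 by exact: lt_trans R12.
have I0 : I 0 by split => //; rewrite (lt_trans _ R2T)// lte_fin.
have Cs0 : 0 <= Cs by have [h _] := HCs 0; exact: le_trans h.
have [tm _ HNm] := EVT_max (ltW R20) (continuous_on_time_within R2T cN).
pose Nmax := `|N tm|; have Nm0 : 0 <= Nmax by exact: normr_ge0.
have HN t : 0 <= t <= R1 -> N t <= Nmax.
  move=> /andP[t0 tR]; apply: le_trans (ler_norm _); apply: HNm.
  by rewrite in_itv/= t0 (le_trans tR)// ltW.
apply/ler_addgt0Pr => e e0.
have Cs1 : 0 < 2 * (Cs + 1) by rewrite mulr_gt0// ltr_wpDl.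
have N1 : 0 < 4 * (Nmax + 1) by rewrite mulr_gt0// ltr_wpDl.
have e'0 : 0 < e / (2 * (Cs + 1)) by rewrite divr_gt0.
have /cvgrPdist_le/(_ _ e'0) : (W s - V1 s) @[s --> within I (nbhs 0)] --> W 0 - V1 0.
  by apply: cvgB; [exact: cW|exact: cV1].
rewrite near_withinE => /nbhs_ballP[d' /= d'0 Hd'].
(* In this order: [[0, 2 * del]] stays where [W - V1] is close to its value at 0; the two cutoffs do
   not overlap; the loss [2 * del * Nmax] is at most [e / 2]. *)
pose del := Num.min (d' / 4) (Num.min (R1 / 4) (e / (4 * (Nmax + 1)))).
have del0 : 0 < del by rewrite !lt_min !divr_gt0.
have del1 : del <= d' / 4 by rewrite ge_min lexx.
have del2 : del <= R1 / 4 by rewrite !ge_min lexx orbT.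
have del3 : del <= e / (4 * (Nmax + 1)) by rewrite !ge_min lexx !orbT.
have delR : 2 * del < R1 by lra.
have HF t : 0 <= t <= 2 * del -> `|(W t - V1 t) - (W 0 - V1 0)| <= e / (2 * (Cs + 1)).
  move=> /andP[t0 td]; rewrite distrC; apply: Hd'.
    by rewrite -ball_normE/= sub0r normrN ger0_norm//; lra.
  split => //; apply: (lt_trans _ R2T); rewrite lte_fin; have := R12; lra.
have := time_inequality_delta del0 delR HN HF.
have h1 : 2 * del * Nmax <= e / 2.
  apply: (@le_trans _ _ (2 * (e / (4 * (Nmax + 1))) * (Nmax + 1))).
    by rewrite ler_pM// ?lerDl ?mulr_ge0 ?(ltW del0)// ler_wpM2l.
  by apply: eq_leW; field; rewrite gt_eqF// ltr_wpDl.
have h2 : Cs * (e / (2 * (Cs + 1))) <= e / 2.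
  have -> : Cs * (e / (2 * (Cs + 1))) = e / 2 * (Cs / (Cs + 1)).
    by field; rewrite gt_eqF// ltr_wpDl.
  apply: ler_piMr; first by rewrite divr_ge0// ltW.
  by rewrite ler_pdivrMr ?ltr_wpDl// mul1r lerDl.
by move: (Rintegral _ _ _) (Rintegral _ _ _) => X Y; lra.
Qed.

End time_cutoff.

(** * The weighted wave inequality *)

Section young.
Variable R : realType.

Lemma powRVl (x y : R) : 0 <= x -> x^-1 `^ y = x `^ (- y).
Proof. by move=> x0; rewrite -(powR_inv1 x0) -powRrM mulN1r. Qed.

Lemma young_param (p mu_ a b : R) : 1 < p -> 0 < mu_ -> 0 <= a -> 0 <= b ->
  a * b <= mu_ * a `^ p + mu_ `^ (- (p - 1)^-1) * b `^ (p / (p - 1)).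
Proof.
move=> p1 m0 a0 b0; have p10 : 0 < p - 1 by rewrite subr_gt0.
have p0 : 0 < p by rewrite (lt_trans _ p1).
have [h|h] := leP b (mu_ * a `^ (p - 1)).
  rewrite ler_wpDr ?mulr_ge0 ?powR_ge0// -(mulr_powRB1 a0 p0) mulrCA.
  by rewrite ler_wpM2l.
rewrite ler_wpDl ?mulr_ge0 ?powR_ge0 ?(ltW m0)//.
have b_gt0 : 0 < b by rewrite (le_lt_trans _ h)// mulr_ge0 ?powR_ge0// ltW.
have -> : p / (p - 1) = 1 + (p - 1)^-1 by field; rewrite gt_eqF.
rewrite powRD_gt0//.
rewrite powRr1// mulrCA [a * b]mulrC ler_wpM2l//.
have q0 : 0 <= (p - 1)^-1 by rewrite invr_ge0 ltW.
have -> : a = (a `^ (p - 1)) `^ (p - 1)^-1 by rewrite -powRrM mulfV ?gt_eqF// powRr1.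
have -> : mu_ `^ (- (p - 1)^-1) * b `^ (p - 1)^-1 = (b / mu_) `^ (p - 1)^-1.
  rewrite powRM ?invr_ge0 ?(ltW m0)// mulrC; congr (_ * _).
  by rewrite powRVl// ltW.
apply: powR_le => //; first exact: powR_ge0.
by rewrite ler_pdivlMr// mulrC ltW.
Qed.

Lemma young_optimize (p a A B : R) : 1 < p -> 0 <= a -> 0 <= A -> 0 < B ->
  (forall mu_, 0 < mu_ -> a <= mu_ * A + mu_ `^ (- (p - 1)^-1) * B) ->
  a `^ p <= 2 `^ p * A * B `^ (p - 1).
Proof.
move=> p1 a0 A0 B0 H; have p10 : 0 < p - 1 by rewrite subr_gt0.
have p0 : 0 < p by rewrite (lt_trans _ p1).
move: a0; rewrite le_eqVlt => /predU1P[<-|a0].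
  by rewrite powR0 ?gt_eqF// !mulr_ge0 ?powR_ge0.
have Ba : 0 < 2 * B / a by rewrite divr_gt0// mulr_gt0.
have := H ((2 * B / a) `^ (p - 1)) (powR_gt0 _ Ba).
rewrite -powRrM mulrN mulfV ?gt_eqF// powR_inv1 ?(ltW Ba)//.
have -> : (2 * B / a)^-1 * B = a / 2 by field; rewrite !gt_eqF.
move=> h; have {}h : a / 2 <= (2 * B / a) `^ (p - 1) * A by lra.
rewrite -(mulr_powRB1 (ltW a0) p0).
have -> : 2 `^ p * A * B `^ (p - 1) = 2 * ((2 * B / a) `^ (p - 1) * A) * a `^ (p - 1).
  rewrite -(mulr_powRB1 (ltW (ltr0Sn R 1)) p0).
  rewrite [X in 2 * (X * A)]powRM ?invr_ge0 ?mulr_ge0 ?(ltW a0) ?(ltW B0)//.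
  rewrite powRM ?(ltW B0)// (powRVl _ (ltW a0)) powRN.
  by field; rewrite gt_eqF ?powR_gt0.
by rewrite ler_wpM2r ?powR_ge0//; lra.
Qed.

End young.

Section wave_curve.
Variables (R : realType) (n : nat) (T : \bar R) (r : R).
Hypothesis r0 : 0 <= r.
Local Notation mu := (lebesgue_rV R n).
Local Notation leb := (@lebesgue_measure R).
Local Notation I := (time_interval T).
Local Notation J := (open_time_interval T).
Local Notation L1_curve := (L1_curve T r).

Record wave_curve (w wt h : R -> 'rV[R]_n -> R) : Prop := WaveCurve {
  wave_curve_w : L1_curve w;
  wave_curve_wt : L1_curve wt;
  wave_curve_h : L1_curve h;
  wave_curve_ge0 : forall t x, I t -> 0 <= h t x;
  wave_curve_dt : forall phi, smooth_expr phi -> test_function_slab T phi ->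
    pairing T w (dt phi) = - pairing T wt phi;
  wave_curve_eq : forall phi, smooth_expr phi -> test_function_slab T phi ->
    pairing T w (fun z => dt (dt phi) z - laplacian phi z) = pairing T h phi }.

(** The weight has to solve the wave equation only where the curves live, on [|x| <= t + r]; beyond
    it may be cut off. The larger cone [|x| <= t + L] keeps its slices compactly supported, so that
    a cutoff in time makes it a test function. *)
Record wave_weight (L : R) (psi : 'rV[R]_n * R -> R) : Prop := WaveWeight {
  wave_weight_smooth : smooth_expr psi;
  wave_weight_supp : forall x t, 0 <= t -> psi (x, t) != 0 -> enorm x <= t + L;
  wave_weight_eq : forall x t, 0 <= t -> enorm x <= t + r ->
    dt (dt psi) (x, t) - laplacian psi (x, t) = 0;
  wave_weight_ge0 : forall x t, 0 <= t -> enorm x <= t + r -> 0 <= psi (x, t) }.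

Variables (w wt h : R -> 'rV[R]_n -> R) (L : R) (psi : 'rV[R]_n * R -> R).
Hypotheses (Hw : wave_curve w wt h) (Hpsi : wave_weight L psi).

Let spsi := wave_weight_smooth Hpsi.
Let sdt : smooth_expr (dt psi) := smooth_expr_derive _ spsi.

Let cw := wave_curve_w Hw.
Let cwt := wave_curve_wt Hw.
Let ch := wave_curve_h Hw.

Definition slice_pairing (f : R -> 'rV[R]_n -> R) (phi : 'rV[R]_n * R -> R) (t : R) : R :=
  \int[mu]_x (f t x * phi (x, t)).

Local Notation sp := slice_pairing.

Lemma dt_time_mul (chi : R -> R) (phi : 'rV[R]_n * R -> R) : Cinf chi -> smooth_expr phi ->
  dt (fun z => chi z.2 * phi z) = fun z => derive1 chi z.2 * phi z + chi z.2 * dt phi z.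
Proof.
move=> cchi sphi; apply/funext => z; rewrite /dt derive_mulE; last 2 first.
- exact: smooth_expr_differentiable (SE_comp cchi (SE_time _ _)) _.
- exact: smooth_expr_differentiable.
rewrite derive_comp1//; last exact: smooth_expr_differentiable (SE_time _ _) _.
by have -> : 'D_((0, 1) : 'rV[R]_n * R) snd z = 1 := dt_time z; rewrite mulr1.
Qed.

Lemma dx_time_mul i (chi : R -> R) (phi : 'rV[R]_n * R -> R) : Cinf chi -> smooth_expr phi ->
  dx i (fun z => chi z.2 * phi z) = fun z => chi z.2 * dx i phi z.
Proof.
move=> cchi sphi; apply/funext => z; rewrite /dx derive_mulE; last 2 first.
- exact: smooth_expr_differentiable (SE_comp cchi (SE_time _ _)) _.
- exact: smooth_expr_differentiable.
rewrite derive_comp1//; last exact: smooth_expr_differentiable (SE_time _ _) _.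
have -> : 'D_((delta_mx ord0 i, 0) : 'rV[R]_n * R) snd z = 0 := dx_time i z.
by rewrite mulr0 mul0r add0r.
Qed.

Lemma laplacian_time_mul (chi : R -> R) (phi : 'rV[R]_n * R -> R) : Cinf chi -> smooth_expr phi ->
  laplacian (fun z => chi z.2 * phi z) = fun z => chi z.2 * laplacian phi z.
Proof.
move=> cchi sphi; apply/funext => z; rewrite /laplacian mulr_sumr.
apply: eq_bigr => i _; rewrite dx_time_mul// dx_time_mul//.
exact: smooth_expr_derive.
Qed.

Lemma dt2_time_mul (chi : R -> R) (phi : 'rV[R]_n * R -> R) z : Cinf chi -> smooth_expr phi ->
  dt (dt (fun z => chi z.2 * phi z)) z =
  derive1 (derive1 chi) z.2 * phi z + 2 * derive1 chi z.2 * dt phi z + chi z.2 * dt (dt phi) z.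
Proof.
move=> cchi sphi; have cchi' := Cinf_derive1 cchi.
have s1 := SE_mul (SE_comp cchi' (SE_time R n)) sphi.
have sdphi : smooth_expr (dt phi) := smooth_expr_derive _ sphi.
have s2 := SE_mul (SE_comp cchi (SE_time R n)) sdphi.
rewrite dt_time_mul// {1}/dt derive_addE; last 2 first.
- exact: smooth_expr_differentiable s1 _.
- exact: smooth_expr_differentiable s2 _.
have -> : 'D_((0, 1) : 'rV[R]_n * R) (fun z0 => derive1 chi z0.2 * phi z0) z = _ :=
  congr1 (fun f => f z) (dt_time_mul cchi' sphi).
have -> : 'D_((0, 1) : 'rV[R]_n * R) (fun z0 => chi z0.2 * dt phi z0) z = _ :=
  congr1 (fun f => f z) (dt_time_mul cchi sdphi).
by rewrite /=; ring.
Qed.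

Lemma slice_pairing_continuous f phi : L1_curve f -> smooth_expr phi ->
  continuous_on_time T (sp f phi).
Proof. by move=> cf sphi t It; exact: (curve_pairing_cont r0 cf sphi It). Qed.

Let test (chi : R -> R) (a b : R) : Cinf chi -> 0 < a -> (b%:E < T)%E ->
  (forall t, ~~ (a <= t <= b) -> chi t = 0) ->
  test_function_slab T (fun z => chi z.2 * psi z).
Proof.
move=> cchi a0 bT chi0.
apply: (@test_function_slab_mul _ _ T chi psi a b (b + `|L|)) => //.
move=> x t /andP[at_ tb] psi0 i; apply: le_trans (coord_le_enorm x i) _.
have t0 : 0 <= t by rewrite (le_trans (ltW a0)).
by apply: le_trans (wave_weight_supp Hpsi t0 psi0) _; rewrite lerD// ler_norm.
Qed.

Let stest (chi : R -> R) : Cinf chi -> smooth_expr (fun z : 'rV[R]_n * R => chi z.2 * psi z).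
Proof. by move=> cchi; exact: SE_mul (SE_comp cchi (SE_time _ _)) spsi. Qed.

Let JI t : J t -> I t. Proof. by move=> [t0 tT]; split => //; exact: ltW. Qed.

(** On the support of [w] the term with [chi] itself drops out because [psi] is a free wave there;
    only derivatives of [chi] remain. *)
Lemma weak_E1 (chi : R -> R) (a b : R) : Cinf chi -> 0 < a -> (b%:E < T)%E ->
  (forall t, ~~ (a <= t <= b) -> chi t = 0) ->
  \int[leb]_(t in J) (derive1 (derive1 chi) t * sp w psi t +
    2 * derive1 chi t * sp w (dt psi) t) =
  \int[leb]_(t in J) (chi t * sp h psi t).
Proof.
move=> cchi a0 bT chi0; have := wave_curve_eq Hw (stest cchi) (test cchi a0 bT chi0).
have -> : pairing T h (fun z => chi z.2 * psi z) = \int[leb]_(t in J) (chi t * sp h psi t).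
  apply: eq_Rintegral => t; rewrite inE => /JI It.
  rewrite /sp -RintegralZl//; last exact: (curve_pairing_integrable ch).
  by apply: eq_Rintegral => x _ /=; ring.
move=> <-; apply: eq_Rintegral => t; rewrite inE => Jt; have It := JI Jt.
have i1 := curve_pairing_integrable cw spsi t It.
have i2 := curve_pairing_integrable cw sdt t It.
rewrite /sp -RintegralZl// -RintegralZl// -RintegralD//; last 2 first.
- exact: integrableZ_fun.
- exact: integrableZ_fun.
apply: eq_Rintegral => x _; rewrite dt2_time_mul// laplacian_time_mul//=.
have [xr|xr] := leP (enorm x) (t + r); last by rewrite (L1_curve_supp cw It xr) !mul0r !mulr0 addr0.
have t0 : 0 <= t by case: It.
have /eqP := wave_weight_eq Hpsi t0 xr; rewrite subr_eq0 => /eqP ->.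
by ring.
Qed.

Lemma weak_E2 (chi : R -> R) (a b : R) : Cinf chi -> 0 < a -> (b%:E < T)%E ->
  (forall t, ~~ (a <= t <= b) -> chi t = 0) ->
  \int[leb]_(t in J) (derive1 chi t * sp w psi t + chi t * sp w (dt psi) t) =
  - \int[leb]_(t in J) (chi t * sp wt psi t).
Proof.
move=> cchi a0 bT chi0; have := wave_curve_dt Hw (stest cchi) (test cchi a0 bT chi0).
have -> : pairing T wt (fun z => chi z.2 * psi z) = \int[leb]_(t in J) (chi t * sp wt psi t).
  apply: eq_Rintegral => t; rewrite inE => /JI It.
  rewrite /sp -RintegralZl//; last exact: (curve_pairing_integrable cwt).
  by apply: eq_Rintegral => x _ /=; ring.
move=> <-; apply: eq_Rintegral => t; rewrite inE => Jt; have It := JI Jt.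
have i1 := curve_pairing_integrable cw spsi t It.
have i2 := curve_pairing_integrable cw sdt t It.
rewrite /sp -RintegralZl// -RintegralZl// -RintegralD//; last 2 first.
- exact: integrableZ_fun.
- exact: integrableZ_fun.
by apply: eq_Rintegral => x _; rewrite dt_time_mul//=; ring.
Qed.

Variables (p Cs R1 R2 B : R) (g : R -> 'rV[R]_n -> R).
Hypotheses (p1 : 1 < p) (R10 : 0 < R1) (R12 : R1 < R2) (R2T : (R2%:E < T)%E) (B0 : 0 < B).
Hypothesis HCs : forall y, `|derive1 (@step R) y| <= Cs /\ `|derive1 (derive1 (@step R)) y| <= Cs.
Hypothesis cwp : L1_curve (fun t x => `|w t x| `^ p).
Hypothesis Hg : forall t x, R1 <= t <= R2 -> enorm x <= t + r ->
  Cs / (R2 - R1) ^+ 2 * `|psi (x, t)| + 2 * (Cs / (R2 - R1)) * `|dt psi (x, t)| <= g t x.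
Hypothesis g0 : forall t x, 0 <= g t x.
Hypothesis ig : forall t, R1 <= t <= R2 ->
  mu.-integrable setT (EFin \o (fun x => g t x `^ (p / (p - 1)))).
Hypothesis HB : forall t, R1 <= t <= R2 -> \int[mu]_x (g t x `^ (p / (p - 1))) <= B.

Definition mass (f : R -> 'rV[R]_n -> R) (t : R) : R := \int[mu]_x f t x.

Lemma mass_continuous f : L1_curve f -> continuous_on_time T (mass f).
Proof.
move=> cf; have := slice_pairing_continuous cf (SE_cst _ 1).
rewrite (_ : sp f (fun=> 1) = mass f)//; apply/funext => t.
by apply: eq_Rintegral => x _; rewrite mulr1.
Qed.

(** The cutoff terms are at most the integral of [|w| g] over the annulus. Young's inequality with a
    free parameter is inserted under the integral over space, [time_inequality] integrates it in
    time, and the parameter is optimised last. *)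
Lemma key_inequality :
  0 <= sp wt psi 0 - sp w (dt psi) 0 ->
  (\int[leb]_(t in `[0, R1]) sp h psi t + (sp wt psi 0 - sp w (dt psi) 0)) `^ p <=
  2 `^ p * (\int[leb]_(t in `[R1, R2]) mass (fun t x => `|w t x| `^ p) t) *
    (B * (R2 - R1)) `^ (p - 1).
Proof.
move=> G0.
set wp := fun t x => `|w t x| `^ p.
have Isub t : 0 <= t <= R2 -> I t.
  by move=> /andP[t0 tR]; split => //; rewrite (le_lt_trans _ R2T)// lee_fin.
have R1I t : R1 <= t <= R2 -> I t.
  by move=> /andP[t1 t2]; apply: Isub; rewrite t2 (le_trans (ltW R10)).
have cM := mass_continuous cwp.
have M0 t : 0 <= mass wp t by apply: Rintegral_ge0 => x _; exact: powR_ge0.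
have N0 t : I t -> 0 <= sp h psi t.
  move=> It; apply: Rintegral_ge0 => x _.
  have [xr|xr] := leP (enorm x) (t + r); last by rewrite (L1_curve_supp ch It xr) mul0r.
  by rewrite mulr_ge0 ?(wave_curve_ge0 Hw)// (wave_weight_ge0 Hpsi)//; case: It.
have D0 : 0 < R2 - R1 by rewrite subr_gt0.
have Mint : leb.-integrable `[R1, R2] (EFin \o mass wp).
  have := continuous_integrable (continuous_on_time_within R2T cM).
  apply: integrableS; try exact: measurable_itv.
  by move=> t /=; rewrite !in_itv/= => /andP[t1 t2]; rewrite t2 (le_trans (ltW R10)).
apply: young_optimize => //.
- rewrite addr_ge0// Rintegral_ge0// => t; rewrite /= in_itv/= => /andP[t0 tR].
  by apply: N0; apply: Isub; rewrite t0 (le_trans tR (ltW R12)).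
- by apply: Rintegral_ge0.
- by rewrite mulr_gt0.
move=> m m0.
have intG : \int[leb]_(t in `[R1, R2]) (m * mass wp t + m `^ (- (p - 1)^-1) * B) =
    m * \int[leb]_(t in `[R1, R2]) mass wp t + m `^ (- (p - 1)^-1) * (B * (R2 - R1)).
  have mR : measurable (`[R1, R2]%classic : set (measurableTypeR R)) by exact: measurable_itv.
  have i1 : leb.-integrable `[R1, R2] (EFin \o (fun t => m * mass wp t)).
    exact: (integrableZl mR m Mint).
  have i2 : leb.-integrable `[R1, R2] (EFin \o (fun=> m `^ (- (p - 1)^-1) * B)).
    by apply: continuous_integrable; apply: continuous_subspaceT => x; exact: cvg_cst.
  rewrite RintegralD//; congr (_ + _); first by rewrite RintegralZl.
  rewrite Rintegral_cst// mulrA; congr (_ * _).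
  by rewrite [X in fine X](lebesgue_measure_itv `[R1, R2])/= lte_fin R12.
rewrite -intG.
apply: (time_inequality (slice_pairing_continuous cw spsi) (slice_pairing_continuous cw sdt)
  (slice_pairing_continuous cwt spsi) (slice_pairing_continuous ch spsi) N0 weak_E1 weak_E2
  R10 R12 R2T HCs).
  apply: within_continuousD.
    apply: within_continuousM; first by apply: continuous_subspaceT => x; exact: cvg_cst.
    exact: continuous_on_time_within R2T cM.
  by apply: continuous_subspaceT => x; exact: cvg_cst.
move=> t tt; have It := R1I t tt.
set c1 := Cs / (R2 - R1) ^+ 2; set c2 := 2 * (Cs / (R2 - R1)).
have Cs0 : 0 <= Cs by have [hh _] := HCs 0; exact: le_trans hh.
have c10 : 0 <= c1 by rewrite divr_ge0 ?sqr_ge0.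
have c20 : 0 <= c2 by rewrite mulr_ge0// divr_ge0// ltW.
have i1 := curve_pairing_integrable cw spsi t It.
have i2 := curve_pairing_integrable cw sdt t It.
have iw := L1_curve_int cwp It.
apply: (@le_trans _ _ (\int[mu]_x (c1 * `|w t x * psi (x, t)| + c2 * `|w t x * dt psi (x, t)|))).
  rewrite RintegralD//; [|by apply: integrableZ_fun; exact: integrable_abs_fun..].
  rewrite !RintegralZl//; [|exact: integrable_abs_fun..].
  by rewrite lerD// ler_wpM2l// le_normr_Rintegral.
apply: (@le_trans _ _ (\int[mu]_x (m * `|w t x| `^ p + m `^ (- (p - 1)^-1) * g t x `^ (p / (p -
  1))))).
  apply: le_Rintegral => //.
  - by apply: integrableD_fun; apply: integrableZ_fun; exact: integrable_abs_fun.
  - by apply: integrableD_fun; apply: integrableZ_fun => //; exact: ig.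
  move=> x _; apply: le_trans (young_param p1 m0 (normr_ge0 (w t x)) (g0 t x)).
  have [xr|xr] := leP (enorm x) (t + r); last
    by rewrite (L1_curve_supp cw It xr) !mul0r normr0 !mulr0 addr0 mul0r.
  rewrite !normrM !(mulrCA _ `|w t x|) -mulrDr ler_wpM2l//; exact: Hg.
rewrite RintegralD//; [|by apply: integrableZ_fun => //; exact: ig..].
rewrite !RintegralZl//; last exact: ig.
by rewrite lerD2l ler_wpM2l ?powR_ge0// HB.
Qed.

End wave_curve.

(** * Free waves inside the cone *)

Section dyadic.
Variable R : realType.

Lemma powR_anti (k x y : R) : 0 <= k -> 0 < x -> x <= y -> y `^ (- k) <= x `^ (- k).
Proof.
move=> k0 x0 xy; rewrite !powRN lef_pV2 ?posrE ?powR_gt0 ?(lt_le_trans x0)//.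
by apply: powR_le => //; exact: ltW.
Qed.

Lemma powR_lt_exp (a x y : R) : 1 < a -> x < y -> a `^ x < a `^ y.
Proof.
move=> a1 xy; have a0 : 0 < a by rewrite (lt_trans _ a1).
by rewrite /powR (gt_eqF a0) ltr_expR ltr_pM2r// ln_gt0.
Qed.

Lemma dyadic_bracket (xi : R) : 1 <= xi -> exists m : nat, 2 ^+ m <= xi < 2 ^+ m.+1.
Proof.
move=> xi1; have /andP[h1 h2] := truncn_itv (le_trans ler01 xi1).
set k := Num.truncn xi in h1 h2.
have k0 : (0 < k)%N by rewrite -ltnS -(ltr_nat R) (le_lt_trans xi1).
have /andP[t1 t2] := trunc_log_bounds (ltnSn 1) k0.
exists (trunc_log 2 k); rewrite -!natrX (le_trans _ h1) ?ler_nat//=.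
by rewrite (lt_le_trans h2)// ler_nat.
Qed.

Lemma powR_natmul (x a : R) (j : nat) : x `^ (a * j%:R) = (x `^ a) ^+ j.
Proof. by rewrite powRrM powR_mulrn// powR_ge0. Qed.

Lemma powR_exprn (x a : R) (j : nat) : 0 <= x -> (x ^+ j) `^ a = (x `^ a) ^+ j.
Proof. by move=> x0; rewrite -powR_mulrn// -powRrM mulrC powR_natmul. Qed.

(** Discrete form of the integral of [l^(gam-1) (xi + l)^(-sig)] over [l > 0]. For [2^j] up to [xi]
    the terms are dominated by an increasing geometric sequence times [xi^(-sig)], beyond by a
    decreasing one; both parts are of the size of the middle term. *)
Lemma dyadic_sum (gam sig : R) : 0 < gam < sig -> exists2 C : R, 0 < C &
  forall (xi : R) (J : nat), 1 <= xi ->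
  \sum_(0 <= j < J) 2 `^ (gam * j%:R) * (xi + 2 ^+ j) `^ (- sig) <= C * xi `^ (gam - sig).
Proof.
move=> /andP[g0 gs]; pose a : R := 2 `^ gam; pose b : R := 2 `^ (gam - sig).
have lt12 : (1 : R) < 2 by rewrite ltr1n.
have a1 : 1 < a by have := powR_lt_exp lt12 g0; rewrite powRr0.
have b1 : b < 1.
  have gs0 : gam - sig < 0 by rewrite subr_lt0.
  by have := powR_lt_exp lt12 gs0; rewrite powRr0.
have b0 : 0 < b by exact: powR_gt0.
have a0 : 0 < a by exact: powR_gt0.
have a10 : 0 < a - 1 by rewrite subr_gt0.
have b10 : 0 < 1 - b by rewrite subr_gt0.
exists (a / (a - 1) + (1 - b)^-1); first by rewrite addr_gt0// ?divr_gt0// invr_gt0.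
move=> xi J xi1; have [m /andP[m1 m2]] := dyadic_bracket xi1.
have xi0 : 0 < xi by rewrite (lt_le_trans ltr01).
have s0 : 0 <= sig by rewrite ltW// (lt_trans g0).
pose t j := 2 `^ (gam * j%:R) * (xi + 2 ^+ j) `^ (- sig).
have two0 j : 0 < 2 ^+ j :> R by rewrite exprn_gt0.
have aj j : 2 `^ (gam * j%:R) = a ^+ j by exact: powR_natmul.
have t1 j : t j <= a ^+ j * xi `^ (- sig).
  rewrite /t aj ler_wpM2l ?exprn_ge0 ?(ltW a0)// powR_anti//.
  by rewrite lerDl ltW.
have t2 j : t j <= b ^+ j.
  have -> : b ^+ j = a ^+ j * (2 ^+ j) `^ (- sig).
    rewrite powR_exprn// -exprMn; congr (_ ^+ _); by rewrite -powRD_gt0.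
  rewrite /t aj ler_wpM2l ?exprn_ge0 ?(ltW a0)// powR_anti//.
  by rewrite lerDr ltW.
have S1 k : \sum_(0 <= j < k) t j <= a ^+ k / (a - 1) * xi `^ (- sig).
  elim: k => [|k IH]; first by rewrite big_geq// mulr_ge0 ?powR_ge0// divr_ge0 ?exprn_ge0 ?ltW.
  rewrite big_nat_recr//= (le_trans (lerD IH (t1 k)))// -mulrDl ler_wpM2r ?powR_ge0//.
  by rewrite exprS; apply: eq_leW; field; rewrite gt_eqF.
have S2 k : \sum_(0 <= j < m.+1 + k) t j <= a ^+ m.+1 / (a - 1) * xi `^ (- sig) +
    b ^+ m.+1 * ((1 - b ^+ k) / (1 - b)).
  elim: k => [|k IH]; first by rewrite addn0 expr0 subrr mul0r mulr0 addr0 S1.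
  rewrite addnS big_nat_recr//= (le_trans (lerD IH (t2 _)))// -addrA lerD2l exprD -mulrDr.
  rewrite ler_wpM2l ?exprn_ge0 ?(ltW b0)// exprS.
  by apply: eq_leW; field; rewrite gt_eqF.
have tj0 j : 0 <= t j by rewrite mulr_ge0 ?powR_ge0.
apply: (@le_trans _ _ (\sum_(0 <= j < m.+1 + J) t j)).
  rewrite (@big_cat_nat _ _ _ J 0%N (m.+1 + J))//= ?leq_addl//.
  by rewrite lerDl sumr_ge0.
have am : a ^+ m <= xi `^ gam.
  by rewrite /a -powR_exprn//; apply: powR_le; rewrite ?(ltW g0)// exprn_ge0.
have bm : b ^+ m.+1 <= xi `^ (gam - sig).
  have -> : b ^+ m.+1 = (2 ^+ m.+1) `^ (- (sig - gam)).
    by rewrite opprB /b powR_exprn.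
  by rewrite -[gam - sig]opprB powR_anti ?subr_ge0 ?(ltW gs)// ltW.
apply: le_trans (S2 J) _; rewrite [X in _ <= X]mulrDl; apply: lerD.
  have -> : xi `^ (gam - sig) = xi `^ gam * xi `^ (- sig).
    by rewrite -powRD_gt0.
  rewrite mulrA ler_wpM2r ?powR_ge0// exprS mulrAC ler_wpM2l//.
  by rewrite divr_ge0 ?(ltW a0) ?(ltW a10).
rewrite mulrC; apply: ler_pM => //.
- by rewrite divr_ge0 ?(ltW b10)// subr_ge0 exprn_ile1 ?ltW.
- by rewrite exprn_ge0 ?ltW.
- by rewrite -[X in _ <= X]mul1r ler_wpM2r ?invr_ge0 ?(ltW b10)// gerBl exprn_ge0 ?ltW.
Qed.

End dyadic.

Section weights.
Variables (R : realType) (n : nat) (r : R).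
Hypothesis r0 : 0 <= r.
Local Notation V := ('rV[R]_n * R)%type.
Let sed := @smooth_expr_differentiable R V.

(** The cut-off power serves two purposes: for [r + 2 <= l] the form exceeds 2 on [|x| <= t + r],
    where this is the genuine power, while beyond [|x| = t + l] the form is negative and the weight
    vanishes. *)
Definition cone_weight (a l : R) (z : V) : R := cut_powR a (cone l z).

Lemma SE_cone_weight a l : smooth_expr (cone_weight a l).
Proof. by apply: SE_comp; [exact: Cinf_cut_powR|exact: SE_cone]. Qed.

Lemma cone_factor l (x : 'rV[R]_n) t : cone l (x, t) = (t + l - enorm x) * (t + l + enorm x).
Proof. by rewrite /cone/= -enorm_sqr subr_sqr. Qed.

Lemma cone_gt2 l (x : 'rV[R]_n) t : r + 2 <= l -> 0 <= t -> enorm x <= t + r ->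
  2 < cone l (x, t).
Proof.
move=> rl t0 xt; rewrite cone_factor.
have x0 := enorm_ge0 x; have h1 : 2 <= t + l - enorm x by lra.
have h2 : 2 <= t + l + enorm x by lra.
by rewrite (lt_le_trans _ (ler_pM _ _ h1 h2))//; lra.
Qed.

Section estimates.
Variables (a l t : R) (x : 'rV[R]_n).
Hypotheses (rl : r + 2 <= l) (t0 : 0 <= t) (xt : enorm x <= t + r).

Lemma cone_weightE : cone_weight a l (x, t) = cone l (x, t) `^ a.
Proof. by rewrite /cone_weight cut_powRE// ltW// cone_gt2. Qed.

Lemma dt_cone_weightE :
  dt (cone_weight a l) (x, t) = a * cone l (x, t) `^ (a - 1) * (2 * (t + l)).
Proof.
rewrite /cone_weight dt_comp_cone; last exact: Cinf_cut_powR.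
by rewrite derive1_cut_powR// cone_gt2.
Qed.

Lemma box_cone_weight : a = 0 \/ a = - ((n%:R - 1) / 2) ->
  dt (dt (cone_weight a l)) (x, t) - laplacian (cone_weight a l) (x, t) = 0.
Proof.
move=> ha; have c2 := cone_gt2 rl t0 xt.
rewrite box_comp_cone; last exact: Cinf_cut_powR.
rewrite derive1_cut_powR// derive2_cut_powR//.
set c := cone l (x, t) in c2 *; have c0 : 0 < c by rewrite (lt_trans _ c2).
have -> : c `^ (a - 1) = c * c `^ (a - 2).
  by rewrite [LHS]powR_pred//; congr (_ * _ `^ _); ring.
by move: (c `^ (a - 2)) => P; case: ha => ->; field.
Qed.

End estimates.

Lemma cone_weight_wave a l : r + 2 <= l -> a = 0 \/ a = - ((n%:R - 1) / 2) ->
  wave_weight r l (cone_weight a l).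
Proof.
move=> rl ha; split.
- exact: SE_cone_weight.
- move=> x t t0; apply: contra_neqT; rewrite -ltNge => xt.
  rewrite /cone_weight cut_powR_eq0// cone_factor (le_trans _ ler01)//.
  rewrite nmulr_rle0; last by rewrite subr_lt0.
  by rewrite addr_ge0 ?enorm_ge0// addr_ge0// (le_trans _ rl)// addr_ge0.
- by move=> x t t0 xt; exact: box_cone_weight.
- by move=> x t t0 xt; rewrite cone_weightE// powR_ge0.
Qed.

Lemma dx_addE i (f g : V -> R) : smooth_expr f -> smooth_expr g ->
  dx i (fun z => f z + g z) = fun z => dx i f z + dx i g z.
Proof. by move=> ef eg; apply/funext => z; rewrite /dx derive_addE//; exact: sed. Qed.

Lemma dt_addE (f g : V -> R) : smooth_expr f -> smooth_expr g ->
  dt (fun z => f z + g z) = fun z => dt f z + dt g z.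
Proof. by move=> ef eg; apply/funext => z; rewrite /dt derive_addE//; exact: sed. Qed.

Lemma derive_scaleE (c : R) (f : V -> R) v : smooth_expr f ->
  'D_v (fun z => c * f z) = fun z => c * 'D_v f z.
Proof.
move=> ef; apply/funext => z; rewrite derive_mulE; last exact: sed.
  by rewrite derive_cst mul0r add0r.
exact: differentiable_cst.
Qed.

Lemma wave_weightD (L1 L2 : R) f g : wave_weight r L1 f -> wave_weight r L2 g ->
  wave_weight r (Num.max L1 L2) (fun z : V => f z + g z).
Proof.
move=> wf wg; have sf := wave_weight_smooth wf; have sg := wave_weight_smooth wg.
have sdx i (h : V -> R) : smooth_expr h -> smooth_expr (dx i h) by exact: smooth_expr_derive.
have sdt (h : V -> R) : smooth_expr h -> smooth_expr (dt h) by exact: smooth_expr_derive.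
split.
- exact: SE_add.
- move=> x t t0; apply: contra_neqT; rewrite -ltNge => xt.
  have [fx|fx] := eqVneq (f (x, t)) 0; last first.
    have := wave_weight_supp wf t0 fx; rewrite leNgt => /negP[].
    by apply: le_lt_trans xt; rewrite lerD2l le_max lexx.
  have [gx|gx] := eqVneq (g (x, t)) 0; first by rewrite fx gx addr0.
  have := wave_weight_supp wg t0 gx; rewrite leNgt => /negP[].
  by apply: le_lt_trans xt; rewrite lerD2l le_max lexx orbT.
- move=> x t t0 xt.
  rewrite dt_addE// dt_addE; [|exact: sdt..].
  have -> : laplacian (fun z => f z + g z) (x, t) = laplacian f (x, t) + laplacian g (x, t).
    rewrite /laplacian -big_split; apply: eq_bigr => i _.
    by rewrite dx_addE// dx_addE//; exact: sdx.
  have := wave_weight_eq wf t0 xt; have := wave_weight_eq wg t0 xt.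
  by move: (dt _ _) (dt _ _) (laplacian _ _) (laplacian _ _) => x1 x2 x3 x4; lra.
- by move=> x t t0 xt; rewrite addr_ge0// (wave_weight_ge0 wf, wave_weight_ge0 wg).
Qed.

Lemma wave_weightZ (c L : R) f : 0 <= c -> wave_weight r L f ->
  wave_weight r L (fun z : V => c * f z).
Proof.
move=> c0 wf; have sf := wave_weight_smooth wf.
have sdx i (h : V -> R) : smooth_expr h -> smooth_expr (dx i h) by exact: smooth_expr_derive.
have sdt (h : V -> R) : smooth_expr h -> smooth_expr (dt h) by exact: smooth_expr_derive.
split.
- by apply: SE_mul => //; exact: SE_cst.
- move=> x t t0; rewrite mulf_eq0 negb_or => /andP[_]; exact: (wave_weight_supp wf).
- have dts h : smooth_expr h -> dt (fun z : V => c * h z) = fun z => c * dt h z.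
    by move=> eh; exact: derive_scaleE.
  have dxs i h : smooth_expr h -> dx i (fun z : V => c * h z) = fun z => c * dx i h z.
    by move=> eh; exact: derive_scaleE.
  move=> x t t0 xt; rewrite dts// dts; last exact: sdt.
  have -> : laplacian (fun z => c * f z) (x, t) = c * laplacian f (x, t).
    rewrite /laplacian mulr_sumr; apply: eq_bigr => i _.
    by rewrite dxs// dxs//; exact: sdx.
  by rewrite -mulrBr [X in c * X](wave_weight_eq wf t0 xt) mulr0.
- by move=> x t t0 xt; rewrite mulr_ge0// (wave_weight_ge0 wf).
Qed.

(* superposition of time-translates of the Lorentz-invariant weight, homogeneous of degree
   [gam + 2 * alpha] up to the scale [2 ^+ J] *)
Definition sum_weight (alpha gam : R) (J : nat) (z : V) : R :=
  \sum_(0 <= j < J) 2 `^ (gam * j%:R) * cone_weight alpha (r + 2 + 2 ^+ j) z.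

Lemma sum_weight_wave gam J : exists L, wave_weight r L (sum_weight (- ((n%:R - 1) / 2)) gam J).
Proof.
elim: J => [|J [L IH]].
  exists (r + 2); rewrite (_ : sum_weight _ _ _ = fun z => 0 * cone_weight 0 (r + 2) z).
    by apply: wave_weightZ => //; apply: cone_weight_wave => //; left.
  by apply/funext => z; rewrite /sum_weight big_geq// mul0r.
exists (Num.max L (r + 2 + 2 ^+ J)).
rewrite (_ : sum_weight _ _ _ = fun z => sum_weight (- ((n%:R - 1) / 2)) gam J z +
    2 `^ (gam * J%:R) * cone_weight (- ((n%:R - 1) / 2)) (r + 2 + 2 ^+ J) z); last first.
  by apply/funext => z; rewrite /sum_weight big_nat_recr.
apply: wave_weightD => //; apply: wave_weightZ; first exact: powR_ge0.
by apply: cone_weight_wave; [rewrite lerDl exprn_ge0|right].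
Qed.

Lemma dt_sum_weight alpha gam J z : dt (sum_weight alpha gam J) z =
  \sum_(0 <= j < J) 2 `^ (gam * j%:R) * dt (cone_weight alpha (r + 2 + 2 ^+ j)) z.
Proof.
rewrite /sum_weight /dt derive_sumE.
  apply: eq_bigr => j _.
  exact: (congr1 (fun f => f z) (derive_scaleE _ _ (SE_cone_weight _ _))).
move=> j; apply: (sed (SE_mul (SE_cst _ _) (SE_cone_weight _ _))).
Qed.


Section region.
Variable nu : R.
Hypothesis nu0 : 0 < nu.

(** The form is the product of [t + l - |x|] and [t + l + |x|], the second factor being at least
    [t + l]. The factor [t + l] created by differentiation consumes one of its [nu + 1] negative
    powers, which leaves [t^(-nu)]. *)
Lemma dt_cone_weight_bound (s t : R) (x : 'rV[R]_n) : 0 <= s -> 0 < t -> enorm x <= t + r ->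
  `|dt (cone_weight (- nu) (r + 2 + s)) (x, t)| <=
    2 * nu * t `^ (- nu) * (t + (r + 2) - enorm x + s) `^ (- (nu + 1)).
Proof.
move=> s0 t0 xt; have x0 := enorm_ge0 x.
have rl : r + 2 <= r + 2 + s by rewrite lerDl.
rewrite dt_cone_weightE ?(ltW t0)//; set l := r + 2 + s.
have l0 : 0 < l by rewrite /l; have := r0; lra.
have tl0 : 0 < t + l by rewrite addr_gt0.
rewrite -opprD; set c := cone l (x, t).
have -> : `|- nu * c `^ (- (nu + 1)) * (2 * (t + l))| = 2 * nu * ((t + l) * c `^ (- (nu + 1))).
  rewrite !normrM normrN (gtr0_norm nu0) (ger0_norm (powR_ge0 _ _)) (ger0_norm (ltW tl0)).
  by rewrite ger0_norm//; ring.
rewrite -[X in _ <= X]mulrA; apply: ler_wpM2l; first by rewrite mulr_ge0// ltW.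
set xi := t + (r + 2) - enorm x + s.
have xi0 : 0 < xi by rewrite /xi; lra.
have nu1 : 0 <= nu + 1 by rewrite addr_ge0// ltW.
have cge : xi * (t + l) <= c.
  rewrite /c cone_factor (_ : t + l - enorm x = xi); last by rewrite /xi /l; ring.
  by rewrite ler_wpM2l ?(ltW xi0)// lerDl.
apply: (@le_trans _ _ ((t + l) * (xi * (t + l)) `^ (- (nu + 1)))).
  by rewrite ler_wpM2l ?(ltW tl0)// powR_anti// mulr_gt0.
rewrite powRM ?(ltW xi0) ?(ltW tl0)// mulrCA mulrC ler_wpM2r ?powR_ge0//.
have -> : (t + l) * (t + l) `^ (- (nu + 1)) = (t + l) `^ (- nu).
  by rewrite [RHS]powR_pred// opprD.
by rewrite powR_anti// ?(ltW nu0)// lerDl ltW.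
Qed.

(** The form is at most [(t + l)^2]. Hence a bound on the time derivative transfers to the weight
    itself, at the price of one factor of the size of the time scale. *)
Lemma cone_weight_le_dt (s t : R) (x : 'rV[R]_n) : 0 <= s -> 0 <= t -> enorm x <= t + r ->
  `|cone_weight (- nu) (r + 2 + s) (x, t)| <=
    (t + (r + 2 + s)) / (2 * nu) * `|dt (cone_weight (- nu) (r + 2 + s)) (x, t)|.
Proof.
move=> s0 t0 xt; have x0 := enorm_ge0 x.
have rl : r + 2 <= r + 2 + s by rewrite lerDl.
have c2 := cone_gt2 rl t0 xt.
rewrite dt_cone_weightE// cone_weightE//; set l := r + 2 + s in c2 *.
have l0 : 0 < l by rewrite /l; have := r0; lra.
have tl0 : 0 < t + l by rewrite ltr_wpDl.
rewrite -opprD; set c := cone l (x, t) in c2 *; have c0 : 0 < c by rewrite (lt_trans _ c2).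
have -> : `|- nu * c `^ (- (nu + 1)) * (2 * (t + l))| = 2 * nu * ((t + l) * c `^ (- (nu + 1))).
  rewrite !normrM normrN (gtr0_norm nu0) (ger0_norm (powR_ge0 _ _)) (ger0_norm (ltW tl0)).
  by rewrite ger0_norm//; ring.
rewrite mulrA divfK; last by rewrite mulf_neq0// gt_eqF.
rewrite ger0_norm ?powR_ge0// mulrA.
have -> : c `^ (- nu) = c * c `^ (- (nu + 1)).
  by rewrite [LHS]powR_pred// opprD.
rewrite ler_wpM2r ?powR_ge0// /c /cone/= -expr2 gerBl sqnorm_ge0//.
Qed.

Lemma sum_weight_dt_bound gam : 0 < gam < nu + 1 -> exists2 C : R, 0 < C &
  forall (J : nat) (t : R) (x : 'rV[R]_n), 0 < t -> enorm x <= t + r ->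
  \sum_(0 <= j < J) 2 `^ (gam * j%:R) * `|dt (cone_weight (- nu) (r + 2 + 2 ^+ j)) (x, t)| <=
  C * t `^ (- nu) * (t + (r + 2) - enorm x) `^ (gam - (nu + 1)).
Proof.
move=> hg; have [C C0 HC] := dyadic_sum hg.
have nu2 : 0 < 2 * nu by rewrite mulr_gt0.
exists (2 * nu * C); first by rewrite mulr_gt0.
move=> J t x t0 xt; set xi := t + (r + 2) - enorm x.
have xi1 : 1 <= xi by rewrite /xi; lra.
apply: (@le_trans _ _ (2 * nu * t `^ (- nu) *
    \sum_(0 <= j < J) 2 `^ (gam * j%:R) * (xi + 2 ^+ j) `^ (- (nu + 1)))).
  rewrite mulr_sumr; apply: ler_sum => j _; rewrite mulrCA ler_wpM2l ?powR_ge0//.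
  by apply: dt_cone_weight_bound => //; exact: exprn_ge0.
rewrite [X in _ <= X](_ : _ = 2 * nu * t `^ (- nu) * (C * xi `^ (gam - (nu + 1)))); last by ring.
by apply: ler_wpM2l; [rewrite mulr_ge0 ?powR_ge0// ltW|exact: HC].
Qed.

(** Only the term with [2^j] comparable to [1 + t] is kept: there the form is at most
    [((1 + t) * (r + 4)) ^+ 2], up to the boundary of the cone. The other terms are nonnegative. *)
Lemma sum_weight_lower gam : 0 < gam -> exists2 c : R, 0 < c &
  forall (J : nat) (t : R) (x : 'rV[R]_n), 0 <= t -> enorm x <= t + r -> 1 + t < 2 ^+ J ->
  c * (1 + t) `^ (gam - 2 * nu) <= sum_weight (- nu) gam J (x, t).
Proof.
move=> g0; have r4 : 0 < r + 4 by rewrite ltr_wpDl.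
exists (2 `^ (- gam) * (r + 4) `^ (- (2 * nu))); first by rewrite mulr_gt0 ?powR_gt0.
move=> J t x t0 xt tJ; have t1 : 1 <= 1 + t by rewrite lerDl.
have t10 : 0 < 1 + t by rewrite (lt_le_trans _ t1).
have [j /andP[j1 j2]] := dyadic_bracket t1.
have jJ : (j < J)%N.
  rewrite ltnNge; apply/negP => Jj; have : 2 ^+ J <= 2 ^+ j :> R by rewrite ler_eXn2l// ltr1n.
  by move=> /(lt_le_trans tJ)/(le_lt_trans j1); rewrite ltxx.
have cw0 i : 0 <= cone_weight (- nu) (r + 2 + 2 ^+ i) (x, t).
  by rewrite cone_weightE ?powR_ge0// lerDl exprn_ge0.
rewrite /sum_weight (bigD1_seq j) ?mem_index_iota ?iota_uniq//=.
apply: (@le_trans _ _ (2 `^ (gam * j%:R) * cone_weight (- nu) (r + 2 + 2 ^+ j) (x, t))); last first.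
  by rewrite lerDl sumr_ge0// => i _; rewrite mulr_ge0 ?powR_ge0.
have jp : 0 <= 2 ^+ j :> R by rewrite exprn_ge0.
have l2 : r + 2 <= r + 2 + 2 ^+ j by rewrite lerDl.
rewrite cone_weightE//.
have tl : t + (r + 2 + 2 ^+ j) <= (1 + t) * (r + 4) by have := mulr_ge0 t0 r0; nra.
have tl0 : 0 <= t + (r + 2 + 2 ^+ j) by rewrite !addr_ge0.
have c2 := cone_gt2 l2 t0 xt; set c := cone _ _ in c2 *.
have c0 : 0 < c by rewrite (lt_trans _ c2).
have cle : c <= ((1 + t) * (r + 4)) ^+ 2.
  apply: (@le_trans _ _ ((t + (r + 2 + 2 ^+ j)) ^+ 2)).
    by rewrite /c /cone/= gerBl sqnorm_ge0.
  by rewrite lerXn2r// nnegrE mulr_ge0// ltW.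
have h1 : ((1 + t) * (r + 4)) `^ (- (2 * nu)) <= c `^ (- nu).
  apply: le_trans (powR_anti (ltW nu0) c0 cle).
  by rewrite -powR_mulrn ?mulr_ge0 ?(ltW t10) ?(ltW r4)// -powRrM mulrN.
have h2 : ((1 + t) / 2) `^ gam <= 2 `^ (gam * j%:R).
  rewrite powR_natmul -powR_exprn//; apply: powR_le; rewrite ?(ltW g0) ?divr_ge0 ?(ltW t10)//.
  by rewrite ler_pdivrMr// mulrC -exprS ltW.
apply: (@le_trans _ _ (((1 + t) / 2) `^ gam * ((1 + t) * (r + 4)) `^ (- (2 * nu)))); last first.
  by apply: ler_pM => //; exact: powR_ge0.
rewrite !powRM ?invr_ge0 ?(ltW t10) ?(ltW r4)// powRVl//.
have -> : (1 + t) `^ (gam - 2 * nu) = (1 + t) `^ gam * (1 + t) `^ (- (2 * nu)).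
  by rewrite -powRD_gt0.
by apply: eq_leW; ring.
Qed.

End region.

End weights.

(** * Estimates on a dyadic annulus in time *)

Section annulus.
Variables (R : realType) (n : nat).
Local Notation mu := (lebesgue_rV R n).

Lemma expR_sub1_bounds (d : R) : 0 < d <= 1 -> d <= expR d - 1 <= expR 1 - 1.
Proof.
move=> /andP[d0 d1]; rewrite lerBrDl expR_ge1Dx/= lerD2r ler_expR//.
Qed.

Lemma integral_cone_trunc_le (p' r H G t : R) (eta hh : R -> R) (m : nat) : (0 < n)%N ->
  0 <= r -> 0 < p' -> 0 <= t -> 0 <= G -> t + (r + 2) < m%:R ->
  (forall s, 0 <= eta s) -> measurable_fun setT eta ->
  (forall s, 0 <= s -> 0 <= hh s) -> (forall s u, 1 <= s -> s <= u -> hh u <= hh s) ->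
  (forall s, 1 <= s -> eta s `^ p' <= hh s) ->
  \sum_(1 <= i < m) hh i%:R <= H ->
  let g x := trunc r (fun t (x : 'rV[R]_n) => G * eta (t + (r + 2) - enorm x)) t x in
  mu.-integrable setT (EFin \o (fun x => g x `^ p')) /\
  \int[mu]_x (g x `^ p') <= G `^ p' * (unit_ball_volume R n * n%:R * (t + (r + 2)) ^+ n.-1 * H).
Proof.
move=> n0 r0 p'0 t0 G0 tm eta0 meta hh0 hhd etah sH g.
have b0 : 0 <= t + (r + 2) by rewrite !addr_ge0.
have g0 x : 0 <= g x by rewrite /g /trunc; case: ifP => // _; rewrite mulr_ge0.
have mg : measurable_fun setT g.
  apply: measurable_trunc; apply: measurable_funM; first exact: measurable_cst.
  apply: (measurableT_comp meta); apply: measurable_funB; first exact: measurable_cst.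
  exact: measurable_enorm.
have mgp : measurable_fun setT (fun x => g x `^ p').
  rewrite (_ : (fun x => _) = fun x => `|g x| `^ p'); first exact: measurable_abs_powR.
  by apply/funext => x; rewrite ger0_norm.
have := @integral_dist_cone_le R n n0 (fun s => G `^ p' * hh s) (t + (r + 2)) m
  (fun x => g x `^ p') b0 tm.
move=> /(_ _ _ mgp) key.
have {}key : (\int[mu]_x (g x `^ p')%:E <=
    (G `^ p' * (unit_ball_volume R n * n%:R * (t + (r + 2)) ^+ n.-1 * H))%:E)%E.
  apply: le_trans (key _ _ _ _) _.
  - by move=> s s0; rewrite mulr_ge0 ?powR_ge0 ?hh0.
  - by move=> s u s1 su; rewrite ler_wpM2l ?powR_ge0 ?hhd.
  - move=> x; rewrite /g /trunc; case: ifP => [xt|_]; last by rewrite powR0// gt_eqF.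
    by move=> h; exfalso; lra.
  - move=> x x1; rewrite powR_ge0/= /g /trunc; case: ifP => [xt|_].
      by rewrite powRM// ler_wpM2l ?powR_ge0 ?etah.
    rewrite powR0; last by rewrite gt_eqF.
    by rewrite mulr_ge0 ?powR_ge0 ?hh0// (le_trans _ x1).
  rewrite lee_fin -mulr_sumr mulrCA ler_wpM2l ?powR_ge0// ler_wpM2l//.
  by rewrite !mulr_ge0 ?unit_ball_volume_ge0 ?exprn_ge0.
have igp : mu.-integrable setT (EFin \o (fun x => g x `^ p')).
  apply/integrableP; split; first exact/measurable_EFinP.
  under eq_integral do rewrite /= ger0_norm ?powR_ge0//.
  by apply: le_lt_trans key _; rewrite ltry.
split=> //; rewrite /Rintegral -lee_fin fineK//.
exact: integrable_fin_num igp.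
Qed.

(** A common form for the three weights to come. They differ in the profile [eta] in the distance to
    the cone, in the nonincreasing majorant [hh] of its [p/(p-1)]-th power, and in the bound [H] on
    the sum of [hh]: of order [X], of order [1 + ln X], or constant. *)
Lemma annulus_inequality (p r : R) : (0 < n)%N -> 0 <= r -> 1 < p -> exists2 K : R, 0 < K &
  forall (nu : R) (T : \bar R) (w wt h : R -> 'rV[R]_n -> R) L psi (X d A H : R) (eta hh : R -> R),
  1 <= X -> 0 < d <= 1 -> ((expR d * X)%:E < T)%E -> 0 < A -> 0 < H ->
  wave_curve T r w wt h -> wave_weight r L psi ->
  L1_curve T r (fun t x => `|w t x| `^ p) ->
  (forall (t : R) (x : 'rV[R]_n), X <= t <= expR d * X -> enorm x <= t + r ->
    `|psi (x, t)| <= A * X `^ (1 - nu) * eta (t + (r + 2) - enorm x) /\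
    `|dt psi (x, t)| <= A * X `^ (- nu) * eta (t + (r + 2) - enorm x)) ->
  (forall s, 0 <= eta s) -> measurable_fun setT eta ->
  (forall s, 0 <= s -> 0 <= hh s) -> (forall s u, 1 <= s -> s <= u -> hh u <= hh s) ->
  (forall s, 1 <= s -> eta s `^ (p / (p - 1)) <= hh s) ->
  (forall m : nat, m%:R <= (expR 1 + r + 3) * X -> \sum_(1 <= i < m) hh i%:R <= H) ->
  0 <= slice_pairing wt psi 0 - slice_pairing w (dt psi) 0 ->
  (\int[lebesgue_measure]_(t in `[0, X]) slice_pairing h psi t +
     (slice_pairing wt psi 0 - slice_pairing w (dt psi) 0)) `^ p <=
  K * A `^ p * d `^ (- (2 * p)) * X `^ (- ((1 + nu) * p) + n%:R * (p - 1)) * H `^ (p - 1) *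
  \int[lebesgue_measure]_(t in `[X, expR d * X]) mass (fun t x => `|w t x| `^ p) t.
Proof.
move=> n0 r0 p1; have [Cs Cs0 HCs] := @step_derive_bounded R.
have p0 : 0 < p by rewrite (lt_trans _ p1).
have p10 : 0 < p - 1 by rewrite subr_gt0.
have E1 : 1 <= expR 1 :> R by have := expR_ge1Dx (1 : R); lra.
have E0 : 0 < expR 1 :> R by exact: expR_gt0.
set om := unit_ball_volume R n; have om0 : 0 <= om := unit_ball_volume_ge0 R n.
set W := (om + 1) * n%:R * (expR 1 + r + 3) ^+ n.-1.
have K10 : 0 < expR 1 + r + 3 by have := r0; lra.
have W0 : 0 < W by rewrite /W !mulr_gt0 ?exprn_gt0 ?ltr0n// ltr_wpDl.
exists (2 `^ p * (3 * Cs) `^ p * (W * expR 1) `^ (p - 1)).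
  by rewrite !mulr_gt0 ?powR_gt0// mulr_gt0.
move=> nu T w wt h L psi X d A H eta hh X1 d01 XT A0 H0 Hw Hpsi cwp Hb eta0 meta hh0 hhd etah sH
  G00.
have /andP[d0 d1] := d01.
have X0 : 0 < X by rewrite (lt_le_trans _ X1).
have /andP[dl du] := expR_sub1_bounds d01.
set Y := expR d * X in XT Hb *.
have Dl : d * X <= Y - X by rewrite /Y -[X in _ - X]mul1r -mulrBl ler_wpM2r ?(ltW X0).
have Du : Y - X <= expR 1 * X.
  by rewrite /Y -[X in _ - X]mul1r -mulrBl ler_wpM2r ?(ltW X0)//; lra.
have dX0 : 0 < d * X by rewrite mulr_gt0.
have XY : X < Y by rewrite -subr_gt0 (lt_le_trans _ Dl).
have YE : Y <= expR 1 * X by rewrite /Y ler_wpM2r ?(ltW X0)// ler_expR.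
(* The cutoff has derivatives of size [Cs / (d * X)] and [Cs / (d * X)^2]. As [d <= 1], the
   coefficients 1 and 2 of the two terms add up to 3 in front of [d^-2]. *)
set G := 3 * Cs * A * d `^ (- 2) * X `^ (- (1 + nu)).
have G0 : 0 < G by rewrite /G !mulr_gt0 ?powR_gt0.
set B := G `^ (p / (p - 1)) * (W * X ^+ n.-1 * H).
have B0 : 0 < B.
  by rewrite /B; apply: mulr_gt0; [exact: powR_gt0|exact: mulr_gt0 (mulr_gt0 W0 (exprn_gt0 _
    X0)) H0].
have tb t : X <= t <= Y -> [/\ 0 <= t, t + (r + 2) < (Num.truncn (t + (r + 2))).+1%:R,
    (Num.truncn (t + (r + 2))).+1%:R <= (expR 1 + r + 3) * X &
    t + (r + 2) <= (expR 1 + r + 3) * X].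
  move=> /andP[t1 t2]; have t0 : 0 <= t by rewrite (le_trans (ltW X0)).
  have b0 : 0 <= t + (r + 2) by rewrite !addr_ge0.
  have /andP[h1 h2] := truncn_itv b0.
  have h3 : t + (r + 2) + 1 <= (expR 1 + r + 3) * X.
    have : r <= r * X by rewrite ler_peMr.
    by rewrite !mulrDl; lra.
  split=> //; last lra.
  by rewrite -natr1; lra.
have p'0 : 0 < p / (p - 1) by rewrite divr_gt0.
pose g t x := trunc r (fun t (x : 'rV[R]_n) => G * eta (t + (r + 2) - enorm x)) t x.
have ig t : X <= t <= Y -> mu.-integrable setT (EFin \o (fun x => g t x `^ (p / (p - 1)))) /\
    \int[mu]_x (g t x `^ (p / (p - 1))) <= B.
  move=> tXY; have [t0 t1 t2 t3] := tb _ tXY.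
  have [i1 i2] := integral_cone_trunc_le n0 r0 p'0 t0 (ltW G0) t1 eta0 meta hh0 hhd etah (sH _ t2).
  split; first exact: i1.
  apply: le_trans i2 _; rewrite /B ler_wpM2l ?powR_ge0//.
  rewrite ler_wpM2r ?(ltW H0)// /W -[X in _ <= X]mulrA -exprMn.
  have b0 : 0 <= t + (r + 2) by rewrite !addr_ge0.
  apply: ler_pM; rewrite ?mulr_ge0 ?exprn_ge0//.
    by rewrite ler_wpM2r// lerDl.
  by rewrite lerXn2r// nnegrE// mulr_ge0 ?(ltW X0) ?(ltW K10).
have := @key_inequality R n T r r0 w wt h L psi Hw Hpsi p Cs X Y B g p1 X0 XY XT B0 HCs cwp.
move=> /(_ _ _ (fun t ht => (ig t ht).1) (fun t ht => (ig t ht).2) G00) key.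
apply: le_trans (key _ _) _.
- move=> t x tXY xt; rewrite /g /trunc xt.
  have [b1 b2] := Hb t x tXY xt; move: (eta _) (eta0 (t + (r + 2) - enorm x)) b1 b2 => e e0 b1 b2.
  have D0 : 0 < Y - X by rewrite subr_gt0.
  set D := Y - X in D0 Dl *; set Q := X `^ (- (1 + nu)).
  have XQ (a : R) : X `^ (a - (1 + nu)) = X `^ a * Q.
    by rewrite /Q -powRD_gt0.
  have q0 : 0 <= A * e * Q by rewrite !mulr_ge0 ?powR_ge0 ?(ltW A0).
  have c1 : `|psi (x, t)| <= X ^+ 2 * (A * e * Q).
    apply: le_trans b1 _; rewrite (_ : 1 - nu = 2 - (1 + nu)); last by ring.
    by rewrite XQ powR_mulrn ?(ltW X0)//; apply: eq_leW; ring.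
  have c2 : `|dt psi (x, t)| <= X * (A * e * Q).
    apply: le_trans b2 _; rewrite (_ : - nu = 1 - (1 + nu)); last by ring.
    by rewrite XQ powRr1 ?(ltW X0)//; apply: eq_leW; ring.
  have yz : X / D <= d^-1 by rewrite ler_pdivrMr// mulrC ler_pdivlMr// mulrC.
  have y0 : 0 <= X / D by rewrite divr_ge0 ?ltW.
  have z1 : 1 <= d^-1 by rewrite invf_ge1.
  have -> : G * e = 3 * Cs * (d^-1) ^+ 2 * (A * e * Q).
    by rewrite /G -/Q (powRN d) powR_mulrn ?(ltW d0)// exprVn; ring.
  move: (A * e * Q) (`|psi _|) (`|dt psi _|) q0 c1 c2 => V a1 a2 V0 c1 c2.
  apply: (@le_trans _ _ (Cs * (X / D) ^+ 2 * V + 2 * Cs * (X / D) * V)).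
    apply: lerD.
      apply: (@le_trans _ _ (Cs / D ^+ 2 * (X ^+ 2 * V))).
        by rewrite ler_wpM2l// divr_ge0 ?exprn_ge0 ?(ltW Cs0) ?(ltW D0).
      by apply: eq_leW; field; rewrite gt_eqF.
    apply: (@le_trans _ _ (2 * (Cs / D) * (X * V))).
      by rewrite ler_wpM2l// mulr_ge0// divr_ge0 ?(ltW Cs0) ?(ltW D0).
    by apply: eq_leW; field; rewrite gt_eqF.
  move: (X / D) (d^-1) y0 yz z1 => y z y0 yz z1.
  have z0 : 0 <= z by rewrite (le_trans ler01).
  have yy : y ^+ 2 <= z ^+ 2 by rewrite lerXn2r.
  have zz : y <= z ^+ 2 by rewrite (le_trans yz)// expr2 ler_peMl.
  have CV : 0 <= Cs * V by rewrite mulr_ge0 ?(ltW Cs0).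
  have := ler_wpM2l CV yy; have := ler_wpM2l CV zz.
  by move: (y ^+ 2) (z ^+ 2) => y2 z2; lra.
- move=> t x; rewrite /g /trunc; case: ifP => // _.
  by rewrite mulr_ge0 ?(ltW G0).
clearbody W; set I := Rintegral _ _ _.
have I0 : 0 <= I.
  by apply: Rintegral_ge0 => t _; apply: Rintegral_ge0 => x _; exact: powR_ge0.
have pD a b c : 0 < a -> a `^ b * a `^ c = a `^ (b + c) :> R.
  by move=> a0; rewrite powRD_gt0.
have h1 : (B * (Y - X)) `^ (p - 1) <= (G `^ (p / (p - 1)) * (W * expR 1 * X ^+ n * H)) `^ (p - 1).
  apply: powR_le; rewrite ?(ltW p10)//; first by rewrite mulr_ge0 ?(ltW B0)// subr_ge0 ltW.
  apply: (@le_trans _ _ (B * (expR 1 * X))); first by rewrite ler_wpM2l// ltW.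
  rewrite /B -[in X in _ <= X](prednK n0) exprS.
  by apply: eq_leW; ring.
have h2 : (G `^ (p / (p - 1)) * (W * expR 1 * X ^+ n * H)) `^ (p - 1) =
    (3 * Cs) `^ p * A `^ p * d `^ (- (2 * p)) * X `^ (- ((1 + nu) * p) + n%:R * (p - 1)) *
    (W * expR 1) `^ (p - 1) * H `^ (p - 1).
  rewrite powRM ?powR_ge0 ?mulr_ge0 ?exprn_ge0 ?(ltW H0) ?(ltW W0) ?(ltW E0) ?(ltW X0)//.
  rewrite -powRrM divfK ?gt_eqF// /G.
  rewrite !powRM ?powR_ge0 ?mulr_ge0 ?exprn_ge0 ?powR_ge0 ?(ltW H0) ?(ltW W0) ?(ltW E0) ?(ltW
    X0) ?(ltW Cs0) ?(ltW A0)//.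
  rewrite -(powR_mulrn n (ltW X0)) -!powRrM -(pD X _ _ X0) !mulNr.
  by ring.
rewrite mulrAC; apply: ler_wpM2r => //.
apply: (@le_trans _ _ _ _ _ (ler_wpM2l (powR_ge0 _ _) h1)); rewrite h2.
by apply: eq_leW; ring.
Qed.

End annulus.

Section lower_bounds.
Variables (R : realType) (n : nat) (T : \bar R) (r : R).
Hypothesis r0 : 0 <= r.
Local Notation mu := (lebesgue_rV R n).
Local Notation V := ('rV[R]_n * R)%type.

Lemma slice_pairing_lower (h : R -> 'rV[R]_n -> R) (psi : V -> R) c t :
  L1_curve T r h -> (forall t x, time_interval T t -> 0 <= h t x) -> smooth_expr psi ->
  time_interval T t -> (forall x, enorm x <= t + r -> c <= psi (x, t)) ->
  c * mass h t <= slice_pairing h psi t.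
Proof.
move=> ch h0 spsi It hc.
have ih := L1_curve_int ch It.
rewrite /mass -RintegralZl//.
apply: le_Rintegral => //.
- exact: integrableZ_fun.
- exact: (curve_pairing_integrable ch spsi).
- move=> x _; have [xt|xt] := leP (enorm x) (t + r).
    by rewrite mulrC ler_wpM2l ?h0 ?hc.
  by rewrite (L1_curve_supp ch It xt) mulr0 mul0r.
Qed.

Lemma time_integral_le (f g : R -> R) X : (X%:E < T)%E ->
  continuous_on_time T f -> continuous_on_time T g ->
  (forall t, 0 <= t <= X -> f t <= g t) ->
  \int[lebesgue_measure]_(t in `[0, X]) f t <= \int[lebesgue_measure]_(t in `[0, X]) g t.
Proof.
move=> XT cf cg fg; apply: le_Rintegral => //.
- by apply: continuous_integrable; exact: continuous_on_time_within cf.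
- by apply: continuous_integrable; exact: continuous_on_time_within cg.
Qed.

Lemma continuous_on_timeM (f g : R -> R) : continuous_on_time T f -> continuous_on_time T g ->
  continuous_on_time T (fun t => f t * g t).
Proof. by move=> cf cg t It; apply: cvgM; [exact: cf|exact: cg]. Qed.

Lemma continuous_on_timeT (f : R -> R) : (forall t, 0 <= t -> {for t, continuous f}) ->
  continuous_on_time T f.
Proof. by move=> cf t [t0 _]; apply: cvg_within_filter; exact: cf. Qed.

Lemma time_power_continuous (b : R) : continuous_on_time T (fun t => (1 + t) `^ (- b)).
Proof.
apply: continuous_on_timeT => t t0.
have t1 : 0 < 1 + t by rewrite ltr_wpDr.
apply: (@continuous_comp _ _ _ (fun t : R => 1 + t) (fun x => x `^ (- b))).
  by apply: cvgD; [exact: cvg_cst|exact: cvg_id].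
apply: differentiable_continuous; apply/derivable1_diffP.
by apply: derivable_powR; rewrite in_itv/= t1.
Qed.

Lemma slice_pairing_ge0 (f : R -> 'rV[R]_n -> R) (psi : V -> R) t :
  L1_curve T r f -> smooth_expr psi -> time_interval T t ->
  {ae mu, forall x, enorm x <= t + r -> 0 <= f t x * psi (x, t)} ->
  0 <= slice_pairing f psi t.
Proof.
move=> cf spsi It f0; have ip := curve_pairing_integrable cf spsi t It.
have mp := integrable_measurable ip.
rewrite /slice_pairing (_ : Rintegral _ _ _ = \int[mu]_x `|f t x * psi (x, t)|).
  by apply: Rintegral_ge0 => x _.
apply: ae_eq_Rintegral => //; first exact: measurableT_comp.
apply: filterS f0 => x; have [xt|xt] := leP (enorm x) (t + r).
  by move=> /(_ isT) h; rewrite ger0_norm.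
by rewrite (L1_curve_supp cf It xt) mul0r normr0.
Qed.

End lower_bounds.

(** * Inequalities between the masses of the two nonlinearities *)

Section mass_inequalities.
Variables (R : realType) (n : nat) (r p : R).
Hypotheses (n1 : (1 < n)%N) (r0 : 0 <= r) (p1 : 1 < p).
Local Notation mu := (lebesgue_rV R n).
Local Notation V := ('rV[R]_n * R)%type.

Let nu : R := (n%:R - 1) / 2.

Let nu0 : 0 < nu. Proof. by rewrite /nu divr_gt0// subr_gt0 ltr1n. Qed.
Let nu2 : 0 < 2 * nu. Proof. exact: mulr_gt0. Qed.
Let p0 : 0 < p. Proof. by rewrite (lt_trans _ p1). Qed.
Let p10 : 0 < p - 1. Proof. by rewrite subr_gt0. Qed.
Let n0 : (0 < n)%N. Proof. exact: ltnW. Qed.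

(** For [1 <= X <= t <= expR 1 * X] the number [K1 * X] dominates [t + r + 3], hence the number of
    unit shells that meet the cone; the 3 is the shift [r + 2] plus the rounding to an integer. *)
Let K1 : R := expR 1 + r + 3.
Let K11 : 1 <= K1.
Proof. by have := expR_ge1Dx (1 : R); rewrite /K1; have := r0; lra. Qed.

Let before_scaled (T : \bar R) (X d : R) : 0 <= X -> 0 <= d -> ((expR d * X)%:E < T)%E ->
  (X%:E < T)%E.
Proof.
move=> X0 d0; apply: le_lt_trans; rewrite lee_fin ler_peMl//.
by rewrite (le_trans _ (expR_ge1Dx d))// lerDl.
Qed.

Let powR_chain (a a' b c : R) : 0 <= a -> a <= a' -> b <= c -> a' `^ p <= b -> a `^ p <= c.
Proof.
move=> a0 aa' bc a'b; apply: le_trans bc; apply: le_trans a'b.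
by apply: powR_le => //; exact: ltW.
Qed.

Let mass_int_ge0 (h : R -> 'rV[R]_n -> R) (D : set R) : measurable (D : set (measurableTypeR R)) ->
  (forall t x, D t -> 0 <= h t x) -> 0 <= \int[lebesgue_measure]_(t in D) mass h t.
Proof.
by move=> mD h0; apply: Rintegral_ge0 => // t Dt; apply: Rintegral_ge0 => // x _; exact: h0.
Qed.

Record nonneg_wave T (w wt h : R -> 'rV[R]_n -> R) : Prop := NonnegWave {
  nonneg_wave_curve : wave_curve T r w wt h;
  nonneg_wave_powR : L1_curve T r (fun t x => `|w t x| `^ p);
  nonneg_wave_data : {ae mu, forall x, 0 <= w 0 x /\ 0 <= wt 0 x} }.

(** Since the weight decreases in time, the initial displacement contributes with the favourable
    sign, and the velocity alone gives the lower bound. *)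
Lemma initial_pairing_ge T w wt h (psi : V -> R) : (0 < T)%E -> nonneg_wave T w wt h ->
  smooth_expr psi -> (forall x, enorm x <= r -> 0 <= psi (x, 0) /\ dt psi (x, 0) <= 0) ->
  0 <= slice_pairing wt psi 0 <= slice_pairing wt psi 0 - slice_pairing w (dt psi) 0.
Proof.
move=> T0 [Hw _ Hd] spsi hpsi.
have I0 : time_interval T 0 by split.
apply/andP; split.
  apply: (slice_pairing_ge0 (wave_curve_wt Hw) spsi I0).
  by apply: filterS Hd => x [_ wt0]; rewrite add0r => /hpsi[? _]; rewrite mulr_ge0.
rewrite lerDl oppr_ge0 -oppr_ge0.
have sdt : smooth_expr (dt psi) by exact: smooth_expr_derive.
have sN : smooth_expr (fun z => -1 * dt psi z) by apply: SE_mul => //; exact: SE_cst.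
rewrite (_ : - _ = slice_pairing w (fun z => -1 * dt psi z) 0).
  apply: (slice_pairing_ge0 (wave_curve_w Hw) sN I0).
  apply: filterS Hd => x [w0 _]; rewrite add0r => /hpsi[_ ?].
  by rewrite mulr_ge0// mulN1r oppr_ge0.
rewrite -[LHS]mulN1r /slice_pairing -RintegralZl//; last first.
  exact: (curve_pairing_integrable (wave_curve_w Hw)).
by apply: eq_Rintegral => x _; rewrite mulrCA.
Qed.

Lemma dt_cone_weight_le0 (a l t : R) (x : 'rV[R]_n) : a <= 0 -> r + 2 <= l -> 0 <= t ->
  enorm x <= t + r -> dt (cone_weight a l) (x, t) <= 0.
Proof.
move=> a0 rl t0 xt; rewrite (dt_cone_weightE _ rl t0 xt) -mulrA mulr_le0_ge0//.
by rewrite mulr_ge0 ?powR_ge0// mulr_ge0// addr_ge0// (le_trans _ rl)// addr_ge0.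
Qed.

Lemma free_mass_inequality : exists2 C : R, 0 < C &
  forall T w wt h (X d : R), (0 < T)%E -> nonneg_wave T w wt h ->
  1 <= X -> 0 < d <= 1 -> ((expR d * X)%:E < T)%E ->
  (\int[lebesgue_measure]_(t in `[0, X]) mass h t) `^ p <=
  C * d `^ (- (2 * p)) * X `^ ((n%:R + 1) * (p - 1) - 2 * p) *
  \int[lebesgue_measure]_(t in `[X, expR d * X]) mass (fun t x => `|w t x| `^ p) t.
Proof.
have [K K0 HK] := annulus_inequality n0 r0 p1.
have K10 : 0 < K1 by rewrite (lt_le_trans _ K11).
exists (K * K1 `^ (p - 1)); first by rewrite mulr_gt0 ?powR_gt0.
move=> T w wt h X d T0 Hw X1 d01 XT; have /andP[d0 d1] := d01.
have X0 : 0 < X by rewrite (lt_le_trans _ X1).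
have Hc := nonneg_wave_curve Hw; have ch := wave_curve_h Hc.
have Hpsi : wave_weight r (r + 2) (@cone_weight R n 0 (r + 2)).
  by apply: cone_weight_wave => //; left.
have psiE (t : R) (x : 'rV[R]_n) : 0 <= t -> enorm x <= t + r ->
    cone_weight 0 (r + 2) (x, t) = 1 /\ dt (cone_weight 0 (r + 2)) (x, t) = 0.
  by move=> t0 xt; rewrite (cone_weightE _ _ t0 xt)// (dt_cone_weightE _ _ t0 xt)// !mul0r powRr0.
have hpsi0 (x : 'rV[R]_n) : enorm x <= r ->
    0 <= cone_weight 0 (r + 2) (x, 0) /\ dt (cone_weight 0 (r + 2)) (x, 0) <= 0.
  by move=> xr; have [|-> ->] := psiE 0 x (lexx _); rewrite ?add0r.
have /andP[G1 G2] := initial_pairing_ge T0 Hw (wave_weight_smooth Hpsi) hpsi0.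
have G0 := le_trans G1 G2.
have XT' := before_scaled (ltW X0) (ltW d0) XT.
have meta : measurable_fun setT (fun _ : R => 1 : R) by exact: measurable_cst.
have := HK 1 T w wt h _ _ X d 1 (K1 * X) (fun=> 1) (fun=> 1) X1 d01 XT ltr01
  (mulr_gt0 K10 X0) Hc Hpsi (nonneg_wave_powR Hw).
have Xt t : X <= t -> 0 <= t by move=> ?; rewrite (le_trans (ltW X0)).
move=> /(_ _ (fun=> ler01) meta (fun _ _ => ler01) (fun _ _ _ _ => lexx _) _ _ G0) key.
apply: (powR_chain _ _ _ (key _ _ _)).
- apply: mass_int_ge0 => // t x; rewrite /= in_itv/= => /andP[t0 tX].
  by apply: (wave_curve_ge0 Hc); split=> //; rewrite (le_lt_trans _ XT').
- apply: ler_wpDr => //; apply: (time_integral_le XT').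
  + exact: mass_continuous ch.
  + exact: (slice_pairing_continuous r0 ch (wave_weight_smooth Hpsi)).
  + move=> t /andP[t0 tX]; rewrite -[mass h t]mul1r.
    apply: (slice_pairing_lower ch (wave_curve_ge0 Hc) (wave_weight_smooth Hpsi)).
      by split=> //; rewrite (le_lt_trans _ XT').
    by move=> x xt; have [-> _] := psiE t x t0 xt.
- rewrite powR1 mulr1 powRM ?(ltW K10) ?(ltW X0)//.
  apply: ler_wpM2r; first by apply: mass_int_ge0 => // t x _; exact: powR_ge0.
  have -> : X `^ ((n%:R + 1) * (p - 1) - 2 * p) =
      X `^ (- ((1 + 1) * p) + n%:R * (p - 1)) * X `^ (p - 1).
    rewrite -powRD_gt0//.
    by congr (_ `^ _); ring.
  by apply: eq_leW; ring.
- move=> t x /andP[Xlt _] xt; have [-> ->] := psiE t x (Xt _ Xlt) xt.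
  rewrite normr1 normr0 subrr powRr0 !mulr1 mul1r; split=> //.
  exact: powR_ge0.
- by move=> s _; rewrite powR1.
- move=> m mX; rewrite sumr_const_nat (le_trans _ mX)// ler_nat.
  exact: leq_subr.
Qed.

(** Two identities dictate this value: [(gam - (nu + 1)) * (p / (p - 1)) = -1], the borderline of
    summability, and [gam - 2 * nu = - (nu - p^-1)], the exponent in the lower bound for the
    weight. *)
Let gam : R := nu + p^-1.

Let gam_bounds : 0 < gam < nu + 1.
Proof.
rewrite /gam addr_gt0 ?invr_gt0//= ltrD2l invf_lt1//.
Qed.

(** The superposition must reach the scale [1 + X] for the lower bound to hold on all of [[0, X]],
    and must stop at a multiple of [X] for the weight to be at most of order [X] times its time
    derivative. *)
Let choose_J (X : R) : 1 <= X -> exists J : nat, 1 + X < 2 ^+ J /\ 2 ^+ J <= 4 * X.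
Proof.
move=> X1; have h : 1 <= 1 + X by rewrite lerDl (le_trans ler01).
have [m /andP[m1 m2]] := dyadic_bracket h.
by exists m.+1; split=> //; rewrite exprS; lra.
Qed.

Let sum_inv_bound (X : R) (m : nat) : 1 <= X -> m%:R <= K1 * X ->
  \sum_(1 <= i < m) i%:R^-1 <= (1 + ln K1) * (1 + ln X).
Proof.
move=> X1 mX; have lnX : 0 <= ln X by exact: ln_ge0.
have lnK : 0 <= ln K1 by exact: ln_ge0.
have X0 : 0 < X by rewrite (lt_le_trans _ X1).
have K10 : 0 < K1 by rewrite (lt_le_trans _ K11).
have R0 : 0 <= (1 + ln K1) * (1 + ln X) by rewrite mulr_ge0// addr_ge0.
case: m mX => [|[|m]] mX; [by rewrite big_geq|by rewrite big_geq|].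
apply: le_trans (@sum_inv_le_ln R m.+1 (ltn0Sn _)) _.
have : ln (m.+1%:R : R) <= ln (K1 * X).
  rewrite ler_ln ?posrE ?ltr0Sn ?mulr_gt0//.
  by apply: le_trans mX; rewrite ler_nat.
rewrite lnM ?posrE// => h; have := mulr_ge0 lnK lnX.
by rewrite mulrDl mul1r mulrDr mulr1; lra.
Qed.

Lemma weighted_mass_inequality : exists2 C : R, 0 < C &
  forall T w wt h (X d : R), (0 < T)%E -> nonneg_wave T w wt h ->
  1 <= X -> 0 < d <= 1 -> ((expR d * X)%:E < T)%E ->
  (\int[lebesgue_measure]_(t in `[0, X]) ((1 + t) `^ (- (nu - p^-1)) * mass h t)) `^ p <=
  C * d `^ (- (2 * p)) * X `^ (nu * p - n%:R) * (1 + ln X) `^ (p - 1) *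
  \int[lebesgue_measure]_(t in `[X, expR d * X]) mass (fun t x => `|w t x| `^ p) t.
Proof.
have [K K0 HK] := annulus_inequality n0 r0 p1.
have K10 : 0 < K1 by rewrite (lt_le_trans _ K11).
have [C1 C10 HC1] := @sum_weight_dt_bound R n r r0 nu nu0 gam gam_bounds.
have [c c0 Hc] := @sum_weight_lower R n r r0 nu nu0 gam (andP gam_bounds).1.
have lnK : 0 <= ln K1 by exact: ln_ge0.
have lnK1 : 0 < 1 + ln K1 by rewrite ltr_wpDr.
(* The second summand is the cost of passing from the time derivative to the weight: on the annulus
   [t + (r + 2 + 2 ^+ j) <= (expR 1 + r + 6) * X], because [2 ^+ j <= 4 * X]. *)
pose A := C1 * (1 + (expR 1 + r + 6) / (2 * nu)).
have A0 : 0 < A.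
  rewrite /A mulr_gt0// ltr_wpDr// divr_ge0 ?(ltW nu2)//.
  by rewrite !addr_ge0 ?expR_ge0.
exists (c `^ (- p) * K * A `^ p * (1 + ln K1) `^ (p - 1)); first by rewrite !mulr_gt0 ?powR_gt0.
move=> T w wt h X d T0 Hw X1 d01 XT; have /andP[d0 d1] := d01.
have X0 : 0 < X by rewrite (lt_le_trans _ X1).
have XT' := before_scaled (ltW X0) (ltW d0) XT.
have lnX : 0 <= ln X by exact: ln_ge0.
have lnX1 : 0 < 1 + ln X by rewrite ltr_wpDr.
have Hcw := nonneg_wave_curve Hw; have ch := wave_curve_h Hcw.
have [J [J1 J2]] := choose_J X1.
have [L Hpsi] := @sum_weight_wave R n r r0 gam J.
have spsi := wave_weight_smooth Hpsi.
set psi := sum_weight _ _ _ _ in Hpsi spsi.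
have Xt t : X <= t -> 0 < t by move=> ?; rewrite (lt_le_trans X0).
have hpsi0 (x : 'rV[R]_n) : enorm x <= r -> 0 <= psi (x, 0) /\ dt psi (x, 0) <= 0.
  move=> xr; have xr0 : enorm x <= 0 + r by rewrite add0r.
  split; first by apply: (wave_weight_ge0 Hpsi).
  rewrite /psi dt_sum_weight; apply: sumr_le0 => j _.
  rewrite mulr_ge0_le0 ?powR_ge0// dt_cone_weight_le0//.
    by rewrite oppr_le0 ltW.
  by rewrite lerDl exprn_ge0.
have /andP[G1 G2] := initial_pairing_ge T0 Hw spsi hpsi0.
have G0 := le_trans G1 G2.
pose eta (s : R) := s `^ (gam - (nu + 1)).
have meta : measurable_fun setT eta by exact: measurable_powR.
have := HK nu T w wt h _ _ X d A ((1 + ln K1) * (1 + ln X)) eta (fun s => s^-1) X1 d01 XT A0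
  (mulr_gt0 lnK1 lnX1) Hcw Hpsi (nonneg_wave_powR Hw).
move=> /(_ _ (fun s => powR_ge0 _ _) meta _ _ _ _ G0) key.
set S := Rintegral _ _ _.
have S0 : 0 <= S.
  apply: Rintegral_ge0 => // t; rewrite /= in_itv/= => /andP[t0 tX].
  rewrite mulr_ge0 ?powR_ge0//; apply: Rintegral_ge0 => x _.
  by apply: (wave_curve_ge0 Hcw); split=> //; rewrite (le_lt_trans _ XT').
have -> : S `^ p = c `^ (- p) * (c * S) `^ p.
  rewrite powRM ?(ltW c0)// mulrA -powRD_gt0//.
  by rewrite addNr powRr0 mul1r.
rewrite -!mulrA; apply: ler_wpM2l; first exact: powR_ge0.
apply: (powR_chain _ _ _ (key _ _ _ _ _)).
- by rewrite mulr_ge0// ltW.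
- apply: ler_wpDr => //; rewrite /S -RintegralZl//; last first.
    apply: continuous_integrable; apply: (continuous_on_time_within XT').
    by apply: continuous_on_timeM; [exact: time_power_continuous|exact: mass_continuous ch].
  apply: (time_integral_le XT').
  + apply: continuous_on_timeM; first by move=> t It; exact: cvg_cst.
    by apply: continuous_on_timeM; [exact: time_power_continuous|exact: mass_continuous ch].
  + exact: (slice_pairing_continuous r0 ch spsi).
  + move=> t /andP[t0 tX]; rewrite mulrA.
    apply: (slice_pairing_lower ch (wave_curve_ge0 Hcw) spsi).
      by split=> //; rewrite (le_lt_trans _ XT').
    move=> x xt; rewrite (_ : - (nu - p^-1) = gam - 2 * nu); last by rewrite /gam; ring.
    apply: Hc => //; apply: le_lt_trans J1; by rewrite lerD2l.
- rewrite !mulrA; apply: ler_wpM2r; first by apply: mass_int_ge0 => // t x _; exact: powR_ge0.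
  rewrite powRM ?(ltW lnK1) ?(ltW lnX1)//.
  have -> : - ((1 + nu) * p) + n%:R * (p - 1) = nu * p - n%:R by rewrite /nu; field.
  by apply: eq_leW; ring.
- move=> t x /andP[Xlt tX] xt; have t0 := Xt _ Xlt.
  have E0 : 0 < expR 1 :> R by exact: expR_gt0.
  have tEX : t <= expR 1 * X.
    by apply: le_trans tX _; rewrite ler_wpM2r ?(ltW X0)// ler_expR.
  set e := eta _; have e0 : 0 <= e by exact: powR_ge0.
  have b1 := HC1 J t x t0 xt; rewrite -/(eta _) -/e in b1.
  set S1 := \sum_(_ <= _ < _) _ in b1.
  have {}b1 : S1 <= C1 * X `^ (- nu) * e.
    apply: le_trans b1 _; rewrite ler_wpM2r// ler_wpM2l ?(ltW C10)//.
    by rewrite powR_anti// ltW.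
  have AC : C1 <= A by rewrite /A ler_peMr ?(ltW C10)// lerDl divr_ge0 ?(ltW nu2)// !addr_ge0
    ?(ltW E0).
  have q0 : 0 <= X `^ (- nu) * e by rewrite mulr_ge0 ?powR_ge0.
  have S1A : S1 <= A * X `^ (- nu) * e.
    by apply: le_trans b1 _; apply: ler_wpM2r => //; apply: ler_wpM2r => //; exact: powR_ge0.
  split; last first.
    apply: le_trans S1A; rewrite /psi dt_sum_weight (le_trans (ler_norm_sum _ _ _))//.
    by apply: ler_sum => j _; rewrite normrM ger0_norm ?powR_ge0.
  pose M := (expR 1 + r + 6) * X / (2 * nu).
  have M0 : 0 <= M by rewrite /M divr_ge0 ?(ltW nu2)// mulr_ge0 ?(ltW X0)// !addr_ge0 ?(ltW E0).
  have -> : X `^ (1 - nu) = X * X `^ (- nu).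
    by rewrite [LHS]powR_pred// addrC addKr.
  apply: (@le_trans _ _ (M * S1)).
    rewrite /psi /sum_weight (le_trans (ler_norm_sum _ _ _))// /S1 mulr_sumr.
    rewrite big_nat_cond [X in _ <= X]big_nat_cond.
    apply: ler_sum => j /andP[/andP[_ jJ] _]; rewrite normrM ger0_norm ?powR_ge0// mulrCA.
    rewrite ler_wpM2l ?powR_ge0//.
    apply: le_trans (cone_weight_le_dt r0 nu0 _ (ltW t0) xt) _; first exact: exprn_ge0.
    rewrite ler_wpM2r// /M ler_wpM2r ?invr_ge0 ?(ltW nu2)//.
    have jJ' : 2 ^+ j <= 2 ^+ J :> R by rewrite ler_eXn2l ?ltr1n// ltnW.
    have rX : r <= r * X by rewrite ler_peMr.
    by rewrite !mulrDl; lra.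
  apply: (@le_trans _ _ (M * (C1 * X `^ (- nu) * e))); first by rewrite ler_wpM2l.
  have -> : A * (X * X `^ (- nu)) * e = C1 * X * (X `^ (- nu) * e) + M * (C1 * X `^ (- nu) * e).
    by rewrite /A /M; field; rewrite gt_eqF.
  by rewrite lerDr mulr_ge0// mulr_ge0 ?(ltW C10) ?(ltW X0).
- by move=> s s0; rewrite invr_ge0.
- by move=> s u s1 su; rewrite lef_pV2 ?posrE// ?(lt_le_trans ltr01)// (le_trans s1).
- move=> s s1; rewrite /eta -powRrM.
  rewrite (_ : _ * _ = -1); first by rewrite powR_inv1// (le_trans ler01).
  by rewrite /gam; field; rewrite ?gt_eqF// ?subr_gt0.
- by move=> m; exact: sum_inv_bound.
Qed.

(** A single power decays like [s^(-(nu+1))] away from the cone. As [1 <= nu], the [p/(p-1)]-th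
    power is at most [s^(-2)], whose sum is at most 2: the data act on every annulus with no
    logarithmic loss. *)
Lemma initial_mass_inequality : (2 < n)%N -> exists2 C : R, 0 < C &
  forall T w wt h (X : R), (0 < T)%E -> nonneg_wave T w wt h ->
  1 <= X -> ((expR 1 * X)%:E < T)%E ->
  slice_pairing wt (cone_weight (- nu) (r + 2)) 0 `^ p <=
  C * X `^ (nu * p - n%:R) *
  \int[lebesgue_measure]_(t in `[X, expR 1 * X]) mass (fun t x => `|w t x| `^ p) t.
Proof.
move=> n2; have nu1 : 1 <= nu.
  rewrite /nu ler_pdivlMr// mul1r lerBrDr.
  have : (3%:R : R) <= n%:R by rewrite ler_nat.
  by lra.
have [K K0 HK] := annulus_inequality n0 r0 p1.
have K10 : 0 < K1 by rewrite (lt_le_trans _ K11).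
pose A := 2 * nu * (1 + (expR 1 + r + 2) / (2 * nu)).
have E0 : 0 < expR 1 :> R by exact: expR_gt0.
have A0 : 0 < A.
  rewrite /A mulr_gt0// ltr_wpDr// divr_ge0 ?(ltW nu2)//.
  by rewrite !addr_ge0 ?(ltW E0).
exists (K * A `^ p * 2 `^ (p - 1)); first by rewrite !mulr_gt0 ?powR_gt0.
move=> T w wt h X T0 Hw X1 XT.
have X0 : 0 < X by rewrite (lt_le_trans _ X1).
have XT' := before_scaled (ltW X0) ler01 XT.
have Hcw := nonneg_wave_curve Hw; have ch := wave_curve_h Hcw.
have Hpsi : wave_weight r (r + 2) (@cone_weight R n (- nu) (r + 2)).
  by apply: cone_weight_wave => //; right.
have spsi := wave_weight_smooth Hpsi.
set psi := cone_weight _ _ in Hpsi spsi *.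
have Xt t : X <= t -> 0 < t by move=> ?; rewrite (lt_le_trans X0).
have hpsi0 (x : 'rV[R]_n) : enorm x <= r -> 0 <= psi (x, 0) /\ dt psi (x, 0) <= 0.
  move=> xr; have xr0 : enorm x <= 0 + r by rewrite add0r.
  split; first by apply: (wave_weight_ge0 Hpsi).
  by rewrite dt_cone_weight_le0// oppr_le0 ltW.
have /andP[G1 G2] := initial_pairing_ge T0 Hw spsi hpsi0.
have G0 := le_trans G1 G2.
pose eta (s : R) := s `^ (- (nu + 1)).
have meta : measurable_fun setT eta by exact: measurable_powR.
have d01 : 0 < (1 : R) <= 1 by rewrite ltr01 lexx.
have := HK nu T w wt h _ _ X 1 A 2 eta (fun s => s ^- 2) X1 d01 XT A0
  (ltr0Sn _ 1) Hcw Hpsi (nonneg_wave_powR Hw).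
move=> /(_ _ (fun s => powR_ge0 _ _) meta _ _ _ _ G0) key.
apply: (powR_chain _ _ _ (key _ _ _ _ _)).
- exact: G1.
- apply: le_trans G2 _; apply: ler_wpDl (lexx _).
  apply: Rintegral_ge0 => t /=; rewrite in_itv/= => /andP[t0 tX].
  have It : time_interval T t by split=> //; rewrite (le_lt_trans _ XT').
  apply: (slice_pairing_ge0 ch spsi It).
  by apply: aeW => x xt; rewrite mulr_ge0 ?(wave_curve_ge0 Hcw) ?(wave_weight_ge0 Hpsi).
- apply: ler_wpM2r; first by apply: mass_int_ge0 => // t x _; exact: powR_ge0.
  rewrite powR1 mulr1.
  have -> : - ((1 + nu) * p) + n%:R * (p - 1) = nu * p - n%:R by rewrite /nu; field.
  by apply: eq_leW; ring.
- move=> t x /andP[Xlt tX] xt; have t0 := Xt _ Xlt.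
  set e := eta _; have e0 : 0 <= e by exact: powR_ge0.
  have b1 := dt_cone_weight_bound r0 nu0 (lexx 0) t0 xt.
  have b2 := cone_weight_le_dt r0 nu0 (lexx 0) (ltW t0) xt.
  rewrite !addr0 -/(eta _) -/e in b1 b2.
  have {}b1 : `|dt psi (x, t)| <= 2 * nu * X `^ (- nu) * e.
    apply: le_trans b1 _; rewrite ler_wpM2r// ler_wpM2l ?(ltW nu2)//.
    by rewrite powR_anti// ltW.
  pose M := (expR 1 + r + 2) * X / (2 * nu).
  have M0 : 0 <= M by rewrite /M divr_ge0 ?(ltW nu2)// mulr_ge0 ?(ltW X0)// !addr_ge0 ?(ltW E0).
  have AC : 2 * nu <= A by rewrite /A ler_peMr ?(ltW nu2)// lerDl divr_ge0 ?(ltW nu2)//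
    !addr_ge0 ?(ltW E0).
  split; last first.
    by apply: le_trans b1 _; apply: ler_wpM2r => //; apply: ler_wpM2r => //; exact: powR_ge0.
  have -> : X `^ (1 - nu) = X * X `^ (- nu).
    by rewrite [LHS]powR_pred// addrC addKr.
  apply: (@le_trans _ _ (M * (2 * nu * X `^ (- nu) * e))).
    apply: le_trans b2 _; apply: ler_pM => //.
      by rewrite divr_ge0 ?(ltW nu2)// !addr_ge0// ltW.
    rewrite /M ler_wpM2r ?invr_ge0 ?(ltW nu2)//.
    have rX : r <= r * X by rewrite ler_peMr.
    have tEX : t <= expR 1 * X by exact: tX.
    by rewrite !mulrDl; lra.
  have -> : A * (X * X `^ (- nu)) * e = 2 * nu * X * (X `^ (- nu) * e) + M * (2 * nu * X `^ (-
    nu) * e).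
    by rewrite /A /M; field; rewrite gt_eqF.
  rewrite lerDr; apply: mulr_ge0; first exact: mulr_ge0 (ltW nu2) (ltW X0).
  by rewrite mulr_ge0 ?powR_ge0.
- by move=> s s0; rewrite invr_ge0 exprn_ge0.
- move=> s u s1 su; have s0 : 0 < s by rewrite (lt_le_trans ltr01).
  by rewrite lef_pV2 ?posrE ?exprn_gt0// ?(lt_le_trans s0)// lerXn2r// nnegrE ltW// (lt_le_trans
    s0).
- move=> s s1; have s0 : 0 < s by rewrite (lt_le_trans ltr01).
  rewrite /eta -powRrM -(powR_mulrn 2 (ltW s0)) -powRN.
  apply: ler_powR => //; rewrite mulNr lerN2.
  have : 1 <= p / (p - 1) by rewrite ler_pdivlMr// mul1r gerBl.
  move: (p / (p - 1)) => y y1; apply: (@le_trans _ _ (2 * y)); first by rewrite ler_peMr.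
  by rewrite ler_wpM2r ?(le_trans ler01)// -lerBlDr; lra.
- by case=> [|m] _; [rewrite big_geq|exact: sum_inv_sqr_le].
Qed.

End mass_inequalities.

(** * Blow-up *)

Section blowup.
Variable R : realType.

Lemma increments_ge (A : R -> R) (s d g : R) (k : nat) :
  (forall i : nat, (i < k)%N -> g <= A (s + i.+1%:R * d) - A (s + i%:R * d)) ->
  k%:R * g <= A (s + k%:R * d) - A s.
Proof.
elim: k => [|k IH] h; first by rewrite !mul0r addr0 subrr.
have {}IH : k%:R * g <= A (s + k%:R * d) - A s by apply: IH => i ik; apply: h; exact: ltnW.
have hk := h k (ltnSn k).
by rewrite -[in X in X * g]natr1 mulrDl mul1r; lra.
Qed.

Lemma unbounded_exp (L lam M : R) : 0 < L -> 1 < lam -> ~ (forall j : nat, L * lam ^+ j <= M).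
Proof.
move=> L0 l1 h; have lx j : 1 + j%:R * (lam - 1) <= lam ^+ j.
  elim: j => [|j IH]; first by rewrite mul0r addr0 expr0.
  have lam0 : 0 <= lam by rewrite ltW// (lt_trans _ l1).
  rewrite exprS; apply: le_trans (ler_wpM2l lam0 IH); rewrite -natr1.
  have j0 : 0 <= j%:R :> R by [].
  by have := mulr_ge0 j0 (sqr_ge0 (lam - 1)); nra.
have [j hj] : exists j : nat, M / L < j%:R * (lam - 1).
  exists (Num.truncn (`|M / L| / (lam - 1))).+1.
  rewrite -ltr_pdivrMr ?subr_gt0//.
  apply: (@le_lt_trans _ _ (`|M / L| / (lam - 1))).
    by rewrite ler_wpM2r ?invr_ge0 ?subr_ge0 ?(ltW l1)// ler_norm.
  have q0 : 0 <= `|M / L| / (lam - 1) by rewrite divr_ge0// subr_ge0 ltW.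
  by have /andP[] := truncn_itv q0.
have := h j; rewrite mulrC -ler_pdivlMr// leNgt => /negP; apply.
by apply: lt_le_trans hj (le_trans _ (lx j)); rewrite lerDr.
Qed.

(* On the j-th of infinitely many stages, of length [K / 2 ^+ j.+1], the inequality is
   used with the step [1 / 2 ^+ j.+1], [K] times. *)
Lemma blowup_bound (kap mu m C1 : R) : 1 < kap -> 0 <= mu -> 0 < m -> 0 < C1 ->
  exists2 C : R, 0 < C & forall (A : R -> R) (b : R) (K : nat), (0 < K)%N -> 0 < b -> 0 <= A 0 ->
  (forall s t, 0 <= s -> s <= t -> t <= 3 * K%:R -> A s <= A t) ->
  (forall s d, 0 <= s -> 0 < d <= 1 -> s + d <= 3 * K%:R ->
    A s `^ kap <= C1 * d `^ (- m) * (1 + s) `^ mu * (A (s + d) - A s)) ->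
  (forall s, 0 <= s -> s + 2 <= 3 * K%:R -> b <= A (s + 2) - A s) ->
  K%:R `^ (kap - mu) * b `^ (kap - 1) <= C.
Proof.
move=> k1 mu0 m0 C10; have k10 : 0 < kap - 1 by rewrite subr_gt0.
have k0 : 0 < kap by rewrite (lt_trans _ k1).
pose th : R := 2 `^ (- m); have th0 : 0 < th by exact: powR_gt0.
pose lam : R := 2 `^ (m / (kap - 1)); have lam0 : 0 < lam by exact: powR_gt0.
have lt12 : (1 : R) < 2 by rewrite ltr1n.
have lam1 : 1 < lam.
  by have := powR_lt_exp lt12 (divr_gt0 m0 k10); rewrite powRr0.
have lamk : lam `^ (kap - 1) = th^-1.
  by rewrite /lam -powRrM divfK ?gt_eqF// /th powRN invrK.
(* The 4 comes from [1 + s <= 4 * K%:R], valid for [s <= 3 * K%:R] and [1 <= K%:R]. *)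
pose c := (C1 * 4 `^ mu)^-1; have c0 : 0 < c by rewrite invr_gt0 mulr_gt0// powR_gt0.
exists (lam / (th * c)); first by rewrite divr_gt0// mulr_gt0.
move=> A b K K0 b0 A0 Amon Aineq Ab.
have K1 : 1 <= K%:R :> R by rewrite ler1n.
have KR0 : 0 < K%:R :> R by rewrite ltr0n.
rewrite leNgt; apply/negP => big.
(* Stages run from [2 * K%:R] towards [3 * K%:R], so infinitely many of them fit; the time before
   [2 * K%:R] is reserved for the accumulation of the data. *)
pose s (j : nat) : R := 2 * K%:R + K%:R * (1 - 2 ^- j).
have p2 j : 0 < (2 ^- j : R) <= 1.
  by rewrite invr_gt0 exprn_gt0//= invf_le1 ?exprn_gt0// exprn_ege1// ltW.
have s3 j : s j <= 3 * K%:R.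
  by have /andP[h1 h2] := p2 j; have := mulr_ge0 (ltW KR0) (ltW h1); rewrite /s mulrBr; lra.
have s0 j : 0 <= s j.
  have /andP[h1 h2] := p2 j; rewrite /s addr_ge0 ?mulr_ge0 ?subr_ge0//.
have sS j : s j.+1 = s j + K%:R * 2 ^- j.+1.
  by rewrite /s exprS; field; rewrite gt_eqF ?exprn_gt0.
have Ages t : 0 <= t -> t <= 3 * K%:R -> 0 <= A t.
  by move=> t0 t3; apply: le_trans A0 (Amon _ _ (lexx _) t0 t3).
(* [K] disjoint intervals of length 2 fill [[0, 2 * K%:R]], each adding at least [b]. *)
have B0 : K%:R * b <= A (s 0%N).
  have -> : s 0%N = 0 + K%:R * 2 by rewrite /s expr0 invr1 subrr; ring.
  apply: (@le_trans _ _ (A (0 + K%:R * 2) - A 0)); last by rewrite gerBl.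
  apply: increments_ge => i iK; rewrite -natr1 mulrDl mul1r addrA.
  apply: Ab; first by rewrite add0r mulr_ge0.
  have : i.+1%:R <= K%:R :> R by rewrite ler_nat.
  by rewrite -natr1; lra.
have Bs j : c * th ^+ j.+1 * K%:R `^ (1 - mu) * A (s j) `^ kap <= A (s j.+1).
  have /andP[d0 d1] := p2 j.+1; set d := 2 ^- j.+1 in d0 d1.
  apply: (@le_trans _ _ (A (s j.+1) - A (s j))); last by rewrite gerBl Ages.
  rewrite sS.
  have -> : c * th ^+ j.+1 * K%:R `^ (1 - mu) * A (s j) `^ kap =
      K%:R * (c * th ^+ j.+1 * K%:R `^ (- mu) * A (s j) `^ kap).
    rewrite powRD_gt0//.
    by rewrite powRr1 ?(ltW KR0)//; ring.
  apply: increments_ge => i iK; rewrite -/d.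
  have iK' : i%:R + 1 <= K%:R :> R by rewrite natr1 ler_nat.
  set u := s j + i%:R * d.
  have uE : s j + i.+1%:R * d = u + d by rewrite -natr1 /u; ring.
  have su : s j <= u by rewrite lerDl mulr_ge0// ltW.
  have u0 : 0 <= u by rewrite (le_trans (s0 j)).
  have u3 : u + d <= 3 * K%:R.
    apply: le_trans (s3 j.+1); rewrite sS /u -addrA lerD2l -/d -[X in _ + X]mul1r -mulrDl.
    by rewrite ler_wpM2r// ltW.
  have u3' : u <= 3 * K%:R by apply: le_trans u3; rewrite lerDl ltW.
  rewrite uE.
  have D0 : 0 <= A (u + d) - A u by rewrite subr_ge0 Amon// lerDl ltW.
  have thd : th ^+ j.+1 = d `^ m.
    by rewrite /d powRVl ?exprn_ge0// /th powR_exprn.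
  have h1 : A (s j) `^ kap <= C1 * d `^ (- m) * (4 * K%:R) `^ mu * (A (u + d) - A u).
    apply: (@le_trans _ _ (A u `^ kap)).
      by apply: powR_le; rewrite ?(ltW k0)// ?Ages ?s3// Amon.
    apply: le_trans (Aineq u d u0 _ u3) _; first by rewrite d0.
    rewrite ler_wpM2r// ler_wpM2l ?mulr_ge0 ?powR_ge0 ?(ltW C10)//.
    by apply: powR_le => //; [rewrite addr_ge0|lra].
  have q0 : 0 < c * d `^ m * K%:R `^ (- mu) by rewrite !mulr_gt0 ?powR_gt0.
  rewrite thd; apply: le_trans (ler_wpM2l (ltW q0) h1) _.
  rewrite !powRN powRM ?(ltW KR0)// /c.
  apply: eq_leW; field.
  by rewrite !gt_eqF ?powR_gt0.
pose L := K%:R * b; have L0 : 0 < L by rewrite mulr_gt0.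
have BL j : L * lam ^+ j <= A (s j).
  elim: j => [|j IH]; first by rewrite expr0 mulr1.
  apply: le_trans (Bs j).
  have q0 : 0 < c * th ^+ j.+1 * K%:R `^ (1 - mu) by rewrite !mulr_gt0 ?powR_gt0 ?exprn_gt0.
  apply: (@le_trans _ _ (c * th ^+ j.+1 * K%:R `^ (1 - mu) * (L * lam ^+ j) `^ kap)); last first.
    rewrite ler_wpM2l ?(ltW q0)//; apply: powR_le; rewrite ?(ltW k0)//.
    by rewrite mulr_ge0 ?exprn_ge0 ?ltW.
  have Lj0 : 0 < L * lam ^+ j by rewrite mulr_gt0 ?exprn_gt0.
  (* One factor is kept for the induction. The powers of [th] then cancel except for one, and the
     hypothesis [big] says exactly that the remaining factor exceeds [lam]. *)
  have -> : (L * lam ^+ j) `^ kap = (L * lam ^+ j) * (L `^ (kap - 1) * th^-1 ^+ j).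
    have -> : th^-1 ^+ j = (lam ^+ j) `^ (kap - 1) by rewrite powR_exprn ?(ltW lam0)// lamk.
    have -> : L `^ (kap - 1) * (lam ^+ j) `^ (kap - 1) = (L * lam ^+ j) `^ (kap - 1).
      by rewrite powRM ?exprn_ge0 ?(ltW lam0) ?(ltW L0).
    exact: powR_pred.
  have -> : c * th ^+ j.+1 * K%:R `^ (1 - mu) * (L * lam ^+ j * (L `^ (kap - 1) * th^-1 ^+ j)) =
      L * lam ^+ j * (c * th * (K%:R `^ (1 - mu) * L `^ (kap - 1))).
    by rewrite exprVn exprS; field; rewrite expf_neq0 ?gt_eqF.
  rewrite exprS mulrCA mulrC ler_wpM2l ?(ltW Lj0)//.
  have -> : K%:R `^ (1 - mu) * L `^ (kap - 1) = K%:R `^ (kap - mu) * b `^ (kap - 1).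
    rewrite /L powRM ?(ltW KR0) ?(ltW b0)// mulrA -powRD_gt0//.
    by congr (_ `^ _ * _); ring.
  move: big; rewrite ltr_pdivrMr ?mulr_gt0// => /ltW.
  by rewrite mulrC [th * c]mulrC.
apply: (unbounded_exp (M := A (3 * K%:R)) L0 lam1) => j.
by apply: le_trans (BL j) (Amon _ _ (s0 j) (s3 j) (lexx _)).
Qed.

End blowup.

(** * From solutions to nonnegative waves *)

Section solution_waves.
Variables (R : realType) (n : nat).
Local Notation mu := (lebesgue_rV R n).

Lemma Lp_norm_le_H1_norm (f : 'rV[R]_n -> R) : (Lp_norm 2 f <= H1_norm f)%E.
Proof.
rewrite /H1_norm; set a := Lp_norm 2 f; have a0 : (0 <= a)%E by exact: Lnorm_ge0.
set s := (\sum_(_ < _) _)%E.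
have s0 : (0 <= s)%E by apply: sume_ge0 => i _; exact: poweR_ge0.
have half : (2 : R)^-1 != 0 by rewrite invr_eq0.
have aE : a = ((a `^ 2) `^ 2^-1)%E by rewrite -poweRrM mulfV// poweRe1.
rewrite [X in (X <= _)%E]aE.
apply: gt0_ler_poweR; rewrite ?in_itv/= ?leey ?andbT ?poweR_ge0 ?adde_ge0 ?poweR_ge0//.
exact: leeDl.
Qed.

Lemma continuous_in_H1_L2 (T : \bar R) (w : R -> 'rV[R]_n -> R) :
  continuous_in T (@H1 R n) (@H1_norm R n) w -> continuous_in T (Lp 2) (Lp_norm 2) w.
Proof.
move=> [wH wc]; split=> t It; first by have [] := wH t It.
apply: (@squeeze_cvge _ _ _ _ (fun=> 0%E) _ (fun s => H1_norm (w s \- w t))).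
- by apply: nearW => s; rewrite Lnorm_ge0 Lp_norm_le_H1_norm.
- exact: cvg_cst.
- exact: wc.
Qed.

Variables (T : \bar R) (r : R).
Hypotheses (n0 : (0 < n)%N) (r0 : 0 <= r).

Lemma pairing_ae (w z : R -> 'rV[R]_n -> R) phi : smooth_expr phi ->
  (forall t, time_interval T t -> measurable_fun setT (w t)) ->
  (forall t, time_interval T t -> measurable_fun setT (z t)) ->
  (forall t, time_interval T t -> {ae mu, forall x, w t x = z t x}) ->
  pairing T w phi = pairing T z phi.
Proof.
move=> sphi mw mz wz; apply: eq_Rintegral => t; rewrite inE => -[t0 tT].
have It : time_interval T t by split=> //; exact: ltW.
have mphi := smooth_expr_measurable t sphi.
apply: ae_eq_Rintegral.
- by apply: measurable_funM => //; exact: mw.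
- by apply: measurable_funM => //; exact: mz.
- by apply: filterS (wz t It) => x ->.
Qed.

(** The exponents [mw] and [mz] record in which Lebesgue space continuity in time is known: [q] for
    [u], but only 2 for [v], so that [p <= 2] is required wherever [|v|^p] appears. *)
Lemma nonneg_wave_trunc (p k mw mz : R) (w wt z : R -> 'rV[R]_n -> R) :
  1 <= p <= mw -> 1 <= k <= mz ->
  continuous_in T (Lp 2) (Lp_norm 2) w -> continuous_in T (Lp mw) (Lp_norm mw) w ->
  continuous_in T (Lp 2) (Lp_norm 2) wt -> continuous_in T (Lp mz) (Lp_norm mz) z ->
  (forall t, time_interval T t -> {ae mu, forall x, t + r < enorm x -> w t x = 0}) ->
  (forall t, time_interval T t -> {ae mu, forall x, t + r < enorm x -> wt t x = 0}) ->
  (forall t, time_interval T t -> {ae mu, forall x, t + r < enorm x -> z t x = 0}) ->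
  time_derivative T w wt -> wave_equation T w (fun t x => `|z t x| `^ k) ->
  {ae mu, forall x, 0 <= w 0 x /\ 0 <= wt 0 x} ->
  nonneg_wave r p T (trunc r w) (trunc r wt) (fun t x => `|trunc r z t x| `^ k).
Proof.
move=> pm km cw2 cwm cwt2 czm sw swt sz dw ew w0.
have le12 : (1 : R) <= 2 by rewrite ler1n.
have /andP[p1 pmw] := pm; have /andP[k1 kmz] := km.
have mww t (It : time_interval T t) := Lp_measurable (cw2.1 t It).
have mwt t (It : time_interval T t) := Lp_measurable (cwt2.1 t It).
have mzz t (It : time_interval T t) := Lp_measurable (czm.1 t It).
have mtw t (It : time_interval T t) : measurable_fun setT (trunc r w t).
  exact: measurable_trunc (mww t It).
have mtwt t (It : time_interval T t) : measurable_fun setT (trunc r wt t).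
  exact: measurable_trunc (mwt t It).
have aw t (It : time_interval T t) := trunc_ae (sw t It).
have awt t (It : time_interval T t) := trunc_ae (swt t It).
have az t (It : time_interval T t) := trunc_ae (sz t It).
split.
- split.
  + exact: (trunc_L1_curve n0 r0 le12 cw2 sw).
  + exact: (trunc_L1_curve n0 r0 le12 cwt2 swt).
  + exact: (trunc_powR_L1_curve n0 r0 (le_trans k1 kmz) czm sz).
  + by move=> t x _; exact: powR_ge0.
  + move=> phi sphi tphi.
    have sdt : smooth_expr (dt phi) by exact: smooth_expr_derive.
    have -> := pairing_ae sdt mtw mww aw.
    have -> := pairing_ae sphi mtwt mwt awt.
    exact: dw.
  + move=> phi sphi tphi.
    have sbox : smooth_expr (fun z => dt (dt phi) z - laplacian phi z).
      rewrite (_ : (fun z => _) = fun z => dt (dt phi) z + -1 * laplacian phi z); last first.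
        by apply/funext => x; rewrite mulN1r.
      apply: SE_add; first by do 2 apply: smooth_expr_derive.
      apply: SE_mul; first exact: SE_cst.
      by apply: smooth_expr_sum => i; do 2 apply: smooth_expr_derive.
    have -> := pairing_ae sbox mtw mww aw.
    rewrite (@pairing_ae (fun t x => `|trunc r z t x| `^ k) (fun t x => `|z t x| `^ k)) => //.
    * exact: ew.
    * by move=> t It; apply: measurable_abs_powR; apply: measurable_trunc; exact: mzz.
    * by move=> t It; apply: measurable_abs_powR; exact: mzz.
    * by move=> t It; apply: filterS (az t It) => x ->.
- exact: (trunc_powR_L1_curve n0 r0 (le_trans p1 pmw) cwm sw).
- apply: filterS w0 => x [h1 h2]; rewrite /trunc; case: ifP => //.
Qed.

End solution_waves.

Section initial_data.
Variables (R : realType) (n : nat) (r : R).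
Hypotheses (n0 : (0 < n)%N) (r0 : 0 <= r).
Local Notation mu := (lebesgue_rV R n).
Variables (a : R) (g : 'rV[R]_n -> R).
Hypotheses (gL2 : Lp 2 g) (gsupp : {ae mu, forall x, r < enorm x -> g x = 0})
  (g0 : {ae mu, forall x, 0 <= g x}) (gn0 : ~ {ae mu, forall x, g x = 0}).
Let psi := @cone_weight R n a (r + 2).

(** The datum is viewed as a constant curve on an infinite time interval, so that the results on
    curves apply to it. *)
Let w (t : R) := g.

Let I0 : time_interval +oo (0 : R).
Proof. by split; rewrite ?ltry. Qed.

Let sw (t : R) : time_interval +oo t -> {ae mu, forall x, t + r < enorm x -> w t x = 0}.
Proof.
move=> [t0 _]; apply: filterS gsupp => x h tx; apply: h; apply: le_lt_trans tx.
by rewrite lerDr.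
Qed.

Let ctw : L1_curve +oo r (trunc r w).
Proof.
have le12 : (1 : R) <= 2 by rewrite ler1n.
have cw : continuous_in +oo (Lp 2) (Lp_norm 2) w.
  split=> t It; first exact: gL2.
  rewrite (_ : (fun s => _) = fun=> 0%E); first exact: cvg_cst.
  apply/funext => s; rewrite /Lp_norm (_ : EFin \o _ = cst 0%E) ?Lnorm0//.
  by apply/funext => x /=; rewrite subrr.
exact: (trunc_L1_curve n0 r0 le12 cw sw).
Qed.

Let spsi : smooth_expr psi. Proof. exact: SE_cone_weight. Qed.

(** The weight is positive on [|x| <= r] and the datum is nonnegative, so a vanishing integral would
    force the datum to vanish almost everywhere. *)
Lemma initial_pairing_gt0 : 0 < slice_pairing (trunc r (fun=> g)) psi 0.
Proof.
have tg : {ae mu, forall x, trunc r w 0 x = g x} by exact: trunc_ae (sw I0).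
have ip := curve_pairing_integrable ctw spsi 0 I0.
set f := (fun x => trunc r w 0 x * psi (x, 0)) in ip.
have psi0 x : enorm x <= 0 + r -> 0 < psi (x, 0).
  by move=> xr; rewrite /psi (cone_weightE _ _ _ xr)// powR_gt0// (lt_trans _ (cone_gt2 _ _ xr)).
have f0 : {ae mu, forall x, 0 <= f x}.
  apply: filterS2 tg g0 => x h1 h2; rewrite /f h1.
  have [xr|xr] := leP (enorm x) (0 + r); first by rewrite mulr_ge0// ltW// psi0.
  by rewrite -h1 trunc_supp// mul0r.
have mf := integrable_measurable ip.
have E : slice_pairing (trunc r (fun=> g)) psi 0 = \int[mu]_x `|f x|.
  apply: ae_eq_Rintegral => //; first exact: measurableT_comp.
  by apply: filterS f0 => x h2; rewrite ger0_norm.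
rewrite E lt0r; apply/andP; split; last by apply: Rintegral_ge0.
apply/eqP => int0; apply: gn0.
have iabs := integrable_abs_fun ip.
have : (\int[mu]_x `|(f x)%:E| = 0)%E.
  rewrite -[RHS](_ : (\int[mu]_x `|f x|)%:E = 0%E); last by rewrite int0.
  by rewrite /Rintegral fineK//; exact: integrable_fin_num iabs.
move/(ae_eq_integral_abs mu measurableT _).1 => /(_ _)fz.
have : ae_eq mu setT (EFin \o f) (cst 0%E).
  by apply: fz; exact/measurable_EFinP.
apply: filterS2 tg => x h1 /(_ Logic.I) [fx].
rewrite -h1; have [xr|xr] := leP (enorm x) (0 + r); last exact: trunc_supp.
move: fx => /eqP; rewrite /f mulf_eq0 => /orP[/eqP//|].
by rewrite gt_eqF// psi0.
Qed.

Lemma scaled_initial_pairing (eps : R) (wt : R -> 'rV[R]_n -> R) :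
  measurable_fun setT (wt 0) -> {ae mu, forall x, wt 0 x = eps * g x} ->
  slice_pairing (trunc r wt) psi 0 = eps * slice_pairing (trunc r (fun=> g)) psi 0.
Proof.
move=> mwt wtg; have mpsi := smooth_expr_measurable 0 spsi.
have ip := curve_pairing_integrable ctw spsi 0 I0.
have ip' := integrableZ_fun eps ip.
rewrite /slice_pairing -RintegralZl//.
apply: ae_eq_Rintegral.
- by apply: measurable_funM => //; exact: measurable_trunc.
- exact: integrable_measurable ip'.
- apply: filterS wtg => x h; rewrite /trunc h mulrA; case: ifP => //.
  by rewrite mulr0.
Qed.

End initial_data.

(** * Growth in logarithmic time *)

Section log_mass.
Variables (R : realType) (n : nat) (T : \bar R) (r beta : R).
Hypotheses (r0 : 0 <= r) (b0 : 0 <= beta).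
Variable f : R -> 'rV[R]_n -> R.
Hypotheses (cf : L1_curve T r f) (f0 : forall t x, time_interval T t -> 0 <= f t x).

Lemma time_integralB (N : R -> R) X Y : continuous_on_time T N -> 0 <= X -> X <= Y ->
  (Y%:E < T)%E ->
  \int[lebesgue_measure]_(t in `[0, Y]) N t - \int[lebesgue_measure]_(t in `[0, X]) N t =
  \int[lebesgue_measure]_(t in `[X, Y]) N t.
Proof.
move=> cN X0 XY YT.
have iN := continuous_integrable (continuous_on_time_within YT cN).
rewrite Rintegral_itvB// ?bnd_simp//.
rewrite Rintegral_itv_obnd_cbnd//.
apply: integrableS iN => //.
by apply: subset_itvr; rewrite bnd_simp.
Qed.

Let N (t : R) := (1 + t) `^ (- beta) * mass f t.

Let cN : continuous_on_time T N.
Proof.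
apply: continuous_on_timeM; first exact: time_power_continuous.
exact: mass_continuous cf.
Qed.

Definition log_mass (s : R) : R := \int[lebesgue_measure]_(t in `[0, expR s]) N t.

Let before (t Y : R) : 0 <= t -> t <= Y -> (Y%:E < T)%E -> time_interval T t.
Proof. by move=> t0 tY YT; split=> //; rewrite (le_lt_trans _ YT). Qed.

Let mass0 t : time_interval T t -> 0 <= mass f t.
Proof. by move=> It; apply: Rintegral_ge0 => x _; exact: f0. Qed.

Lemma log_massB s u : s <= u -> ((expR u)%:E < T)%E -> log_mass u - log_mass s =
  \int[lebesgue_measure]_(t in `[expR s, expR u]) N t.
Proof. by move=> su uT; apply: time_integralB => //; rewrite ?expR_ge0 ?ler_expR. Qed.

Lemma log_mass_ge0 s : ((expR s)%:E < T)%E -> 0 <= log_mass s.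
Proof.
move=> sT; apply: Rintegral_ge0 => // t; rewrite /= in_itv/= => /andP[t0 ts].
by rewrite mulr_ge0 ?powR_ge0 ?mass0//; exact: before sT.
Qed.

Lemma log_mass_le s u : s <= u -> ((expR u)%:E < T)%E -> log_mass s <= log_mass u.
Proof.
move=> su uT; rewrite -subr_ge0 log_massB//.
apply: Rintegral_ge0 => // t; rewrite /= in_itv/= => /andP[t0 ts].
rewrite mulr_ge0 ?powR_ge0 ?mass0//; apply: before ts uT.
by rewrite (le_trans _ t0)// expR_ge0.
Qed.

Lemma mass_annulus_le s d : 0 <= s -> 0 < d <= 1 -> ((expR (s + d))%:E < T)%E ->
  \int[lebesgue_measure]_(t in `[expR s, expR (s + d)]) mass f t <=
  (1 + expR 1) `^ beta * expR s `^ beta * (log_mass (s + d) - log_mass s).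
Proof.
move=> s0 /andP[d0 d1] sT; have sd : s <= s + d by rewrite lerDl ltW.
have E0 : 0 < 1 + expR 1 :> R by rewrite addr_gt0 ?expR_gt0.
have X1 : 1 <= expR s by rewrite -[leLHS]expR0 ler_expR.
have sub : `[expR s, expR (s + d)] `<=` `[0, expR (s + d)].
  by apply: subset_itvr; rewrite bnd_simp expR_ge0.
have iS (g : R -> R) : continuous_on_time T g ->
    lebesgue_measure.-integrable `[expR s, expR (s + d)] (EFin \o g).
  move=> cg; have ig := continuous_integrable (continuous_on_time_within sT cg).
  exact: integrableS ig.
rewrite log_massB// -RintegralZl//; last exact: iS.
apply: le_Rintegral => //.
- by apply: iS; exact: mass_continuous cf.
- by apply: iS; apply: continuous_on_timeM => //; move=> t It; exact: cvg_cst.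
move=> t /=; rewrite in_itv/= => /andP[t1 t2].
have t0 : 0 <= t by rewrite (le_trans _ t1)// expR_ge0.
have It := before t0 t2 sT.
rewrite /N mulrA ler_peMl ?mass0//.
have t10 : 0 < 1 + t by rewrite ltr_wpDr.
rewrite powRN -powRM ?expR_ge0 ?(ltW E0)// ler_pdivlMr ?powR_gt0// mul1r.
apply: powR_le => //; first exact: ltW.
have : expR (s + d) <= expR 1 * expR s by rewrite -expRD ler_expR addrC lerD2r.
rewrite mulrDl mul1r; lra.
Qed.

End log_mass.

Lemma powR_compose_le (R : realType) (p q Z D a I C dq b J W c Q M : R) : 0 < q ->
  0 <= D -> 0 <= a -> 0 <= I -> 0 <= C -> 0 <= dq -> 0 <= b -> 0 <= W -> 0 <= Q ->
  Z `^ p <= D * a * I -> I `^ q <= C * dq * b * J -> J <= W * c * Q -> a `^ q * (b * c) <= M ->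
  Z `^ (p * q) <= C * W * M * dq * D `^ q * Q.
Proof.
move=> q0 D0 a0 I0 C0 d0 b0 W0 Q0 ZI IJ JQ abc.
rewrite powRrM; apply: le_trans (powR_le (ltW q0) (powR_ge0 _ _) ZI) _.
rewrite powRM ?mulr_ge0// (powRM q D0 a0).
have c1 : 0 <= D `^ q * a `^ q by rewrite mulr_ge0 ?powR_ge0.
have c2 : 0 <= C * dq * b by rewrite !mulr_ge0.
apply: le_trans (ler_wpM2l c1 (le_trans IJ (ler_wpM2l c2 JQ))) _.
have c3 : 0 <= C * W * dq * D `^ q * Q by rewrite !mulr_ge0 ?powR_ge0.
have := ler_wpM2l c3 abc; congr (_ <= _); ring.
Qed.

Section growth.
Variables (R : realType) (n : nat) (r p q : R).
Hypotheses (n2 : (2 < n)%N) (r0 : 0 <= r) (p1 : 1 < p) (q1 : 1 < q).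

Let nu : R := (n%:R - 1) / 2.
Let beta : R := nu - p^-1.
Let e1 : R := nu * p - n%:R.

Let n1 : (1 < n)%N. Proof. exact: ltnW. Qed.
Let p0 : 0 < p. Proof. by rewrite (lt_trans _ p1). Qed.
Let q0 : 0 < q. Proof. by rewrite (lt_trans _ q1). Qed.

Let nu1 : 1 <= nu.
Proof.
rewrite /nu ler_pdivlMr// mul1r lerBrDr.
have : (3%:R : R) <= n%:R by rewrite ler_nat.
by lra.
Qed.

Let beta0 : 0 <= beta.
Proof. by rewrite /beta subr_ge0 (le_trans _ nu1)// invf_le1// ltW. Qed.

Let expR_powRD (a b : R) (c : R) : expR (a + b) `^ c = expR a `^ c * expR b `^ c.
Proof. by rewrite -powRM ?expR_ge0// -expRD. Qed.

Let expR_powR_le (d c : R) : 0 < d <= 1 -> expR d `^ c <= expR `|c|.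
Proof.
move=> /andP[d0 d1]; rewrite -expRM ler_expR (le_trans (ler_norm _))// normrM.
by rewrite ler_piMl// gtr0_norm.
Qed.

Let expR_ge1 (s : R) : 0 <= s -> 1 <= expR s.
Proof. by move=> s0; rewrite -[leLHS]expR0 ler_expR. Qed.

Let initial_ge0 T v vt h : (0 < T)%E -> nonneg_wave r p T v vt h ->
  0 <= slice_pairing vt (@cone_weight R n (- nu) (r + 2)) 0.
Proof.
move=> T0 Wv.
have psi0 (x : 'rV[R]_n) : enorm x <= r -> 0 <= cone_weight (- nu) (r + 2) (x, 0) /\
    dt (cone_weight (- nu) (r + 2)) (x, 0) <= 0.
  move=> xr; have xr0 : enorm x <= 0 + r by rewrite add0r.
  split; first by rewrite (cone_weightE _ _ _ xr0)// powR_ge0.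
  by rewrite (dt_cone_weight_le0 r0)// oppr_le0 (le_trans ler01).
by have /andP[] := initial_pairing_ge T0 Wv (SE_cone_weight n (- nu) (r + 2)) psi0.
Qed.

Section system.
Hypothesis critical : nu * (p * q - 1) = q + 2 + p^-1.

(** Power of the time scale from the free inequality, plus [beta] for reinserting the weight of
    [log_mass]. *)
Let e2 : R := (n%:R + 1) * (q - 1) - 2 * q + beta.

(** The left-hand side equals [nu * (p * q - 1) - (q + 2 + p^-1)]: the critical relation states that
    the composed inequality is scale invariant. *)
Let e12 : e1 * q + e2 = 0.
Proof.
have -> : e1 * q + e2 = nu * (p * q - 1) - (q + 2 + p^-1) by rewrite /e1 /e2 /beta /nu; field;
  rewrite gt_eqF.
by rewrite critical subrr.
Qed.

Let exp_cancel s d : 0 < d <= 1 -> (expR s `^ e1) `^ q *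
  (expR (s + d) `^ ((n%:R + 1) * (q - 1) - 2 * q) * expR (s + d) `^ beta) <= expR `|e2|.
Proof.
move=> d01; have pD (a b c : R) : expR a `^ b * expR a `^ c = expR a `^ (b + c).
  by rewrite -powRD_gt0 ?expR_gt0.
by rewrite pD -/e2 expR_powRD -powRrM mulrA pD e12 powRr0 mul1r expR_powR_le.
Qed.

(** Used twice, with [Z] the logarithmic mass and with [Z] the pairing of the initial velocity. A
    bound through [|v|^p] on the first interval of length [d] is passed on by the free inequality to
    [|u|^q] on the next one, hence the total length [2 * d]. *)
Let chain : exists2 C : R, 0 < C & forall T u ut v vt (Z D s d : R), (0 < T)%E ->
  nonneg_wave r p T v vt (fun t x => `|u t x| `^ q) ->
  nonneg_wave r q T u ut (fun t (x : 'rV[R]_n) => `|v t x| `^ p) ->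
  0 <= Z -> 0 <= D -> 0 <= s -> 0 < d <= 1 -> ((expR (s + 2 * d))%:E < T)%E ->
  Z `^ p <= D * expR s `^ e1 * \int[lebesgue_measure]_(t in `[expR s, expR (s + d)])
    mass (fun t x => `|v t x| `^ p) t ->
  Z `^ (p * q) <= C * d `^ (- (2 * q)) * D `^ q *
    (log_mass beta (fun t x => `|u t x| `^ q) (s + 2 * d) - log_mass beta (fun t x => `|u t x|
      `^ q) s).
Proof.
have [C C0 HC] := free_mass_inequality n1 r0 q1.
have E0 : 0 < 1 + expR 1 :> R by rewrite addr_gt0 ?expR_gt0.
exists (C * (1 + expR 1) `^ beta * expR `|e2|); first by rewrite !mulr_gt0 ?powR_gt0 ?expR_gt0.
move=> T u ut v vt Z D s d T0 Wv Wu Z0 D0 s0 d01 sdT ZD; have /andP[d0 d1] := d01.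
have cfu := nonneg_wave_powR Wu; have cfv := nonneg_wave_powR Wv.
set fu := (fun t x => `|u t x| `^ q) in cfu Wv *;
  set fv := (fun t x => `|v t x| `^ p) in cfv Wu ZD *.
have fu0 t x : time_interval T t -> 0 <= fu t x by move=> _; exact: powR_ge0.
have fv0 t x : 0 <= fv t x by exact: powR_ge0.
have s2 : s + 2 * d = s + d + d by ring.
rewrite s2 in sdT *; set s' := s + d in sdT *.
have s'0 : 0 <= s' by rewrite addr_ge0// ltW.
have s'T : ((expR s')%:E < T)%E by apply: le_lt_trans sdT; rewrite lee_fin ler_expR lerDl ltW.
set I := \int[lebesgue_measure]_(t in `[0, expR s']) mass fv t.
have cM := mass_continuous r0 cfv.
have intM0 a b : 0 <= \int[lebesgue_measure]_(t in `[a, b]) mass fv t.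
  by apply: Rintegral_ge0 => // t _; apply: Rintegral_ge0 => x _; exact: fv0.
have ZI : Z `^ p <= D * expR s `^ e1 * I.
  apply: le_trans ZD _; rewrite ler_wpM2l ?mulr_ge0 ?powR_ge0//.
  by rewrite -(time_integralB cM) ?expR_ge0 ?ler_expR ?lerDl ?(ltW d0)// gerBl intM0.
have Iq : I `^ q <= C * d `^ (- (2 * q)) * (expR s' `^ ((n%:R + 1) * (q - 1) - 2 * q)) *
    \int[lebesgue_measure]_(t in `[expR s', expR (s' + d)]) mass fu t.
  have := HC T u ut fv (expR s') d T0 Wu (expR_ge1 s'0) d01.
  by rewrite -expRD addrC addrC [d + s']addrC => /(_ sdT).
have ann := mass_annulus_le r0 beta0 cfu fu0 s'0 d01 sdT.
have Lle : log_mass beta fu (s' + d) - log_mass beta fu s' <=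
    log_mass beta fu (s' + d) - log_mass beta fu s.
  rewrite lerD2l lerN2; apply: (log_mass_le beta r0 cfu fu0 _ s'T).
  by rewrite lerDl ltW.
have L0 : 0 <= log_mass beta fu (s' + d) - log_mass beta fu s'.
  by rewrite subr_ge0; apply: (log_mass_le beta r0 cfu fu0 _ sdT); rewrite lerDl ltW.
have W0 : 0 <= (1 + expR 1) `^ beta by exact: powR_ge0.
apply: (powR_compose_le q0 D0 (powR_ge0 _ _) (intM0 _ _) (ltW C0) (powR_ge0 _ _) (powR_ge0 _ _)
  W0 (le_trans L0 Lle) ZI Iq _ (exp_cancel s d01)).
exact: le_trans ann (ler_wpM2l (mulr_ge0 W0 (powR_ge0 _ _)) Lle).
Qed.

Lemma system_growth : exists C m : R, [/\ 0 < C, 0 < m & forall T u ut v vt, (0 < T)%E ->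
  nonneg_wave r p T v vt (fun t x => `|u t x| `^ q) ->
  nonneg_wave r q T u ut (fun t (x : 'rV[R]_n) => `|v t x| `^ p) ->
  let L := log_mass beta (fun t x => `|u t x| `^ q) in
  (forall s d : R, 0 <= s -> 0 < d <= 1 -> ((expR (s + d))%:E < T)%E ->
    L s `^ (p * q) <= C * d `^ (- m) * (1 + s) `^ (q * (p - 1)) * (L (s + d) - L s)) /\
  (forall s : R, 0 <= s -> ((expR (s + 2))%:E < T)%E ->
    slice_pairing vt (cone_weight (- nu) (r + 2)) 0 `^ (p * q) <= C * (L (s + 2) - L s))].
Proof.
have [C C0 HC] := chain.
have [C1 C10 HC1] := weighted_mass_inequality n1 r0 p1.
have [C3 C30 HC3] := initial_mass_inequality n1 r0 p1 n2.
(* The free inequality loses [d^(-2q)]; the weighted one loses [d^(-2p)], raised to the power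
   [q]. *)
pose m : R := 2 * q + 2 * p * q.
have m0 : 0 < m by rewrite /m addr_gt0 ?mulr_gt0.
exists (C * (C1 `^ q * 2 `^ m + C3 `^ q)), m; split=> //.
  by rewrite mulr_gt0// addr_gt0// ?mulr_gt0 ?powR_gt0.
move=> T u ut v vt T0 Wv Wu.
have cfu := nonneg_wave_powR Wu; have Hcv := nonneg_wave_curve Wv.
set fu := (fun t x => `|u t x| `^ q) in cfu Wv Hcv *; move=> L.
have fu0 t x : time_interval T t -> 0 <= fu t x by move=> _; exact: powR_ge0.
have Lle s t : s <= t -> ((expR t)%:E < T)%E -> L s <= L t by exact: (log_mass_le beta r0 cfu fu0).
split.
  move=> s d s0 d01 sT; have /andP[d0 d1] := d01.
  pose d' := d / 2; have d'01 : 0 < d' <= 1 by apply/andP; rewrite /d'; split; lra.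
  have dd : d = 2 * d' by rewrite /d'; field.
  have d'E : d' = d / 2 by []; clearbody d'.
  have d'0 : 0 < d' by case/andP: d'01.
  have sT' : ((expR (s + d'))%:E < T)%E.
    by apply: le_lt_trans sT; rewrite lee_fin ler_expR lerD2l dd; lra.
  have s1T : ((expR s)%:E < T)%E.
    by apply: le_lt_trans sT'; rewrite lee_fin ler_expR lerDl ltW.
  have L0 : 0 <= L s by exact: (log_mass_ge0 beta fu0 s1T).
  pose D := C1 * d' `^ (- (2 * p)) * (1 + s) `^ (p - 1).
  have D0 : 0 <= D by rewrite !mulr_ge0 ?powR_ge0// ltW.
  have := HC T u ut v vt (L s) D s d' T0 Wv Wu L0 D0 s0 d'01.
  rewrite -dd => /(_ sT) h.
  apply: le_trans (h _) _.
    have := HC1 T v vt fu (expR s) d' T0 Wv (expR_ge1 s0) d'01.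
    rewrite -expRD [d' + s]addrC => /(_ sT'); rewrite expRK -/e1 => h1.
    apply: le_trans h1 _.
    by rewrite /D; apply: eq_leW; ring.
  have LL0 : 0 <= L (s + d) - L s by rewrite subr_ge0 Lle// lerDl ltW.
  rewrite ler_wpM2r//.
  have s10 : 0 <= 1 + s by rewrite addr_ge0.
  have -> : D `^ q = C1 `^ q * d' `^ (- (2 * p * q)) * (1 + s) `^ (q * (p - 1)).
    rewrite /D !powRM ?mulr_ge0 ?powR_ge0 ?(ltW C10)// -!powRrM.
    by congr (_ * _ `^ _ * _ `^ _); ring.
  have dm : d' `^ (- (2 * q)) * d' `^ (- (2 * p * q)) = 2 `^ m * d `^ (- m).
    rewrite -powRD_gt0//.
    rewrite d'E powRM ?(ltW d0) ?invr_ge0// powRVl// mulrC.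
    by congr (_ `^ _ * _ `^ _); rewrite /m; ring.
  rewrite (_ : _ * _ = C * (C1 `^ q * (d' `^ (- (2 * q)) * d' `^ (- (2 * p * q)))) *
    (1 + s) `^ (q * (p - 1))); last by ring.
  rewrite dm ler_wpM2r ?powR_ge0// -mulrA ler_wpM2l ?(ltW C0)//.
  by rewrite mulrA ler_wpM2r ?powR_ge0// lerDl powR_ge0.
move=> s s0 sT.
have T1 : ((expR 1 * expR s)%:E < T)%E.
  by apply: le_lt_trans sT; rewrite lee_fin -expRD ler_expR; lra.
have G0 := initial_ge0 T0 Wv.
set G := slice_pairing _ _ _ in G0 *.
(* For the data both steps of [chain] have length 1 and together cover [[s, s + 2]]. *)
have d01 : 0 < (1 : R) <= 1 by rewrite ltr01 lexx.
have := HC T u ut v vt G C3 s 1 T0 Wv Wu G0 (ltW C30) s0 d01.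
rewrite mulr1 powR1 mulr1 => /(_ sT) h.
apply: le_trans (h _) _.
  have es : expR 1 * expR s = expR (s + 1) by rewrite -expRD addrC.
  by have := HC3 T v vt fu (expR s) T0 Wv (expR_ge1 s0) T1; rewrite es => k; exact: k.
have LL0 : 0 <= L (s + 2) - L s by rewrite subr_ge0 Lle// lerDl.
rewrite ler_wpM2r// ler_wpM2l ?(ltW C0)// lerDr mulr_ge0 ?powR_ge0//.
Qed.

End system.

Section equal_exponents.
Hypothesis critical : nu * (p * p - 1) = p + 2 + p^-1.

(** For equal exponents the critical relation factors as [(p + 1) * (e1 + beta) = 0]. The weighted
    inequality alone is therefore scale invariant, without recourse to the free one. *)
Let e1_beta : e1 + beta = 0.
Proof.
have : (p + 1) * (e1 + beta) = nu * (p * p - 1) - (p + 2 + p^-1).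
  by rewrite /e1 /beta /nu; field; rewrite gt_eqF.
rewrite critical subrr => /eqP; rewrite mulf_eq0 => /orP[|/eqP//].
by rewrite gt_eqF// addr_gt0.
Qed.

Let annulus_log_mass T (v vt h : R -> 'rV[R]_n -> R) (s d : R) : nonneg_wave r p T v vt h ->
  0 <= s -> 0 < d <= 1 -> ((expR (s + d))%:E < T)%E ->
  expR s `^ e1 * \int[lebesgue_measure]_(t in `[expR s, expR (s + d)])
     mass (fun t x => `|v t x| `^ p) t <=
  (1 + expR 1) `^ beta * (log_mass beta (fun t x => `|v t x| `^ p) (s + d) -
    log_mass beta (fun t x => `|v t x| `^ p) s).
Proof.
move=> Wv s0 d01 sT; have cfv := nonneg_wave_powR Wv.
set fv := (fun t x => `|v t x| `^ p) in cfv *.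
have fv0 t x : time_interval T t -> 0 <= fv t x by move=> _; exact: powR_ge0.
have XI := ler_wpM2l (powR_ge0 (expR s) e1) (mass_annulus_le r0 beta0 cfv fv0 s0 d01 sT).
have XY : expR s `^ e1 * expR s `^ beta = 1.
  by rewrite -powRD_gt0 ?expR_gt0// e1_beta powRr0.
move: (Rintegral _ _ _) (log_mass beta fv (s + d) - log_mass beta fv s) ((1 + expR 1) `^ beta)
  (expR s `^ e1) (expR s `^ beta) XY XI => I Q W X Y XY XI.
apply: le_trans XI _; rewrite (_ : X * _ = X * Y * (W * Q)); last by ring.
by rewrite XY mul1r.
Qed.

Let log_mass_growth : exists2 C : R, 0 < C & forall T (f v vt : R -> 'rV[R]_n -> R) (s d : R),
  (0 < T)%E -> nonneg_wave r p T v vt f -> 0 <= s -> 0 < d <= 1 -> ((expR (s + d))%:E < T)%E ->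
  log_mass beta f s `^ p <= C * d `^ (- (2 * p)) * (1 + s) `^ (p - 1) *
    (log_mass beta (fun t x => `|v t x| `^ p) (s + d) - log_mass beta (fun t x => `|v t x| `^ p) s).
Proof.
have [C1 C10 HC1] := weighted_mass_inequality n1 r0 p1.
exists (C1 * (1 + expR 1) `^ beta); first by rewrite mulr_gt0 ?powR_gt0// addr_gt0 ?expR_gt0.
move=> T f v vt s d T0 Wv s0 d01 sT.
have es : expR d * expR s = expR (s + d) by rewrite -expRD addrC.
have := HC1 T v vt f (expR s) d T0 Wv (expR_ge1 s0) d01; rewrite es expRK => /(_ sT) h1.
apply: le_trans h1 _; rewrite -/e1.
have := annulus_log_mass Wv s0 d01 sT.
move: (Rintegral _ _ _) (_ - _) ((1 + expR 1) `^ beta) (expR s `^ e1) => I Q W X XI.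
have c0 : 0 <= C1 * d `^ (- (2 * p)) * (1 + s) `^ (p - 1) by rewrite !mulr_ge0 ?powR_ge0// ltW.
have := ler_wpM2l c0 XI; congr (_ <= _); ring.
Qed.

Let powR_sum_le (a b : R) : 0 <= a -> 0 <= b -> (a + b) `^ p <= 2 `^ p * (a `^ p + b `^ p).
Proof.
move=> a0 b0; have [ab|/ltW ab] := leP a b.
  apply: (@le_trans _ _ ((2 * b) `^ p)).
    by apply: powR_le; rewrite ?(ltW p0) ?addr_ge0//; lra.
  by rewrite powRM// ler_wpM2l ?powR_ge0// lerDr powR_ge0.
apply: (@le_trans _ _ ((2 * a) `^ p)).
  by apply: powR_le; rewrite ?(ltW p0) ?addr_ge0//; lra.
by rewrite powRM// ler_wpM2l ?powR_ge0// lerDl powR_ge0.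
Qed.

(** The composed inequality would only give the exponent [p(p^2-1)] in the lifespan. Here the
    weighted inequality bounds each logarithmic mass by the growth of the other, and their sum
    satisfies a closed inequality with exponent [p]. *)
Lemma equal_exponents_growth : exists2 C : R, 0 < C & forall T u ut v vt, (0 < T)%E ->
  nonneg_wave r p T v vt (fun t x => `|u t x| `^ p) ->
  nonneg_wave r p T u ut (fun t (x : 'rV[R]_n) => `|v t x| `^ p) ->
  let L s := log_mass beta (fun t x => `|u t x| `^ p) s + log_mass beta (fun t x => `|v t x| `^
    p) s in
  (forall s d : R, 0 <= s -> 0 < d <= 1 -> ((expR (s + d))%:E < T)%E ->
    L s `^ p <= C * d `^ (- (2 * p)) * (1 + s) `^ (p - 1) * (L (s + d) - L s)) /\
  (forall s : R, 0 <= s -> ((expR (s + 2))%:E < T)%E ->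
    slice_pairing vt (cone_weight (- nu) (r + 2)) 0 `^ p <= C * (L (s + 2) - L s)).
Proof.
have [C1 C10 HC1] := log_mass_growth.
have [C3 C30 HC3] := initial_mass_inequality n1 r0 p1 n2.
set W : R := (1 + expR 1) `^ beta; have W0 : 0 <= W := powR_ge0 _ _.
exists (2 `^ p * C1 + C3 * W).
  by rewrite ltr_wpDr ?mulr_ge0 ?(ltW C30)// mulr_gt0// powR_gt0.
move=> T u ut v vt T0 Wv Wu.
have cfu := nonneg_wave_powR Wu; have cfv := nonneg_wave_powR Wv.
set fu := (fun t x => `|u t x| `^ p) in Wv cfu *.
set fv := (fun t x => `|v t x| `^ p) in Wu cfv *.
have fu0 t x : time_interval T t -> 0 <= fu t x by move=> _; exact: powR_ge0.
have fv0 t x : time_interval T t -> 0 <= fv t x by move=> _; exact: powR_ge0.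
move=> L.
split.
  move=> s d s0 d01 sT; have /andP[d0 d1] := d01.
  have sd : s <= s + d by rewrite lerDl ltW.
  have s1T : ((expR s)%:E < T)%E by apply: le_lt_trans sT; rewrite lee_fin ler_expR.
  have hv := HC1 T fu v vt s d T0 Wv s0 d01 sT; have hu := HC1 T fv u ut s d T0 Wu s0 d01 sT.
  have hs := powR_sum_le (log_mass_ge0 beta fu0 s1T) (log_mass_ge0 beta fv0 s1T).
  have l1 := log_mass_le beta r0 cfu fu0 sd sT; have l2 := log_mass_le beta r0 cfv fv0 sd sT.
  rewrite /L; move: (log_mass beta fu s) (log_mass beta fu (s + d)) (log_mass beta fv s)
    (log_mass beta fv (s + d)) hs hv hu l1 l2 => a1 a2 b1 b2 hs hv hu l1 l2.
  have D0 : 0 <= a2 + b2 - (a1 + b1) by rewrite subr_ge0 lerD.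
  apply: le_trans hs (le_trans (ler_wpM2l (powR_ge0 2 p) (lerD hv hu)) _).
  apply: (@le_trans _ _ (2 `^ p * C1 * d `^ (- (2 * p)) * (1 + s) `^ (p - 1) * (a2 + b2 - (a1 +
    b1)))).
    by apply: eq_leW; ring.
  apply: ler_wpM2r => //; apply: ler_wpM2r; first exact: powR_ge0.
  apply: ler_wpM2r; first exact: powR_ge0.
  by rewrite lerDl mulr_ge0// ltW.
move=> s s0 sT.
have es : expR 1 * expR s = expR (s + 1) by rewrite -expRD addrC.
have s1T : ((expR (s + 1))%:E < T)%E.
  by apply: le_lt_trans sT; rewrite lee_fin ler_expR lerD2l ler1n.
have d01 : 0 < (1 : R) <= 1 by rewrite ltr01 lexx.
have hv := annulus_log_mass Wv s0 d01 s1T.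
have := HC3 T v vt fu (expR s) T0 Wv (expR_ge1 s0); rewrite es => /(_ s1T) h.
have ss1 : s <= s + 1 by rewrite lerDl.
have ss2 : s + 1 <= s + 2 by rewrite lerD2l ler1n.
have l1 := log_mass_le beta r0 cfu fu0 (le_trans ss1 ss2) sT.
have l2 := log_mass_le beta r0 cfv fv0 ss2 sT.
have l3 := log_mass_le beta r0 cfv fv0 ss1 s1T.
apply: le_trans h _; rewrite -/e1 -mulrA.
apply: le_trans (ler_wpM2l (ltW C30) hv) _; rewrite /L -/W -/fv.
move: (log_mass beta fu s) (log_mass beta fu (s + 2)) (log_mass beta fv s)
  (log_mass beta fv (s + 1)) (log_mass beta fv (s + 2)) l1 l2 l3 => a1 a2 b1 b2 b3 l1 l2 l3.
rewrite mulrA mulrDl; apply: ler_wpDl.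
  by rewrite mulr_ge0 ?mulr_ge0 ?powR_ge0 ?(ltW C10)// subr_ge0 lerD// (le_trans l3).
apply: ler_wpM2l; first by rewrite mulr_ge0// ltW.
by rewrite opprD addrACA; apply: ler_wpDl; rewrite ?subr_ge0// lerD2r.
Qed.

End equal_exponents.

End growth.

(** * Lifespan *)

Section lifespan.
Variable R : realType.

Lemma lifespan_from_bound (kap rho sig C0 b0 : R) : 0 < rho -> 0 <= kap -> 0 <= sig -> 0 < C0 ->
  0 < b0 -> exists2 Cf : R, 0 < Cf & forall (eps : R) (T : \bar R), 0 < eps <= 1 ->
  (forall K : nat, (0 < K)%N -> ((expR (3 * K%:R))%:E < T)%E ->
    K%:R `^ rho * (b0 * eps `^ sig) `^ kap <= C0) ->
  (T <= (expR (Cf * eps `^ (- (sig * kap / rho))))%:E)%E.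
Proof.
move=> rho0 kap0 sig0 C00 b00.
have bk : 0 < b0 `^ kap by exact: powR_gt0.
pose y := 2 * C0 / b0 `^ kap; have y0 : 0 < y by rewrite divr_gt0// mulr_gt0.
pose k0 := y `^ rho^-1 + 1; have k01 : 1 <= k0 by rewrite lerDr powR_ge0.
have k00 : 0 < k0 by rewrite (lt_le_trans _ k01).
exists (6 * k0); first by rewrite mulr_gt0.
move=> eps T /andP[e0 e1] HK; set x := eps `^ _.
have x1 : 1 <= x.
  rewrite /x powRN invf_ge1 ?powR_gt0// (_ : 1 = 1 `^ (sig * kap / rho)); last by rewrite powR1.
  by apply: powR_le => //; rewrite ?(ltW e0)// divr_ge0 ?mulr_ge0// ltW.
have x0 : 0 < x by rewrite (lt_le_trans _ x1).
rewrite leNgt; apply/negP => xT.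
have kx1 : 1 <= k0 * x by rewrite -[leLHS]mulr1 ler_pM.
have kx0 : 0 <= 2 * (k0 * x) by rewrite mulr_ge0// (le_trans ler01).
(* As [1 <= k0 * x], rounding [2 * (k0 * x)] down leaves an integer of at least [k0 * x]. The value
   [3 * K%:R <= 6 * k0 * x] explains the constant [6 * k0]. *)
have /andP[t1 t2] := truncn_itv kx0; set K := Num.truncn _ in t1 t2.
have Kge : k0 * x <= K%:R by move: t2; rewrite -natr1; lra.
have K0 : (0 < K)%N by rewrite -(ltr_nat R) (lt_le_trans _ Kge)// (lt_le_trans ltr01).
have KT : ((expR (3 * K%:R))%:E < T)%E.
  by apply: le_lt_trans xT; rewrite lee_fin ler_expR; lra.
have := HK K K0 KT; apply/negP; rewrite -ltNge.
apply: (@lt_le_trans _ _ ((k0 * x) `^ rho * (b0 * eps `^ sig) `^ kap)); last first.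
  by rewrite ler_wpM2r ?powR_ge0//; apply: powR_le => //; rewrite ?(ltW rho0)// mulr_ge0// ltW.
rewrite !powRM ?powR_ge0 ?(ltW k00) ?(ltW x0) ?(ltW b00)// /x -!powRrM.
rewrite [X in _ < X](_ : _ = k0 `^ rho * b0 `^ kap *
  (eps `^ (- (sig * kap / rho) * rho) * eps `^ (sig * kap))); last by ring.
rewrite -powRD_gt0//.
rewrite (_ : _ + _ = 0) ?powRr0 ?mulr1; last by field; rewrite gt_eqF.
rewrite -ltr_pdivrMr//; apply: (@lt_le_trans _ _ y).
  by rewrite /y ltr_pM2r ?invr_gt0// ltr_pMl// ltr1n.
have -> : y = (y `^ rho^-1) `^ rho by rewrite -powRrM mulVf ?powRr1 ?gt_eqF// ltW.
by apply: powR_le; rewrite ?(ltW rho0) ?powR_ge0// lerDl.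
Qed.

(** With data of size [eps^sig], [blowup_bound] limits [K^(kap-mu) eps^(sig(kap-1))]; solving for
    [K], a multiple of the logarithm of the lifespan, yields the exponent. *)
Lemma lifespan_from_growth (kap mu m sig C c : R) : 1 < kap -> 0 <= mu < kap -> 0 < m ->
  0 <= sig -> 0 < C -> 0 < c -> exists2 Cf : R, 0 < Cf &
  forall (eps : R) (T : \bar R) (L : R -> R), 0 < eps <= 1 ->
  (forall s, ((expR s)%:E < T)%E -> 0 <= L s) ->
  (forall s t, s <= t -> ((expR t)%:E < T)%E -> L s <= L t) ->
  (forall s d, 0 <= s -> 0 < d <= 1 -> ((expR (s + d))%:E < T)%E ->
    L s `^ kap <= C * d `^ (- m) * (1 + s) `^ mu * (L (s + d) - L s)) ->
  (forall s, 0 <= s -> ((expR (s + 2))%:E < T)%E -> (eps * c) `^ sig <= C * (L (s + 2) - L s)) ->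
  (T <= (expR (Cf * eps `^ (- (sig * (kap - 1) / (kap - mu)))))%:E)%E.
Proof.
move=> k1 /andP[mu0 muk] m0 sig0 C0 c0.
have [C2 C20 HC2] := blowup_bound k1 mu0 m0 C0.
have b00 : 0 < c `^ sig / C by rewrite divr_gt0// powR_gt0.
have rho0 : 0 < kap - mu by rewrite subr_gt0.
have k10 : 0 <= kap - 1 by rewrite subr_ge0 ltW.
have [Cf Cf0 HCf] := lifespan_from_bound rho0 k10 sig0 C20 b00.
exists Cf => // eps T L e01 L0 Lmon Lgrow Linit; have /andP[e0 e1] := e01.
apply: HCf => // K K0 KT.
have before s : s <= 3 * K%:R -> ((expR s)%:E < T)%E.
  by move=> sK; apply: le_lt_trans KT; rewrite lee_fin ler_expR.
apply: (HC2 L) => //.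
- by rewrite mulr_gt0// powR_gt0.
- by apply: L0; apply: before; rewrite mulr_ge0.
- by move=> s t _ st tK; apply: Lmon => //; exact: before.
- by move=> s d s0 d01 sK; apply: Lgrow => //; exact: before.
- move=> s s0 sK; have := Linit s s0 (before _ sK).
  rewrite powRM ?(ltW e0) ?(ltW c0)// => h.
  by rewrite mulrAC ler_pdivrMr// mulrC [X in _ <= X]mulrC.
Qed.

End lifespan.

(** * The critical relation and the conclusion *)

Section critical_exponent.
Variables (R : realType) (n : nat) (p q : R).
Hypotheses (n4 : (4 <= n)%N) (p1 : 1 < p) (pq : p <= q) (F0 : F p q n = 0).

Lemma critical_curve : (n%:R - 1) / 2 * (p * q - 1) = q + 2 + p^-1.
Proof.
have p0 : 0 < p by rewrite (lt_trans _ p1).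
have q0 : 0 < q by rewrite (lt_le_trans p0).
have pq1 : 0 < p * q - 1 by rewrite subr_gt0 mulr_egt1// (lt_le_trans p1).
move: F0; rewrite /F => /eqP; rewrite subr_eq0 => /eqP <-.
rewrite max_l; first by rewrite divfK// gt_eqF.
have pqi : q^-1 <= p^-1 by rewrite lef_pV2.
by rewrite ler_wpM2r ?invr_ge0 ?(ltW pq1)// lerD// lerD2r.
Qed.

(** From [n >= 4] one has [(n-1)/2 >= 3/2]. If [p > 2], the critical relation would give
    [3/2 * (2 * q - 1) <= q + 5/2], that is [q <= 2], contradicting [p <= q]. *)
Lemma exponent_le2 : p <= 2.
Proof.
have p0 : 0 < p by rewrite (lt_trans _ p1).
have n4R : (4%:R : R) <= n%:R by rewrite ler_nat.
have nu : 3 / 2 <= (n%:R - 1) / 2 :> R by rewrite ler_wpM2r ?invr_ge0//; lra.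
rewrite leNgt; apply/negP => p2.
have q2 : 2 < q by exact: lt_le_trans pq.
have pi : p^-1 <= 2^-1 by rewrite lef_pV2 ?posrE// ltW.
have pq2 : 2 * q <= p * q by rewrite ler_wpM2r; lra.
have pq1 : 0 <= p * q - 1 by lra.
have := ler_wpM2r pq1 nu; rewrite critical_curve.
clear - pq2 pi q2; move: (p * q) (p^-1) pq2 pi => z i pq2 pi h; lra.
Qed.

End critical_exponent.

Lemma solution_waves (R : realType) (n : nat) (p q r eps : R) (f1 g1 f2 g2 : 'rV[R]_n -> R)
    (T : \bar R) (u v ut vt : R -> 'rV[R]_n -> R) :
  (0 < n)%N -> 0 <= r -> 1 < p -> p <= 2 -> 1 < q -> 0 < eps -> (0 < T)%E ->
  {ae lebesgue_rV R n, forall x, [/\ 0 <= f1 x, 0 <= f2 x, 0 <= g1 x & 0 <= g2 x]} ->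
  solution p q r eps f1 g1 f2 g2 T u v ut vt ->
  nonneg_wave r p T (trunc r v) (trunc r vt) (fun t x => `|trunc r u t x| `^ q) /\
  nonneg_wave r q T (trunc r u) (trunc r ut) (fun t x => `|trunc r v t x| `^ p).
Proof.
move=> n0 r0 p1 p2 q1 e0 T0 data_ge0
  [uH uq vH ut2 vt2 du dv eu ev iu0 iut0 iv0 ivt0 ssupp].
have u2 := continuous_in_H1_L2 uH; have v2 := continuous_in_H1_L2 vH.
have supp_of w : supp T w `<=` supp T u `|` supp T v `|` supp T ut `|` supp T vt ->
    forall t, time_interval T t -> {ae lebesgue_rV R n, forall x, t + r < enorm x -> w t x = 0}.
  by move=> sw t It; exact: (supp_ae It (subset_trans sw ssupp)).
have {supp_of} [su sv sut svt] := And4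
  (supp_of u (fun z h => or_introl (or_introl (or_introl h))))
  (supp_of v (fun z h => or_introl (or_introl (or_intror h))))
  (supp_of ut (fun z h => or_introl (or_intror h))) (supp_of vt (fun z h => or_intror h)).
have I0 : time_interval T 0 by split.
split.
- apply: (nonneg_wave_trunc n0 r0 _ _ v2 v2 vt2 uq sv svt su dv ev).
  + by rewrite (ltW p1).
  + by rewrite (ltW q1) lexx.
  + apply: filterS3 data_ge0 iv0 ivt0 => x [h1 h2 h3 h4] -> ->.
    by rewrite !mulr_ge0 ?(ltW e0).
- apply: (nonneg_wave_trunc n0 r0 _ _ u2 uq ut2 v2 su sut sv du eu).
  + by rewrite (ltW q1) lexx.
  + by rewrite (ltW p1).
  + apply: filterS3 data_ge0 iu0 iut0 => x [h1 h2 h3 h4] -> ->.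
    by rewrite !mulr_ge0 ?(ltW e0).
Qed.

Theorem theorem1 (R : realType) (n : nat) (p q r : R)
    (f1 g1 f2 g2 : 'rV[R]_n -> R)
    (n_ge4 : (4 <= n)%N) (p_gt1 : 1 < p) (le_pq : p <= q)
    (F0 : F p q n = 0)
    (r_gt0 : 0 < r)
    (f1_H1 : H1 f1) (f1_Lq : Lp q f1) (g1_L2 : Lp 2 g1)
    (f2_H1 : H1 f2) (g2_L2 : Lp 2 g2)
    (data_support : {ae lebesgue_rV R n, forall x, r < enorm x ->
       [/\ f1 x = 0, f2 x = 0, g1 x = 0 & g2 x = 0]})
    (data_ge0 : {ae lebesgue_rV R n, forall x,
       [/\ 0 <= f1 x, 0 <= f2 x, 0 <= g1 x & 0 <= g2 x]})
    (g1_neq0 : ~ {ae lebesgue_rV R n, forall x, g1 x = 0})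
    (g2_neq0 : ~ {ae lebesgue_rV R n, forall x, g2 x = 0}) :
  exists eps0 C : R, [/\ 0 < eps0, 0 < C &
    forall (eps : R) (T : \bar R) (u v ut vt : R -> 'rV[R]_n -> R),
      0 < eps <= eps0 -> (0 < T)%E ->
      solution p q r eps f1 g1 f2 g2 T u v ut vt ->
      (T <= (if p != q then expR (C * eps `^ (- (p * (p * q - 1))))
             else expR (C * eps `^ (- (p * (p - 1)))))%:E)%E].
Proof.
have r0 := ltW r_gt0; have n0 : (0 < n)%N by exact: leq_trans n_ge4.
have n2 : (2 < n)%N by exact: leq_trans n_ge4.
have p0 : 0 < p by rewrite (lt_trans _ p_gt1).
have q1 : 1 < q by rewrite (lt_le_trans p_gt1).
have q0 : 0 < q by rewrite (lt_trans _ q1).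
have crit := critical_curve p_gt1 le_pq F0.
have p2 := exponent_le2 n_ge4 p_gt1 le_pq F0.
have g2supp : {ae lebesgue_rV R n, forall x, r < enorm x -> g2 x = 0}.
  by apply: filterS data_support => x h /h[].
have g20 : {ae lebesgue_rV R n, forall x, 0 <= g2 x}.
  by apply: filterS data_ge0 => x [].
pose nu : R := (n%:R - 1) / 2.
have := initial_pairing_gt0 n0 r0 (- nu) g2_L2 g2supp g20 g2_neq0.
set c := slice_pairing _ _ _ => c0.
have pairing0 (eps : R) T u v ut vt : (0 < T)%E ->
    solution p q r eps f1 g1 f2 g2 T u v ut vt ->
    slice_pairing (trunc r vt) (cone_weight (- nu) (r + 2)) 0 = eps * c.
  move=> T0 [_ _ _ _ vt2 _ _ _ _ _ _ _ ivt0 _].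
  have I0 : time_interval T 0 by split.
  exact: (scaled_initial_pairing n0 r0 (- nu) g2_L2 g2supp (Lp_measurable (vt2.1 0 I0)) ivt0).
have [pq|pq] := eqVneq p q.
  subst q.
  have [C C0 HC] := equal_exponents_growth n2 r0 p_gt1 crit.
  have m0 : 0 < 2 * p by rewrite mulr_gt0.
  have mu0 : 0 <= p - 1 < p by apply/andP; split; rewrite ?gtrBl// subr_ge0 ltW.
  have [Cf Cf0 HCf] := lifespan_from_growth p_gt1 mu0 m0 (ltW p0) C0 c0.
  (* Smallness of the data is used only as [eps <= 1], to have a negative power of [eps] bounded
     below by 1 in [lifespan_from_bound]. *)
  exists 1, Cf; split=> // eps T u v ut vt e01 T0 sol.
  have /andP[e0 _] := e01.
  have [Wv Wu] := solution_waves n0 r0 p_gt1 p2 q1 e0 T0 data_ge0 sol.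
  have [h1 h2] := HC T _ _ _ _ T0 Wv Wu.
  (* The exponent [sig * (kap - 1) / (kap - mu)] with [sig = kap = p] and [mu = p - 1]. *)
  rewrite (_ : p * (p - 1) = p * (p - 1) / (p - (p - 1))); last by field; lra.
  have pow0 (w : R -> 'rV[R]_n -> R) t x : time_interval T t -> 0 <= `|w t x| `^ p.
    by move=> _; exact: powR_ge0.
  have cu := nonneg_wave_powR Wu; have cv := nonneg_wave_powR Wv.
  apply: (HCf eps T _ e01 _ _ h1).
  - by move=> s sT; apply: addr_ge0; apply: (log_mass_ge0 _ _ sT); exact: pow0.
  - move=> s t st tT; apply: lerD.
      exact: (log_mass_le _ r0 cu (pow0 _) st tT).
    exact: (log_mass_le _ r0 cv (pow0 _) st tT).
  - by move=> s s0 sT; rewrite -(pairing0 _ _ _ _ _ _ T0 sol); exact: h2.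
have [C [m [C0 m0 HC]]] := system_growth n2 r0 p_gt1 q1 crit.
have pq1 : 1 < p * q by rewrite mulr_egt1.
have mu0 : 0 <= q * (p - 1) < p * q.
  apply/andP; split; first by rewrite mulr_ge0 ?subr_ge0 ?(ltW q0) ?(ltW p_gt1).
  by rewrite mulrC ltr_pM2r// gtrBl.
have [Cf Cf0 HCf] := lifespan_from_growth pq1 mu0 m0 (ltW (mulr_gt0 p0 q0)) C0 c0.
exists 1, Cf; split=> // eps T u v ut vt e01 T0 sol.
have /andP[e0 _] := e01.
have [Wv Wu] := solution_waves n0 r0 p_gt1 p2 q1 e0 T0 data_ge0 sol.
have [h1 h2] := HC T _ _ _ _ T0 Wv Wu.
(* The same formula with [sig = kap = p * q] and [mu = q * (p - 1)]; the denominator is [q]. *)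
have -> : p * (p * q - 1) = p * q * (p * q - 1) / (p * q - q * (p - 1)).
  rewrite (_ : p * q - q * (p - 1) = q); last by ring.
  by field; rewrite gt_eqF.
have pow0 t x : time_interval T t -> 0 <= `|trunc r u t x| `^ q.
  by move=> _; exact: powR_ge0.
apply: (HCf eps T _ e01 _ _ h1).
- by move=> s sT; apply: (log_mass_ge0 _ _ sT); exact: pow0.
- by move=> s t st tT; exact: (log_mass_le _ r0 (nonneg_wave_powR Wu) pow0 st tT).
- by move=> s s0 sT; rewrite -(pairing0 _ _ _ _ _ _ T0 sol); exact: h2.
Qed.
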